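(* Let $X$ be an affine complex variety and $\pi^+ : X^+ \to X$ be the seminormalization morphism. Then the map $$\varphi : \mathcal{K}^0(X(\mathbb{C})) \to \mathbb{C}[X^+],\qquad f \mapsto f\circ \pi^+_{\mathbb{C}}$$ is a well-defined isomorphism of rings.
   Context: An affine complex variety is $X=\operatorname{Spec}(\mathbb{C}[X])$ with $\mathbb{C}[X]$ a reduced finitely generated $\mathbb{C}$-algebra ($X$ need not be irreducible). $X(\mathbb{C})$ is the set of closed points of $X$, identified with a Zariski closed subset of some $\mathbb{C}^n$; elements of $\mathbb{C}[X]$ are identified with polynomial functions on $X(\mathbb{C})$. A function $f:X(\mathbb{C})\to\mathbb{C}$ is rational if it is regular on some Zariski dense Zariski open subset of $X(\mathbb{C})$. $\mathcal{K}^0(X(\mathbb{C}))$ is the ring of functions $f:X(\mathbb{C})\to\mathbb{C}$ that are rational and continuous on all of $X(\mathbb{C})$ for the Euclidean topology. For an integral ring extension $A\hookrightarrow B$, the seminormalization of $A$ in $B$ is $$A_B^{+}=\{b\in B \mid \forall \mathfrak{p}\in\operatorname{Spec}(A),\ b_{\mathfrak{p}}\in A_{\mathfrak{p}}+\operatorname{Rad}(B_{\mathfrak{p}})\},$$ where $B_{\mathfrak p}=(A\setminus\mathfrak p)^{-1}B$, $b_{\mathfrak p}$ is the image of $b$ in $B_{\mathfrak p}$, and $\operatorname{Rad}$ is the Jacobson radical. Let $\mathbb{C}[X]'$ be the integral closure of $\mathbb{C}[X]$ in its total ring of fractions; it is a finite $\mathbb{C}[X]$-module. The seminormalization of $X$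 is the affine variety $X^+=\operatorname{Spec}(\mathbb{C}[X]^+_{\mathbb{C}[X]'})$, so $\mathbb{C}[X^+]=\mathbb{C}[X]^+_{\mathbb{C}[X]'}$; the morphism $\pi^+:X^+\to X$ is induced by the inclusion $\mathbb{C}[X]\subset\mathbb{C}[X^+]$, and $\pi^+_{\mathbb{C}}:X^+(\mathbb{C})\to X(\mathbb{C})$ is its restriction to closed points. *)

(* Defs.v *)
(* MathComp and MathComp-Analysis.

   The field of complex numbers is R[i] for an arbitrary R : realType.
   All rings are commutative and may be zero (comPzRingType), so that the
   empty variety is not excluded; a C-algebra is a ring A with a ring morphism
   C -> A.  (MathComp's comAlgType forces 1 != 0.) *)
From HB Require Import structures.
From mathcomp Require Import all_boot all_order all_algebra ring.
From mathcomp Require Import complex.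
From mathcomp Require Import all_classical all_reals.
From mathcomp Require Import topology normedtype measure lebesgue_measure.
Set Implicit Arguments.
Unset Strict Implicit.
Unset Printing Implicit Defensive.
Import GRing.Theory Num.Theory numFieldNormedType.Exports.
Local Open Scope classical_set_scope.
Local Open Scope ring_scope.
Local Open Scope quotient_scope.
Local Open Scope complex_scope.

Section Ideals.
Variable A : comPzRingType.
Implicit Types I J : set A.

Definition is_ideal I :=
  [/\ I 0, forall a b, I a -> I b -> I (a + b) & forall a b, I b -> I (a * b)].

Definition is_prime I :=
  [/\ is_ideal I, ~ I 1 & forall a b, I (a * b) -> I a \/ I b].

Definition is_maximal I :=
  [/\ is_ideal I, ~ I 1 &
      forall J, is_ideal J -> ~ J 1 -> I `<=` J -> J = I].

Definition jacobson_radical : set A :=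
  [set a | forall I, is_maximal I -> I a].

End Ideals.

Record multset (A : comPzRingType) := Multset {
  multset_set :> A -> Prop;
  multset1 : multset_set 1;
  multsetM : forall a b, multset_set a -> multset_set b -> multset_set (a * b) }.

Section Localization.
Variables (A : comPzRingType) (S : multset A).

Definition denom := {s : A | `[< S s >]}.

Lemma denomP (s : denom) : S (sval s).
Proof. by case: s => s /= /asboolP. Qed.

Definition mkdenom s (Ss : S s) : denom := exist _ s (asboolT Ss).

Definition denom1 := mkdenom (multset1 S).
Definition denomM (s t : denom) := mkdenom (multsetM (denomP s) (denomP t)).

(* Equality of fractions a / s = b / t; the factor u is needed because
   S may contain zero divisors. *)
Definition eqfrac (x y : A * denom) : bool :=
  `[< exists2 u, S u & u * (x.1 * sval y.2) = u * (y.1 * sval x.2) >].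

Lemma eqfrac_refl : reflexive eqfrac.
Proof. by move=> x; apply/asboolP; exists 1 => //; exact: multset1. Qed.

Lemma eqfrac_sym : symmetric eqfrac.
Proof. by move=> x y; apply/asboolP/asboolP => -[u Su e]; exists u. Qed.

Lemma eqfrac_trans : transitive eqfrac.
Proof.
move=> [b t] [a s] [c r] /asboolP[u Su /= e1] /asboolP[v Sv /= e2].
apply/asboolP; exists (u * v * sval t) => /=.
  by apply: multsetM (denomP t); exact: multsetM.
have -> : u * v * sval t * (a * sval r) = v * sval r * (u * (a * sval t)) by ring.
have -> : u * v * sval t * (c * sval s) = u * sval s * (v * (c * sval t)) by ring.
by rewrite e1 -e2; ring.
Qed.

Canonical eqfrac_equiv := EquivRel eqfrac eqfrac_refl eqfrac_sym eqfrac_trans.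

Definition localization := {eq_quot eqfrac}.
HB.instance Definition _ : EqQuotient _ eqfrac localization :=
  EqQuotient.on localization.
HB.instance Definition _ := Choice.on localization.

Local Notation mk x := (\pi_localization x).

Lemma mkP x y : mk x = mk y <->
  exists2 u, S u & u * (x.1 * sval y.2) = u * (y.1 * sval x.2).
Proof.
by split=> [/eqmodP/asboolP //|h]; apply/eqmodP/asboolP.
Qed.

Let addf (x y : A * denom) :=
  (x.1 * sval y.2 + y.1 * sval x.2, denomM x.2 y.2).
Let oppf (x : A * denom) := (- x.1, x.2).
Let mulf (x y : A * denom) := (x.1 * y.1, denomM x.2 y.2).

Definition loc_add (X Y : localization) := mk (addf (repr X) (repr Y)).
Definition loc_opp (X : localization) := mk (oppf (repr X)).
Definition loc_mul (X Y : localization) := mk (mulf (repr X) (repr Y)).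

Lemma mk_repr x : exists2 u, S u &
  u * ((repr (mk x)).1 * sval x.2) = u * (x.1 * sval (repr (mk x)).2).
Proof. by apply/mkP; rewrite reprK. Qed.

Lemma loc_addE x y : loc_add (mk x) (mk y) = mk (addf x y).
Proof.
have [u Su eu] := mk_repr x; have [v Sv ev] := mk_repr y.
apply/mkP; exists (u * v); first exact: multsetM.
move: (repr _) eu (repr _) ev => [a s] /= eu [b t] /= ev.
transitivity (v * sval t * sval y.2 * (u * (a * sval x.2)) +
              u * sval s * sval x.2 * (v * (b * sval y.2))); first by ring.
by rewrite eu ev; ring.
Qed.

Lemma loc_oppE x : loc_opp (mk x) = mk (oppf x).
Proof.
have [u Su eu] := mk_repr x; apply/mkP; exists u => //=.
by rewrite !mulNr !mulrN eu.
Qed.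

Lemma loc_mulE x y : loc_mul (mk x) (mk y) = mk (mulf x y).
Proof.
have [u Su eu] := mk_repr x; have [v Sv ev] := mk_repr y.
apply/mkP; exists (u * v); first exact: multsetM.
move: (repr _) eu (repr _) ev => [a s] /= eu [b t] /= ev.
transitivity ((u * (a * sval x.2)) * (v * (b * sval y.2))); first by ring.
by rewrite eu ev; ring.
Qed.

Lemma mk_eq x y : x.1 * sval y.2 = y.1 * sval x.2 -> mk x = mk y.
Proof. by move=> e; apply/mkP; exists 1; [exact: multset1|rewrite e]. Qed.

Let loc0 := mk (0, denom1).
Let loc1 := mk (1, denom1).

Lemma loc_addA : associative loc_add.
Proof.
elim/quotW=> x; elim/quotW=> y; elim/quotW=> z.
by rewrite (loc_addE y z) (loc_addE x y) !loc_addE; apply: mk_eq => /=; ring.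
Qed.

Lemma loc_addC : commutative loc_add.
Proof.
elim/quotW=> x; elim/quotW=> y.
by rewrite !loc_addE; apply: mk_eq => /=; ring.
Qed.

Lemma loc_add0 : left_id loc0 loc_add.
Proof. by elim/quotW=> x; rewrite loc_addE; apply: mk_eq => /=; ring. Qed.

Lemma loc_addN : left_inverse loc0 loc_opp loc_add.
Proof.
by elim/quotW=> x; rewrite loc_oppE loc_addE; apply: mk_eq => /=; ring.
Qed.

HB.instance Definition _ :=
  GRing.isZmodule.Build localization loc_addA loc_addC loc_add0 loc_addN.

Lemma loc_mulA : associative loc_mul.
Proof.
elim/quotW=> x; elim/quotW=> y; elim/quotW=> z.
by rewrite (loc_mulE y z) (loc_mulE x y) !loc_mulE; apply: mk_eq => /=; ring.
Qed.

Lemma loc_mulC : commutative loc_mul.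
Proof.
elim/quotW=> x; elim/quotW=> y.
by rewrite !loc_mulE; apply: mk_eq => /=; ring.
Qed.

Lemma loc_mul1 : left_id loc1 loc_mul.
Proof. by elim/quotW=> x; rewrite loc_mulE; apply: mk_eq => /=; ring. Qed.

Lemma loc_mulDl : left_distributive loc_mul loc_add.
Proof.
elim/quotW=> x; elim/quotW=> y; elim/quotW=> z.
rewrite (loc_addE x y) (loc_mulE x z) (loc_mulE y z) loc_mulE loc_addE.
by apply: mk_eq => /=; ring.
Qed.

HB.instance Definition _ := GRing.Zmodule_isComPzRing.Build localization
  loc_mulA loc_mulC loc_mul1 loc_mulDl.

(* The fraction a / s; junk (= a / 1) when s is not in S. *)
Definition loc_frac (a s : A) : localization := mk (a, insubd denom1 s).

Definition loc_in (a : A) : localization := loc_frac a 1.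

Lemma loc_fracE a s (Ss : S s) : loc_frac a s = mk (a, mkdenom Ss).
Proof.
rewrite /loc_frac; congr (mk (_, _)); apply: val_inj.
by rewrite val_insubd; case: asboolP.
Qed.

Lemma loc_frac_eq a s b t : S s -> S t ->
  loc_frac a s = loc_frac b t <-> exists2 u, S u & u * (a * t) = u * (b * s).
Proof. by move=> Ss St; rewrite !loc_fracE mkP. Qed.

Lemma loc_fracD a s b t : S s -> S t ->
  loc_frac a s + loc_frac b t = loc_frac (a * t + b * s) (s * t).
Proof.
move=> Ss St; rewrite !loc_fracE; first exact: multsetM.
by move=> Sst; rewrite [LHS]loc_addE; apply: mk_eq.
Qed.

Lemma loc_fracN a s : S s -> - loc_frac a s = loc_frac (- a) s.
Proof. by move=> Ss; rewrite !loc_fracE [LHS]loc_oppE. Qed.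

Lemma loc_fracM a s b t : S s -> S t ->
  loc_frac a s * loc_frac b t = loc_frac (a * b) (s * t).
Proof.
move=> Ss St; rewrite !loc_fracE; first exact: multsetM.
by move=> Sst; rewrite [LHS]loc_mulE; apply: mk_eq.
Qed.

Lemma loc_in_zmod : zmod_morphism loc_in.
Proof.
move=> a b; have S1 := multset1 S.
by rewrite /loc_in loc_fracN // loc_fracD // !mulr1.
Qed.

Lemma loc_in_monoid : monoid_morphism loc_in.
Proof.
have S1 := multset1 S; split=> [|a b]; last by rewrite /loc_in loc_fracM// mulr1.
by rewrite /loc_in (loc_fracE _ S1); apply: mk_eq.
Qed.

HB.instance Definition _ :=
  GRing.isZmodMorphism.Build A localization loc_in loc_in_zmod.
HB.instance Definition _ :=
  GRing.isMonoidMorphism.Build A localization loc_in loc_in_monoid.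

End Localization.

Section IdealTheory.
Variable A : comPzRingType.
Implicit Types I J : set A.

Lemma idealB I a b : is_ideal I -> I a -> I b -> I (a - b).
Proof. by move=> [_ D M] Ia Ib; apply: D => //; rewrite -mulN1r; exact: M. Qed.

Lemma ideal_sum I n (F : 'I_n -> A) :
  is_ideal I -> (forall i, I (F i)) -> I (\sum_(i < n) F i).
Proof. by move=> [I0 D _] h; elim/big_ind: _. Qed.

Lemma ideal_expr_sub1 I x n : is_ideal I -> I (x - 1) -> I (x ^+ n - 1).
Proof.
move=> hI Ix; have [I0 D M] := hI.
elim: n => [|n ih]; first by rewrite expr0 subrr.
have -> : x ^+ n.+1 - 1 = x * (x ^+ n - 1) + (x - 1) by rewrite exprS; ring.
by apply: D => //; exact: M.
Qed.

Lemma maximal_inv I a : is_maximal I -> ~ I a -> exists b, I (b * a - 1).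
Proof.
move=> [[I0 D M] I1 mx] Ia; apply: contrapT => hb.
pose J := [set y | exists z b, I z /\ y = z + b * a].
suff JI : J = I.
  by apply: Ia; rewrite -JI; exists 0, 1; split=> //; ring.
apply: mx; last by move=> y Iy; exists y, 0; split=> //; ring.
- split; first by exists 0, 0; split=> //; ring.
    move=> _ _ [z [b [Iz ->]]] [z' [b' [Iz' ->]]].
    by exists (z + z'), (b + b'); split; [exact: D|ring].
  move=> c _ [z [b [Iz ->]]].
  by exists (c * z), (c * b); split; [exact: M|ring].
- move=> [z [b [Iz e]]]; apply: hb; exists b.
  have -> : b * a - 1 = - z by rewrite e; ring.
  by rewrite -mulN1r; exact: M.
Qed.

Lemma maximal_prime I : is_maximal I -> is_prime I.
Proof.
move=> mI; have [hI I1 _] := mI; have [I0 D M] := hI.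
split=> // a b Iab; have [|na] := pselect (I a); first by left.
right; have [c Ic] := maximal_inv mI na.
have -> : b = c * (a * b) - b * (c * a - 1) by ring.
by apply: idealB => //; exact: M.
Qed.

Lemma jacobson_radical_ideal : is_ideal (@jacobson_radical A).
Proof.
split=> [I [[]]|a b ha hb I mI|a b hb I mI] //; have [[_ D M] _ _] := mI.
- by apply: D; [exact: ha|exact: hb].
- by apply: M; exact: hb.
Qed.

End IdealTheory.

(* The library's integralOver, for rings that may be zero: see integral_eltE. *)
Definition integral_elt (A B : comPzRingType) (f : A -> B) (b : B) :=
  exists n (c : 'I_n -> A), b ^+ n + \sum_(i < n) f (c i) * b ^+ i = 0.

Lemma integral_eltE (A B : comNzRingType) (f : {rmorphism A -> B}) b :
  integral_elt f b <-> integralOver f b.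
Proof.
split=> [[n [c e]]|[p pm]].
  have sz : (size (\sum_(i < n) (c i)%:P * 'X^i)%R <= n)%N.
    apply: (leq_trans (size_sum _ _ _)); apply/bigmax_leqP => i _.
    by rewrite mul_polyC (leq_trans (size_scale_leq _ _)) ?size_polyXn.
  exists ('X^n + \sum_(i < n) (c i)%:P * 'X^i).
    by rewrite monicE lead_coefDl ?lead_coefXn // size_polyXn.
  rewrite /root rmorphD rmorph_sum /= map_polyXn hornerD hornerXn horner_sum.
  apply/eqP; rewrite -[RHS]e; congr (_ + _); apply: eq_bigr => i _.
  by rewrite rmorphM /= map_polyC map_polyXn hornerM hornerC hornerXn.
rewrite /root => /eqP.
rewrite (@horner_coef_wide _ (size p)); last exact: size_poly.
move: (monic_neq0 pm); rewrite -size_poly_gt0.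
case E: (size p) => [//|n] _; rewrite big_ord_recr /= => e.
exists n, (fun i => p`_i); rewrite -[RHS]e [LHS]addrC; congr (_ + _).
  by apply: eq_bigr => i _; rewrite coef_map.
by rewrite coef_map /=; move/monicP: pm; rewrite lead_coefE E /= => ->; rewrite rmorph1 mul1r.
Qed.

Lemma integral_rmorph_elt (A B : comPzRingType) (f : {rmorphism A -> B}) a :
  integral_elt f (f a).
Proof.
exists 1%N, (fun=> - a); rewrite big_ord1 expr0 expr1 mulr1 rmorphN; ring.
Qed.

Section IntegralElements.
Variables (A B : comPzRingType) (f : {rmorphism A -> B}).

Lemma integral_subM x y : integral_elt f x -> integral_elt f y ->
  integral_elt f (x - y) /\ integral_elt f (x * y).
Proof.
move=> ix iy; have [e|ne] := eqVneq (1 : B) 0.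
  by split; exists 0%N, (fun=> 0); rewrite big_ord0 addr0 expr0.
have neA : (1 : A) != 0.
  by apply/eqP => e; move: ne; rewrite -(rmorph1 f) e rmorph0 eqxx.
pose A' : comNzRingType := HB.pack (GRing.ComPzRing.sort A)
  (GRing.ComPzRing.class A) (GRing.PzSemiRing_isNonZero.Build A neA).
pose B' : comNzRingType := HB.pack (GRing.ComPzRing.sort B)
  (GRing.ComPzRing.class B) (GRing.PzSemiRing_isNonZero.Build B ne).
pose g : A' -> B' := f.
have ga : zmod_morphism g by exact: (rmorphB f).
have gm : monoid_morphism g by split; [exact: (rmorph1 f)|exact: (rmorphM f)].
pose g' : {rmorphism A' -> B'} := HB.pack g
   (GRing.isZmodMorphism.Build A' B' g ga) (GRing.isMonoidMorphism.Build A' B' g gm).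
move: ix iy => /(integral_eltE g') ix /(integral_eltE g') iy.
by split; apply/(integral_eltE g'); [exact: integral_sub|exact: integral_mul].
Qed.

End IntegralElements.

Definition integral_ext (A B : comPzRingType) (f : A -> B) :=
  forall b, integral_elt f b.

Lemma contract_maximal (A B : comPzRingType) (f : {rmorphism A -> B})
    (I : set B) : integral_ext f -> is_maximal I -> is_maximal (f @^-1` I).
Proof.
move=> fi mI; have [hI I1 _] := mI; have [I0 D M] := hI.
have hP : is_ideal (f @^-1` I).
  split=> /= [|a b|a b]; rewrite ?rmorph0 ?rmorphD ?rmorphM //;
  [exact: D|exact: M].
split=> //=; first by rewrite rmorph1.
move=> J hJ J1 IJ; apply/seteqP; split=> // a Ja; apply: contrapT => /= na.
have [b Ib] := maximal_inv mI na.
have [n [c e]] := fi b; have [J0 JD JM] := hJ.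
pose s := \sum_(i < n) c i * a ^+ (n - i).
have Js : J s.
  apply: ideal_sum => // i; apply: (JM).
  have -> : (n - i = (n - i).-1.+1)%N by rewrite prednK // subn_gt0.
  by rewrite exprSr; exact: JM.
suff : J ((1 + s) - s) by rewrite addrK.
apply: (idealB hJ _ Js); apply: IJ => /=.
rewrite rmorphD rmorph1 rmorph_sum /=.
have -> : 1 + \sum_(i < n) f (c i * a ^+ (n - i)) =
   - ((b * f a) ^+ n - 1 + \sum_(i < n) f (c i * a ^+ (n - i)) * ((b * f a) ^+ i - 1)).
  have h : f a ^+ n * (b ^+ n + \sum_(i < n) f (c i) * b ^+ i) = 0.
    by rewrite e mulr0.
  rewrite -[LHS]subr0 -[X in _ - X = _]h mulrDr mulr_sumr.
  under [in RHS]eq_bigr do rewrite mulrBr mulr1.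
  rewrite sumrB exprMn.
  have -> : \sum_(i < n) f (c i * a ^+ (n - i)) * (b * f a) ^+ i =
     \sum_(i < n) f a ^+ n * (f (c i) * b ^+ i).
    apply: eq_bigr => i _; rewrite rmorphM rmorphXn exprMn.
    have -> : f a ^+ n = f a ^+ (n - i) * f a ^+ i.
      by rewrite -exprD subnK // ltnW.
    ring.
  ring.
rewrite -[X in I X]mulN1r; apply: (M); apply: (D); first exact: ideal_expr_sub1.
by apply: ideal_sum => // i; apply: (M); exact: ideal_expr_sub1.
Qed.

Lemma real_uncountable (R : realType) : ~ countable [set: R].
Proof.
move=> h; have : lebesgue_measure (`[0, 1]%classic : set R) = 0%E.
  by apply: countable_lebesgue_measure0; apply: sub_countable h; exact: subset_card_le.
rewrite lebesgue_measure_itv /= lte01 => /eqP.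
by rewrite oppr0 adde0 -[0%E]/(0%:E) eqe oner_eq0.
Qed.

Definition is_subalgebra (C A : comPzRingType) (k : C -> A) (T : set A) :=
  [/\ forall c, T (k c), forall a b, T a -> T b -> T (a + b) &
      forall a b, T a -> T b -> T (a * b)].

Definition generates (C A : comPzRingType) (k : C -> A) n (x : 'I_n -> A) :=
  forall T : set A, is_subalgebra k T -> (forall i, T (x i)) -> forall a, T a.

Section Nullstellensatz.
Variables (R : realType) (A : comPzRingType) (k : {rmorphism R[i] -> A}).

Lemma poly_eval (a : A) : exists ev : {rmorphism {poly R[i]} -> A},
  ev 'X = a /\ forall c, ev c%:P = k c.
Proof.
have [e|ne] := eqVneq (1 : A) 0.
  have z (y : A) : y = 0 by rewrite -[y]mulr1 e mulr0.
  exists (k \o horner_eval 0 : {rmorphism _ -> _}).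
  by split=> [|c]; rewrite [LHS]z [RHS]z.
pose A' : comNzRingType := HB.pack (GRing.ComPzRing.sort A)
  (GRing.ComPzRing.class A) (GRing.PzSemiRing_isNonZero.Build A ne).
pose g : R[i] -> A' := k.
have ga : zmod_morphism g by exact: (rmorphB k).
have gm : monoid_morphism g by split; [exact: (rmorph1 k)|exact: (rmorphM k)].
pose g' : {rmorphism R[i] -> A'} := HB.pack g
  (GRing.isZmodMorphism.Build R[i] A' g ga)
  (GRing.isMonoidMorphism.Build R[i] A' g gm).
have cg : commr_rmorph g' (a : A') by move=> c; exact: mulrC.
pose h : {rmorphism {poly R[i]} -> A'} := horner_morph cg.
pose l : {poly R[i]} -> A := h.
have la : zmod_morphism l by exact: (rmorphB h).
have lm : monoid_morphism l by split; [exact: (rmorph1 h)|exact: (rmorphM h)].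
pose l' : {rmorphism {poly R[i]} -> A} := HB.pack l
  (GRing.isZmodMorphism.Build {poly R[i]} A l la)
  (GRing.isMonoidMorphism.Build {poly R[i]} A l lm).
exists l'; split; first exact: (horner_morphX cg).
exact: (horner_morphC cg).
Qed.

Definition in_span (s : seq A) (a : A) :=
  exists v : 'rV[R[i]]_(size s), a = \sum_(j < size s) k (v 0 j) * s`_j.

Lemma in_span_sub s a b : in_span s a -> in_span s b -> in_span s (a + b).
Proof.
move=> [v ->] [w ->]; exists (v + w); rewrite -big_split; apply: eq_bigr => j _.
by rewrite mxE rmorphD mulrDl.
Qed.

Lemma in_span0 s : in_span s 0.
Proof. by exists 0; rewrite big1 // => j _; rewrite mxE rmorph0 mul0r. Qed.

Lemma in_span_mem s a : a \in s -> in_span s a.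
Proof.
move=> /(nthP 0)[j js <-]; exists (\row_l (l == Ordinal js)%:R).
rewrite (bigD1 (Ordinal js)) //= mxE eqxx rmorph1 mul1r big1 ?addr0 // => l ne.
by rewrite mxE (negPf ne) rmorph0 mul0r.
Qed.

Lemma in_spanZ s a c : in_span s a -> in_span s (k c * a).
Proof.
move=> [v ->]; exists (c *: v); rewrite mulr_sumr; apply: eq_bigr => j _.
by rewrite mxE rmorphM mulrA.
Qed.

Lemma in_span_le s t a : {subset s <= t} -> in_span s a -> in_span t a.
Proof.
move=> st [v ->]; elim/big_ind: _ => [|y z|j _]; first exact: in_span0.
  exact: in_span_sub.
by apply: in_spanZ; apply: in_span_mem; apply: st; exact: mem_nth.
Qed.

Variables (n : nat) (x : 'I_n -> A).
Hypothesis genx : generates k x.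

Fixpoint monomials (d : nat) : seq A :=
  if d is e.+1 then
    monomials e ++ [seq x i * y | i <- enum 'I_n, y <- monomials e]
  else [:: 1].

Lemma monomials_sub d e : (d <= e)%N -> {subset monomials d <= monomials e}.
Proof.
elim: e => [|e ih]; first by rewrite leqn0 => /eqP ->.
rewrite leq_eqVlt => /predU1P[-> //|]; rewrite ltnS => /ih h y /h /=.
by rewrite mem_cat => ->.
Qed.

Let U : set A := [set a | exists d, in_span (monomials d) a].

Lemma monomials_span a : exists d, in_span (monomials d) a.
Proof.
suff : forall z, U z -> U (a * z).
  move/(_ 1); rewrite mulr1; apply; exists 0%N; apply: in_span_mem.
  by rewrite inE.
have UD y z : U y -> U z -> U (y + z).
  move=> [d hd] [e he]; exists (maxn d e); apply: in_span_sub => //.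
    by apply: in_span_le hd; apply: monomials_sub; exact: leq_maxl.
  by apply: in_span_le he; apply: monomials_sub; exact: leq_maxr.
have U0 : U 0 by exists 0%N; exact: in_span0.
apply: (genx (T := [set a | forall z, U z -> U (a * z)])) => [|i].
  split=> /= [c z [d hd]|b c hb hc z Uz|b c hb hc z Uz].
  - by exists d; exact: in_spanZ.
  - by rewrite mulrDl; apply: UD; [exact: hb|exact: hc].
  - by rewrite -mulrA; apply: hb; exact: hc.
move=> z [d [v ->]] /=; rewrite mulr_sumr; elim/big_ind: _ => // j _.
rewrite mulrCA; exists d.+1; apply: in_spanZ; apply: in_span_mem => /=.
rewrite mem_cat; apply/orP; right; apply/allpairsP.
by exists (i, (monomials d)`_j) => /=; rewrite mem_enum mem_nth.
Qed.

Lemma dependent_mod (M : set A) (s : seq A) (a : A) (B : R -> A) (cs : seq R) :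
  is_maximal M -> uniq cs -> (size s < size cs)%N ->
  (forall c, c \in cs -> M (B c * (a - k c%:C) - 1)) ->
  (forall c, c \in cs -> in_span s (B c)) ->
  exists c, M (a - k c).
Proof.
move=> mM ucs sz hB sB; have [hM M1 _] := mM; have [M0 MD MM] := hM.
have [_ _ Mp] := maximal_prime mM.
pose N := size cs.
pose c (j : 'I_N) : R := cs`_j.
have csj j : c j \in cs by exact: mem_nth.
have /fin_all_exists[V hV] (j : 'I_N) := sB _ (csj j).
pose W : 'M[R[i]]_(N, size s) := \matrix_(j, l) V j 0 l.
have kn : kermx W != 0.
  rewrite kermx_eq0 /row_free neq_ltn; apply/orP; left.
  exact: leq_ltn_trans (rank_leq_col W) sz.
have [lam [lamW lam0]] : exists lam : 'rV_N, lam *m W = 0 /\ lam != 0.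
  have /rowV0Pn[v /sub_kermxP vW v0] := kn; by exists v.
have sumB : \sum_j k (lam 0 j) * B (c j) = 0.
  under eq_bigr do rewrite hV mulr_sumr.
  rewrite exchange_big /= big1 // => l _.
  under eq_bigr do rewrite mulrA -rmorphM.
  rewrite -mulr_suml -rmorph_sum.
  have -> : \sum_(j < N) lam 0 j * V j 0 l = (lam *m W) 0 l.
    by rewrite mxE; apply: eq_bigr => j _; rewrite mxE.
  by rewrite lamW mxE rmorph0 mul0r.
pose q := \sum_j lam 0 j *: \prod_(i | i != j) ('X - (c i)%:C%:P).
have [ev [evX evC]] := poly_eval a.
have Mq : M (ev q).
  pose P := \prod_j (a - k (c j)%:C).
  suff : M (ev q - P * \sum_j k (lam 0 j) * B (c j)).
    by rewrite sumB mulr0 subr0.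
  rewrite rmorph_sum mulr_sumr -sumrB /=; apply: ideal_sum => // j.
  rewrite -mul_polyC rmorphM /= evC rmorph_prod /=.
  under eq_bigr do rewrite rmorphB /= evX evC.
  have -> : P = (a - k (c j)%:C) * \prod_(i < N | i != j) (a - k (c i)%:C) by rewrite /P (bigD1 j).
  set p := \prod_(i < N | _) _.
  have -> : k (lam 0 j) * p - (a - k (c j)%:C) * p * (k (lam 0 j) * B (c j)) =
    (- (k (lam 0 j) * p)) * (B (c j) * (a - k (c j)%:C) - 1) by ring.
  by apply: MM; exact: hB.
have q0 : q != 0.
  have [j lj] : exists j, lam 0 j != 0 by exact/rV0Pn.
  apply/eqP => e; have : q.[(c j)%:C] = 0 by rewrite e horner0.
  rewrite /q horner_sum (bigD1 j) //= [X in _ + X]big1 ?addr0; last first.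
    move=> i ij;  rewrite hornerZ horner_prod (bigD1 j) 1?eq_sym //=.
    by rewrite hornerXsubC subrr mul0r mulr0.
  rewrite hornerZ horner_prod => /eqP; rewrite mulf_eq0 (negPf lj) /=.
  move=> /prodf_eq0[l lj2]; rewrite hornerXsubC subr_eq0.
  rewrite (inj_eq (@complexI R)) nth_uniq // => /eqP e'.
  by move: lj2; rewrite (ord_inj e') eqxx.
have [r qr] := closed_field_poly_normal q.
move: Mq; rewrite qr -mul_polyC rmorphM /= evC => /Mp[Mk|].
  exfalso; apply: M1; have : M (k (lead_coef q)^-1 * k (lead_coef q)) by exact: MM.
  by rewrite -rmorphM mulVf ?lead_coef_eq0 // rmorph1.
elim: r {qr} => [|z r ih]; first by rewrite big_nil rmorph1.
rewrite big_cons rmorphM => /Mp[|/ih//].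
by rewrite rmorphB /= evX evC => h; exists z.
Qed.

Lemma residue_field (M : set A) (a : A) :
  is_maximal M -> exists c, M (a - k c).
Proof.
move=> mM; apply: contrapT => nM.
have /choice[B hB] c : exists b, M (b * (a - k c%:C) - 1).
  by apply: maximal_inv mM _ => h; apply: nM; exists c%:C.
pose D d := [set c : R | in_span (monomials d) (B c)].
have [d Dd] : exists d, infinite_set (D d).
  apply: contrapT => h; apply: (@real_uncountable R).
  have -> : [set: R] = \bigcup_d D d.
    apply/seteqP; split=> // c _; have [d hd] := monomials_span (B c).
    by exists d.
  apply: bigcup_countable => // d _; apply: finite_set_countable.
  by apply: contrapT => hd; apply: h; exists d.
have [F FD sF] := infinite_set_fset (size (monomials d)).+1 Dd.
apply: nM; have Fs c : c \in finmap.enum_fset F -> D d c by move=> cF; exact: FD.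
exact: (dependent_mod mM (finmap.fset_uniq F) sF (fun c _ => hB c) Fs).
Qed.

End Nullstellensatz.

Record spectrum (A : comPzRingType) := Spectrum {
  prime_ideal :> A -> Prop;
  prime_idealP : is_prime prime_ideal }.

Record closed_point (A : comPzRingType) := ClosedPoint {
  point_ideal :> A -> Prop;
  point_idealP : is_maximal point_ideal }.

HB.instance Definition _ (A : comPzRingType) :=
  gen_eqMixin (closed_point A).
HB.instance Definition _ (A : comPzRingType) :=
  gen_choiceMixin (closed_point A).

Section TotalFractions.
Variable A : comPzRingType.

Definition regular (s : A) : Prop := forall a, s * a = 0 -> a = 0.

Lemma regular1 : regular 1.
Proof. by move=> a; rewrite mul1r. Qed.

Lemma regularM s t : regular s -> regular t -> regular (s * t).
Proof. by move=> hs ht a; rewrite -mulrA => /hs/ht. Qed.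

Definition regular_elts : multset A := Multset regular1 regularM.

Definition total_fractions := localization regular_elts.
HB.instance Definition _ := GRing.ComPzRing.on total_fractions.

Definition to_fractions : {rmorphism A -> total_fractions} :=
  @loc_in A regular_elts.

Definition integral_pred : pred total_fractions :=
  fun b => `[< integral_elt to_fractions b >].

Lemma integral_pred_subring : GRing.subring_closed integral_pred.
Proof.
split=> [|b c /asboolP ib /asboolP ic|b c /asboolP ib /asboolP ic];
  apply/asboolP.
- by rewrite -(rmorph1 to_fractions); exact: integral_rmorph_elt.
- exact: (integral_subM ib ic).1.
- exact: (integral_subM ib ic).2.
Qed.

(* The integral closure of A in its total ring of fractions. *)
Definition normalization := {b : total_fractions | integral_pred b}.
HB.instance Definition _ := SubChoice.on normalization.
HB.instance Definition _ := GRing.SubChoice_isSubComPzRing.Build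
  total_fractions integral_pred normalization integral_pred_subring.

Definition to_normalization (a : A) : normalization :=
  exist _ (to_fractions a) (asboolT (integral_rmorph_elt to_fractions a)).

Lemma to_normalization_zmod : zmod_morphism to_normalization.
Proof. by move=> a b; apply: val_inj; rewrite rmorphB /= rmorphB. Qed.

Lemma to_normalization_monoid : monoid_morphism to_normalization.
Proof.
split=> [|a b]; apply: val_inj; first by rewrite rmorph1 /= rmorph1.
by rewrite /= rmorphM.
Qed.

HB.instance Definition _ := GRing.isZmodMorphism.Build A normalization
  to_normalization to_normalization_zmod.
HB.instance Definition _ := GRing.isMonoidMorphism.Build A normalization
  to_normalization to_normalization_monoid.

Lemma to_normalization_integral : integral_ext to_normalization.
Proof.
move=> [b ib]; have [n [c e]] := asboolP _ ib.
exists n, c; apply: val_inj; rewrite rmorphD rmorphXn rmorph_sum rmorph0 -[RHS]e.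
congr (_ + _); apply: eq_bigr => i _; by rewrite rmorphM rmorphXn.
Qed.

End TotalFractions.

Section Seminormalization.
Variables (A B : comPzRingType) (f : {rmorphism A -> B}).

Definition in_prime_compl (p : spectrum A) (b : B) : Prop :=
  exists2 s, ~ p s & f s = b.

Lemma prime_compl1 p : in_prime_compl p 1.
Proof. by exists 1; rewrite ?rmorph1 //; case: (prime_idealP p). Qed.

Lemma prime_complM p b c :
  in_prime_compl p b -> in_prime_compl p c -> in_prime_compl p (b * c).
Proof.
move=> [s ps <-] [t pt <-]; exists (s * t); rewrite ?rmorphM //.
by case: (prime_idealP p) => _ _ h /h[].
Qed.

Definition prime_compl (p : spectrum A) : multset B :=
  Multset (prime_compl1 p) (@prime_complM p).

(* B_p = (A \ p)^-1 B *)
Definition loc_at p := localization (prime_compl p).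
HB.instance Definition _ p := GRing.ComPzRing.on (loc_at p).

(* A_p, seen inside B_p *)
Definition loc_base p : set (loc_at p) :=
  [set y | exists a s, ~ p s /\ y = loc_frac (prime_compl p) (f a) (f s)].

Definition seminorm_pred : pred B := fun b =>
  `[< forall p, exists y r : loc_at p,
        [/\ loc_base y, jacobson_radical r & loc_in (prime_compl p) b = y + r] >].

Lemma seminorm_rmorph a : seminorm_pred (f a).
Proof.
apply/asboolP => p; exists (loc_in (prime_compl p) (f a)), 0.
split; last by rewrite addr0.
  exists a, 1; rewrite rmorph1; split=> //; by case: (prime_idealP p).
by have [] := jacobson_radical_ideal (loc_at p).
Qed.

Lemma loc_base_subM p (y z : loc_at p) : loc_base y -> loc_base z ->
  loc_base (y - z) /\ loc_base (y * z).
Proof.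
move=> [a [s [ps ->]]] [b [t [pt ->]]].
have Ss : prime_compl p (f s) by exists s.
have St : prime_compl p (f t) by exists t.
have pst : ~ p (s * t) by case: (prime_idealP p) => _ _ h /h[].
split; [exists (a * t - b * s), (s * t)|exists (a * b), (s * t)]; split=> //.
  by rewrite loc_fracN // loc_fracD // !rmorphB !rmorphM mulNr.
by rewrite loc_fracM // !rmorphM.
Qed.

Lemma seminorm_subring : GRing.subring_closed seminorm_pred.
Proof.
split=> [|b c /asboolP sb /asboolP sc|b c /asboolP sb /asboolP sc].
- by rewrite -(rmorph1 f); exact: seminorm_rmorph.
- apply/asboolP => p.
  have [y [r [Ay Rr e]]] := sb p; have [y' [r' [Ay' Rr' e']]] := sc p.
  exists (y - y'), (r - r'); split; first exact: (loc_base_subM Ay Ay').1.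
    exact: idealB (jacobson_radical_ideal _) Rr Rr'.
  by rewrite rmorphB /= e e'; ring.
- apply/asboolP => p.
  have [y [r [Ay Rr e]]] := sb p; have [y' [r' [Ay' Rr' e']]] := sc p.
  have [_ D M] := jacobson_radical_ideal (loc_at p).
  exists (y * y'), (y * r' + (y' * r + r * r')).
  split; first exact: (loc_base_subM Ay Ay').2.
    by apply: (D); [exact: (M)|apply: (D); exact: (M)].
  by rewrite rmorphM /= e e'; ring.
Qed.

Definition seminormalization := {b : B | seminorm_pred b}.
HB.instance Definition _ := SubChoice.on seminormalization.
HB.instance Definition _ := GRing.SubChoice_isSubComPzRing.Build
  B seminorm_pred seminormalization seminorm_subring.

Definition to_seminormalization (a : A) : seminormalization :=
  exist _ (f a) (seminorm_rmorph a).

Lemma to_seminormalization_zmod : zmod_morphism to_seminormalization.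
Proof. by move=> a b; apply: val_inj; rewrite rmorphB /= rmorphB. Qed.

Lemma to_seminormalization_monoid : monoid_morphism to_seminormalization.
Proof.
split=> [|a b]; apply: val_inj; first by rewrite rmorph1 /= rmorph1.
by rewrite /= rmorphM.
Qed.

HB.instance Definition _ := GRing.isZmodMorphism.Build A seminormalization
  to_seminormalization to_seminormalization_zmod.
HB.instance Definition _ := GRing.isMonoidMorphism.Build A seminormalization
  to_seminormalization to_seminormalization_monoid.

Lemma to_seminormalization_integral :
  integral_ext f -> integral_ext to_seminormalization.
Proof.
move=> fi [b sb]; have [n [c e]] := fi b.
exists n, c; apply: val_inj; rewrite rmorphD rmorphXn rmorph_sum rmorph0 -[RHS]e.
congr (_ + _); apply: eq_bigr => i _; by rewrite rmorphM rmorphXn.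
Qed.

End Seminormalization.

(* The map on closed points induced by an integral morphism f : A -> B. *)
Definition contract (A B : comPzRingType) (f : {rmorphism A -> B})
    (fi : integral_ext f) (m : closed_point B) : closed_point A :=
  ClosedPoint (contract_maximal fi (point_idealP m)).

Section Variety.
Variable R : realType.

(* The coordinate functions [coord] are the closed embedding of the variety
   into the affine space of dimension [embdim]; besides witnessing finite
   generation, they only serve to define the Euclidean topology. *)
Record affine_variety := AffineVariety {
  coord_ring :> comPzRingType;
  scalar : {rmorphism R[i] -> coord_ring};
  coord_ring_reduced : forall (a : coord_ring) n, a ^+ n = 0 -> a = 0;
  embdim : nat;
  coord : 'I_embdim -> coord_ring;
  coord_generates : generates scalar coord }.

(* The value of a at the closed point m: the class of a in the residue field,
   which is C for an algebra of finite type (Nullstellensatz, residue_field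
   above), hence also for an algebra integral over one of finite type.  The
   default 0 is never used for such algebras. *)
Definition value (A : comPzRingType) (k : R[i] -> A) (a : A)
    (m : closed_point A) : R[i] := xget 0 [set c | m (a - k c)].

Section Functions.
Variable X : affine_variety.
Local Notation pt := (closed_point X).
Local Notation val_at := (value (scalar X)).

Lemma valueP a (m : pt) c : m (a - scalar X c) <-> val_at a m = c.
Proof.
have [hI I1 _] := point_idealP m; have [I0 D M] := hI.
have h : m (a - scalar X (val_at a m)).
  rewrite /value; case: xgetP => // e.
  have [z hz] := residue_field (@coord_generates X) a (point_idealP m).
  by case: (e z).
split=> [mc|<- //]; apply/eqP; rewrite -subr_eq0; apply/negPn/negP => ne.
apply: I1; rewrite -(rmorph1 (scalar X)) -(mulVf ne) rmorphM; apply: (M).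
have -> : scalar X (val_at a m - c) =
  (a - scalar X c) - (a - scalar X (val_at a m)) by rewrite rmorphB; ring.
exact: (idealB hI).
Qed.

Lemma valueB a b m : val_at (a - b) m = val_at a m - val_at b m.
Proof.
apply/valueP; have [hI _ _] := point_idealP m.
have ha := (valueP a m _).2 erefl; have hb := (valueP b m _).2 erefl.
by rewrite rmorphB (_ : _ - _ = (a - scalar X (val_at a m)) -
  (b - scalar X (val_at b m))); [exact: (idealB hI)|ring].
Qed.

Lemma valueM a b m : val_at (a * b) m = val_at a m * val_at b m.
Proof.
apply/valueP; have [[_ D M] _ _] := point_idealP m.
have ha := (valueP a m _).2 erefl; have hb := (valueP b m _).2 erefl.
rewrite rmorphM (_ : _ - _ = b * (a - scalar X (val_at a m)) +
  scalar X (val_at a m) * (b - scalar X (val_at b m))); last by ring.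
by apply: D; exact: M.
Qed.

Lemma value1 m : val_at 1 m = 1.
Proof.
by apply/valueP; rewrite rmorph1 subrr; have [[]] := point_idealP m.
Qed.

Definition zariski_open (U : set pt) :=
  exists I : set X, U = [set m : pt | ~ I `<=` m].

Definition zariski_dense (D : set pt) :=
  forall U, zariski_open U -> U !=set0 -> (U `&` D) !=set0.

Definition regular_on (U : set pt) (f : pt -> R[i]) :=
  forall m, U m -> exists W a s,
    [/\ zariski_open W, W m, W `<=` U &
        forall q, W q -> val_at s q != 0 /\ f q = val_at a q / val_at s q].

Definition rational (f : pt -> R[i]) :=
  exists U, [/\ zariski_open U, zariski_dense U & regular_on U f].

Definition embedding (m : pt) : 'rV[R[i]^o]_(embdim X) :=
  \row_j val_at (coord j) m.

Definition euclidean_continuous (f : pt -> R[i]) :=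
  continuous (f : initial_topology embedding -> R[i]^o).

Lemma zariski_openT : zariski_open setT.
Proof.
exists setT; apply/seteqP; split=> // m _ h.
by have [_ I1 _] := point_idealP m; apply: I1; exact: h.
Qed.

Lemma zariski_openI U V :
  zariski_open U -> zariski_open V -> zariski_open (U `&` V).
Proof.
move=> [I ->] [J ->]; exists [set z | exists a b, [/\ I a, J b & z = a * b]].
apply/seteqP; split=> m /=.
  move=> [/existsNP[a /not_implyP[Ia ma]] /existsNP[b /not_implyP[Jb mb]]] h.
  have [_ _ mp] := maximal_prime (point_idealP m).
  by have /mp[] : m (a * b) by apply: h; exists a, b.
have [[_ _ M] _ _] := point_idealP m.
move=> h; split=> h'; apply: h => _ [a [b [Ia Jb ->]]].
  by rewrite mulrC; apply: M; exact: h'.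
by apply: M; exact: h'.
Qed.

Lemma zariski_denseI U V : zariski_open U -> zariski_dense U ->
  zariski_dense V -> zariski_dense (U `&` V).
Proof.
move=> oU dU dV W oW W0; rewrite setIA.
by apply: dV; [exact: zariski_openI|exact: dU].
Qed.

Lemma rational1 : rational (cst 1).
Proof.
exists setT; split; first exact: zariski_openT.
  by move=> U _ [m Um]; exists m.
move=> m _; exists setT, 1, 1; split=> //; first exact: zariski_openT.
by move=> q _; rewrite value1 oner_neq0 divr1.
Qed.

Lemma rational_subM f g : rational f -> rational g ->
  rational (f - g) /\ rational (f * g).
Proof.
move=> [U [oU dU rf]] [V [oV dV rg]].
have UV := zariski_openI oU oV; have dUV := zariski_denseI oU dU dV.
have H m : (U `&` V) m -> exists W a s b t, [/\ zariski_open W, W m, W `<=` U `&` V &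
    forall q, W q -> [/\ val_at s q != 0, val_at t q != 0,
       f q = val_at a q / val_at s q & g q = val_at b q / val_at t q]].
  move=> [/rf[W [a [s [oW Wm WU hW]]]] /rg[W' [b [t [oW' Wm' WU' hW']]]]].
  exists (W `&` W'), a, s, b, t; split=> //; first exact: zariski_openI.
    by move=> q [/WU ? /WU' ?].
  by move=> q [/hW[? ?] /hW'[? ?]].
split; exists (U `&` V); split=> // m /H[W [a [s [b [t [oW Wm WU hW]]]]]].
  exists W, (a * t - b * s), (s * t); split=> // q /hW[s0 t0 ef eg].
  rewrite valueB !valueM mulf_neq0 //; split=> //.
  by rewrite -[LHS]/(f q - g q) ef eg -mulNr addf_div // mulNr.
exists W, (a * b), (s * t); split=> // q /hW[s0 t0 ef eg].
rewrite !valueM mulf_neq0 //; split=> //.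
by rewrite -[LHS]/(f q * g q) ef eg mulf_div.
Qed.

Definition K0_pred : pred (pt -> R[i]) := fun f =>
  `[< rational f /\ euclidean_continuous f >].

Lemma K0_subring : GRing.subring_closed K0_pred.
Proof.
split=> [|f g /asboolP[rf cf] /asboolP[rg cg]|f g /asboolP[rf cf] /asboolP[rg cg]];
  apply/asboolP; split.
- exact: rational1.
- exact: (@cst_continuous (initial_topology embedding) R[i]^o 1).
- exact: (rational_subM rf rg).1.
- by move=> m; have := @continuousB R[i] R[i]^o _ _ _ m (cf m) (cg m).
- exact: (rational_subM rf rg).2.
- by move=> m; have := @continuousM R[i] _ _ _ m (cf m) (cg m).
Qed.

(* The ring of rational functions that are continuous on the whole of X(C),
   with the pointwise operations. *)
Definition K0 := {f : pt -> R[i] | K0_pred f}.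
HB.instance Definition _ := SubChoice.on K0.
HB.instance Definition _ := GRing.SubChoice_isSubComPzRing.Build
  (pt -> R[i]) K0_pred K0 K0_subring.

(* C[X^+] *)
Definition seminorm_ring := seminormalization (@to_normalization X).
HB.instance Definition _ := GRing.ComPzRing.on seminorm_ring.

Definition to_seminorm_ring : {rmorphism X -> seminorm_ring} :=
  to_seminormalization (@to_normalization X).

Lemma to_seminorm_ring_integral : integral_ext to_seminorm_ring.
Proof. exact: to_seminormalization_integral (@to_normalization_integral X). Qed.

(* pi^+ on closed points *)
Definition seminorm_map : closed_point seminorm_ring -> pt :=
  contract to_seminorm_ring_integral.

Definition seminorm_scalar : {rmorphism R[i] -> seminorm_ring} :=
  to_seminorm_ring \o scalar X.

End Functions.
End Variety.

(* Main.v *)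
(* A regular fraction g = a / s which agrees with a continuous function f on the points of X
   lies in C[X^+] because a Zariski dense open set is dense for the Euclidean topology.
   For a domain D over C this density is proved by Noether normalization over a polynomial
   ring S: given a point eta, an element b separates eta in its fibre; since S is factorial
   the relations of b over S are generated by a monic polynomial, and continuity of roots and
   lying over produce points near eta outside any given hypersurface.  Hence g is integral
   over C[X] (otherwise 1 / g would tend to 0 near some point, where f is bounded), g takes
   the value f(m) at every point of Spec C[X]' over m, and an element of C[X]' which is
   constant on the fibres lies in C[X^+]: modulo a prime P, its minimal polynomial has degree
   one, as all the roots at a general point of V(P) are values at points over it.
   Conversely g in C[X^+] is constant on the fibres over X(C), and if g takes the value t
   over m then a power of g - t is a combination of elements of C[X] vanishing at m, so the
   function induced by g is continuous. *)
Require Import Defs.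
From HB Require Import structures.
From mathcomp Require Import all_boot all_order all_algebra complex.
From mathcomp Require Import ring_quotient ring.
From mathcomp Require Import all_classical all_reals topology normedtype.
Set Implicit Arguments.
Unset Strict Implicit.
Unset Printing Implicit Defensive.
Import Order.TTheory GRing.Theory Num.Theory numFieldNormedType.Exports.
Local Open Scope classical_set_scope.
Local Open Scope ring_scope.
Local Open Scope quotient_scope.

(** * Prime ideals *)

(** What has to be controlled is the closure of a graph: that of a / s over X when g is shown to
    take the value f(m) on the fibre, and that of s / a when g is shown to be integral. Density is
    therefore stated for the zero set of an arbitrary ideal J of a polynomial ring and for an h that
    is a nonzerodivisor modulo J ([zero_density]); a prime over J through the given point reduces it
    to a domain. Fraction fields of domains are avoided in favour of pseudo-division and primitive
    polynomials. Points are C-algebra morphisms to C, so producing a point over a given one is lying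
    over followed by splitting a monic polynomial over C. *)

Section PrimeAvoidance.
Variable A : comPzRingType.
Implicit Types I J P Q : set A.

(** Zorn's lemma picks Q maximal among the ideals that contain J and miss M. The last clause is this
    maximality: Q + (b) meets M for b outside Q. It gives primality here and identifies the
    contraction in [lying_over]. *)
Lemma prime_ideal_avoiding J (M : multset A) :
  is_ideal J -> (forall a, M a -> ~ J a) ->
  exists Q, [/\ is_prime Q, J `<=` Q, forall a, M a -> ~ Q a &
    forall b, ~ Q b -> exists m c, M m /\ Q (m - c * b)].
Proof.
move=> hJ dJ.
(* The empty set counts as good because the union of the empty chain has to be good. *)
pose good (I : set A) := I = set0 \/ [/\ is_ideal I, J `<=` I & forall a, M a -> ~ I a].
have [|Q [PQ mQ]] := @Zorn_bigcup A good.
  move=> F FP tF; have [[I [FI [a Ia]]]|nF] := pselect (exists I, F I /\ I !=set0); last first.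
    left; apply/seteqP; split=> // a [I FI Ia]; apply: nF; exists I; split=> //.
    by exists a.
  right.
  have ne I' b : F I' -> I' b -> [/\ is_ideal I', J `<=` I' & forall a, M a -> ~ I' a].
    by move=> /FP[->|//] [].
  have [hI JI dI] := ne _ _ FI Ia.
  split.
  - split; first by exists I => //; have [] := hI.
      move=> b c [I1 F1 b1] [I2 F2 c2].
      have [/(_ _ b1) b2|/(_ _ c2) c1] := tF _ _ F1 F2.
        by exists I2 => //; have [[_ D _] _ _] := ne _ _ F2 c2; exact: D.
      by exists I1 => //; have [[_ D _] _ _] := ne _ _ F1 b1; exact: D.
    move=> b c [I1 F1 c1]; exists I1 => //.
    by have [[_ _ D] _ _] := ne _ _ F1 c1; exact: D.
  - by move=> b Jb; exists I => //; exact: JI.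
  - by move=> b Mb [I1 F1 b1]; have [_ _ d1] := ne _ _ F1 b1; exact: (d1 b Mb b1).
have [hQ JQ dQ] : [/\ is_ideal Q, J `<=` Q & forall a, M a -> ~ Q a].
  case: PQ => // Q0; exfalso; apply: (mQ J); last by right; split.
  rewrite Q0; split=> [a []|J0]; have [J00 _ _] := hJ; exact: (J0 0 J00).
have [Q0 QD QM] := hQ.
have av b : ~ Q b -> exists m c, M m /\ Q (m - c * b).
  move=> nb; apply: contrapT => h.
  pose I : set A := [set y | exists2 q, Q q & exists c, y = q + c * b].
  apply: (mQ I); last first.
    right; split.
    - split; first by exists 0 => //; exists 0; ring.
        move=> _ _ [q Qq [c ->]] [q' Qq' [c' ->]].
        by exists (q + q'); [exact: QD|exists (c + c'); ring].
      move=> d _ [q Qq [c ->]].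
      by exists (d * q); [exact: QM|exists (d * c); ring].
    - by move=> a /JQ Qa; exists a => //; exists 0; ring.
    - move=> m Mm [q Qq [c e]]; apply: h; exists m, c; split=> //.
      by rewrite e addrK.
  split=> [a Qa|IQ]; first by exists a => //; exists 0; ring.
  by apply: nb; apply: IQ; exists 0 => //; exists 1; ring.
exists Q; split=> //; split=> //.
  by move=> Q1; apply: (dQ 1) => //; exact: multset1.
move=> a b Qab; have [|/av[m [c [Mm Qm]]]] := pselect (Q a); first by left.
have [|/av[m' [c' [Mm' Qm']]]] := pselect (Q b); first by right.
exfalso; apply: (dQ (m * m')); first exact: multsetM.
have -> : m * m' = m' * (m - c * a) + c * a * (m' - c' * b) + c * c' * (a * b) by ring.
by apply: (QD); [apply: (QD); exact: (QM)|exact: (QM)].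
Qed.

Lemma powers1 (a : A) : exists i, a ^+ i = 1.
Proof. by exists 0%N. Qed.

Lemma powersM (a b c : A) : (exists i, a ^+ i = b) -> (exists i, a ^+ i = c) ->
  exists i, a ^+ i = b * c.
Proof. by move=> [i <-] [j <-]; exists (i + j)%N; rewrite exprD. Qed.

Definition powers (a : A) :=
  @Multset A (fun b => exists i, a ^+ i = b) (powers1 a) (@powersM a).

Lemma prime_ideal_above J : is_ideal J -> ~ J 1 -> exists2 Q, is_prime Q & J `<=` Q.
Proof.
move=> hJ J1; have [|Q [pQ JQ _ _]] := @prime_ideal_avoiding J (powers 1) hJ.
  by move=> _ [i <-]; rewrite expr1n.
by exists Q.
Qed.

Lemma prime_expr P a n : is_prime P -> P (a ^+ n) -> P a.
Proof.
move=> [hP P1 Pp]; elim: n => [|n ih]; first by rewrite expr0.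
by rewrite exprS => /Pp[|/ih].
Qed.

Lemma ideal_exprB J a b n : is_ideal J -> J (a - b) -> J (a ^+ n - b ^+ n).
Proof.
move=> [_ _ JM] Jab; rewrite subrXX mulrC; exact: JM.
Qed.

Lemma ideal_subl J a b : is_ideal J -> J (a - b) -> J a -> J b.
Proof.
move=> hJ Jab Ja; have -> : b = a - (a - b) by ring.
exact: idealB.
Qed.

End PrimeAvoidance.

(** * Lying over for integral ring morphisms *)

Section LyingOver.
Variables (A B : comPzRingType) (f : {rmorphism A -> B}).

Lemma kernel_ideal : is_ideal [set a | f a = 0].
Proof.
split=> /= [|a b ea eb|a b eb]; first exact: rmorph0.
  by rewrite rmorphD ea eb addr0.
by rewrite rmorphM eb mulr0.
Qed.

(** Multiplying the equation of b by [f a ^+ n] makes [b * f a] a root of a monic polynomial whose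
    lower coefficients are images of elements of P. Modulo Q this root is [f s], so [s ^+ n] lies in
    P. *)
Lemma integral_contract (P : set A) (Q : set B) a s b :
  is_prime P -> is_ideal Q -> (forall x, Q (f x) -> P x) -> integral_elt f b ->
  P a -> Q (f s - b * f a) -> P s.
Proof.
move=> pP hQ QP [n [c e]] Pa Qs; have [hP P1 Pp] := pP; have [P0 PD PM] := hP.
have [Q0 QD QM] := hQ.
apply: (prime_expr (n := n) pP).
have : P (s ^+ n + \sum_(i < n) c i * a ^+ (n - i) * s ^+ i).
  apply: QP; rewrite rmorphD rmorphXn rmorph_sum.
  pose F (i : 'I_n) := f (c i * a ^+ (n - i)).
  have h : (b * f a) ^+ n + \sum_(i < n) F i * (b * f a) ^+ i = 0.
    have : f a ^+ n * (b ^+ n + \sum_(i < n) f (c i) * b ^+ i) = 0 by rewrite e mulr0.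
    rewrite mulrDr mulr_sumr => h; rewrite -[RHS]h exprMn [b ^+ n * _]mulrC; congr (_ + _).
    apply: eq_bigr => i _; rewrite /F rmorphM rmorphXn exprMn.
    have -> : f a ^+ n = f a ^+ (n - i) * f a ^+ i by rewrite -exprD subnK // ltnW.
    ring.
  have -> : f s ^+ n + \sum_(i < n) f (c i * a ^+ (n - i) * s ^+ i) =
    (f s ^+ n - (b * f a) ^+ n) + \sum_(i < n) F i * (f s ^+ i - (b * f a) ^+ i).
    under [in RHS]eq_bigr do rewrite mulrBr.
    rewrite sumrB addrACA -opprD h subr0; congr (_ + _).
    by apply: eq_bigr => i _; rewrite rmorphM rmorphXn.
  apply: (QD); first exact: ideal_exprB.
  by apply: ideal_sum => // i; apply: (QM); exact: ideal_exprB.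
move=> h; have -> : s ^+ n = (s ^+ n + \sum_(i < n) c i * a ^+ (n - i) * s ^+ i) -
  \sum_(i < n) c i * a ^+ (n - i) * s ^+ i by ring.
apply: (idealB hP) => //; apply: ideal_sum => // i.
rewrite mulrC; apply: (PM); apply: (PM).
have -> : (n - i = (n - i).-1.+1)%N by rewrite prednK // subn_gt0.
by rewrite exprSr; exact: PM.
Qed.

(** Q is maximal among the ideals over J that miss the image of the complement of P. If a in P had
    [f a] outside Q, maximality would give s outside P with [f s = b * f a] modulo Q, which
    [integral_contract] excludes. *)
Lemma lying_over (J : set B) (P : set A) : is_prime P -> integral_ext f ->
  is_ideal J -> (forall a, J (f a) -> P a) ->
  exists Q : set B, [/\ is_prime Q, J `<=` Q & forall a, Q (f a) <-> P a].
Proof.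
move=> pP fi hJ JP.
have [|Q [pQ JQ dQ mQ]] := @prime_ideal_avoiding B J (prime_compl f (Spectrum pP)) hJ.
  by move=> _ [s ns <-] /= /JP.
have QP a : Q (f a) -> P a.
  by move=> Qa; apply: contrapT => na; apply: (dQ (f a)) => //; exists a.
exists Q; split=> // a; split=> [/QP//|Pa]; apply: contrapT => /mQ[_ [b [[s ns <-] Qs]]].
by apply: ns; have [hQ _ _] := pQ; apply: (integral_contract pP hQ QP (fi b) Pa Qs).
Qed.

Lemma zero_ideal : is_ideal [set (0 : B)].
Proof. by split=> [//|a b /= -> ->|a b /= ->]; rewrite ?addr0 ?mulr0. Qed.

End LyingOver.

Lemma kernel_prime (A : comPzRingType) (D : idomainType) (f : {rmorphism A -> D}) :
  is_prime [set a | f a = 0].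
Proof.
split=> /= [||a b]; first exact: kernel_ideal.
  by rewrite rmorph1 => /eqP; rewrite oner_eq0.
by rewrite rmorphM => /eqP; rewrite mulf_eq0 => /orP[]/eqP; [left|right].
Qed.

(** * Quotients by prime ideals as integral domains *)

Section Quotient.

(** An [idomainType] carries a boolean unit predicate and an inverse operation; both are chosen
    classically on the same carrier. *)
Lemma idomain_of_classical (D : comNzRingType) :
  (forall x y : D, x * y = 0 -> x = 0 \/ y = 0) ->
  exists (E : idomainType) (i : {rmorphism D -> E}), bijective i.
Proof.
move=> hD.
pose un : pred D := fun x => `[< exists y, y * x = 1 >].
pose inv (x : D) : D := if pselect (exists y, y * x = 1) is left h then projT1 (cid h) else x.
have mulVx : {in un, left_inverse 1 inv *%R}.
  move=> x /asboolP h; rewrite /inv; case: pselect => // h'.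
  by case: cid.
have unP (x y : D) : y * x = 1 -> un x by move=> e; apply/asboolP; exists y.
have invout : {in [predC un], inv =1 id}.
  by move=> x /asboolP h; rewrite /inv; case: pselect.
pose E1 : comUnitRingType := HB.pack (GRing.ComNzRing.sort D) (GRing.ComNzRing.class D)
  (GRing.ComNzRing_hasMulInverse.Build D mulVx unP invout).
have ax : GRing.integral_domain_axiom E1.
  by move=> x y /hD[->|->]; rewrite eqxx ?orbT.
pose E : idomainType := HB.pack (GRing.ComUnitRing.sort E1) (GRing.ComUnitRing.class E1)
  (GRing.ComUnitRing_isIntegral.Build E1 ax).
exists E.
pose g : D -> E := id.
have ga : zmod_morphism g by [].
have gm : monoid_morphism g by [].
pose g' : {rmorphism D -> E} := HB.pack g
   (GRing.isZmodMorphism.Build D E g ga) (GRing.isMonoidMorphism.Build D E g gm).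
by exists g'; exists id.
Qed.

Lemma prime_quotient_nz (A : comNzRingType) (P : set A) : is_prime P ->
  exists (D : idomainType) (q : {rmorphism A -> D}),
    (forall d, exists a, q a = d) /\ forall a, q a = 0 <-> P a.
Proof.
move=> pP; have [[P0 PD PM] P1 Pp] := pP.
pose I : pred A := fun a => `[< P a >].
have cI : idealr_closed I.
  split; first exact/asboolP.
    by apply/asboolP.
  move=> a u v /asboolP Pu /asboolP Pv; apply/asboolP.
  by apply: PD => //; exact: PM.
have pI : prime_idealr_closed I.
  by move=> u v /asboolP/Pp[] h; apply/orP; [left|right]; apply/asboolP.
pose I' : prime_idealr A := HB.pack I (isIdealr.Build A I cI) (isPrimeIdealrClosed.Build A I pI).
have [|D [i bi]] := @idomain_of_classical {ideal_quot I'}.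
  move=> x y /(@Quotient.rquot_IdomainAxiom A I') /orP[/eqP|/eqP]; by [left|right].
exists D, (i \o \pi_{ideal_quot I'}); split=> [d|a].
  have [j ij ji] := bi; exists (repr (j d)) => /=.
  by rewrite reprK ji.
have -> : ((i \o \pi_{ideal_quot I'}) a = 0) = (\pi_{ideal_quot I'} a = 0).
  apply/propext; split=> /= [e|->]; last exact: rmorph0.
  by apply: (bij_inj bi); rewrite e rmorph0.
rewrite -(rmorph0 (\pi_{ideal_quot I'})).
split=> [/eqP|h].
  by rewrite -Quotient.idealrBE subr0 => /asboolP.
by apply/eqP; rewrite -Quotient.idealrBE subr0; apply/asboolP.
Qed.

(** Once A is destructed, its repacking as a nonzero ring is convertible to A, so a result stated
    for nonzero rings applies to it. *)
Lemma nz_induction (P : comPzRingType -> Prop) :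
  (forall A : comNzRingType, P A) -> forall A : comPzRingType, (1 : A) <> 0 -> P A.
Proof.
move=> h A /eqP ne.
pose A' : comNzRingType := HB.pack (GRing.ComPzRing.sort A)
  (GRing.ComPzRing.class A) (GRing.PzSemiRing_isNonZero.Build A ne).
by case: A ne @A' => [A cA] ne A'; exact: (h A').
Qed.

Lemma prime_quotient (A : comPzRingType) (P : set A) : is_prime P ->
  exists (D : idomainType) (q : {rmorphism A -> D}),
    (forall d, exists a, q a = d) /\ forall a, q a = 0 <-> P a.
Proof.
move=> pP; have ne : (1 : A) <> 0.
  by move=> e; have [[P0 _ _] P1 _] := pP; apply: P1; rewrite e.
move: A ne P pP.
by apply: (@nz_induction (fun A => forall P : set A, is_prime P -> _)) => A P; exact: prime_quotient_nz.
Qed.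

Lemma factor_through (A D L : comPzRingType) (q : {rmorphism A -> D}) (g : {rmorphism A -> L}) :
  (forall d, exists a, q a = d) -> (forall a, q a = 0 -> g a = 0) ->
  exists h : {rmorphism D -> L}, forall a, h (q a) = g a.
Proof.
move=> /choice[r qr] qg.
pose h d := g (r d).
have hq a : h (q a) = g a.
  by apply/eqP; rewrite -subr_eq0 -rmorphB; apply/eqP/qg; rewrite rmorphB qr subrr.
have ha : zmod_morphism h.
  by move=> x y; rewrite -{1}(qr x) -{1}(qr y) -rmorphB hq rmorphB.
have hm : monoid_morphism h.
  split; first by rewrite -(rmorph1 q) hq rmorph1.
  by move=> x y; rewrite -{1}(qr x) -{1}(qr y) -rmorphM hq rmorphM.
pose h' : {rmorphism D -> L} := HB.pack h
   (GRing.isZmodMorphism.Build D L h ha) (GRing.isMonoidMorphism.Build D L h hm).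
by exists h'.
Qed.

End Quotient.

(** * Factorial rings and Hilbert's basis theorem *)

Section Factorial.

Lemma ex_min_measure (T : Type) (m : T -> nat) (P : T -> Prop) :
  (exists x, P x) -> exists x, P x /\ forall y, P y -> (m x <= m y)%N.
Proof.
move=> [x Px]; pose p n := `[< exists y, P y /\ m y = n >].
have ex : exists n, p n by exists (m x); apply/asboolP; exists x.
case: (ex_minnP ex) => n /asboolP[y [Py <-]] h; exists y; split=> // z Pz.
by apply: h; apply/asboolP; exists z.
Qed.

Definition divides (S : idomainType) (a b : S) := exists c, b = c * a.

Definition prime_element (S : idomainType) (p : S) :=
  [/\ p != 0, p \isn't a GRing.unit &
      forall a b, divides p (a * b) -> divides p a \/ divides p b].

Definition factorial_ring (S : idomainType) := forall a : S, a != 0 ->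
  exists u ps, [/\ u \is a GRing.unit, forall p, p \in ps -> prime_element p &
                   a = u * \prod_(p <- ps) p].

Definition primitive (S : idomainType) (P : {poly S}) :=
  forall p : S, prime_element p -> ~ divides p%:P P.

Variable S : idomainType.
Implicit Types (p c : S) (P Q A B : {poly S}).

Lemma divides_ideal p : is_ideal (divides p).
Proof.
split=> [|a b [c ->] [d ->]|a b [c ->]]; first by exists 0; rewrite mul0r.
  by exists (c + d); rewrite mulrDl.
by exists (a * c); rewrite mulrA.
Qed.

Lemma prime_element_ideal p : prime_element p -> is_prime (divides p).
Proof.
move=> [p0 pu pM]; split; [exact: divides_ideal| |exact: pM].
by move=> [c e]; case/negP: pu; apply/unitrPr; exists c; rewrite mulrC.
Qed.

(** The multiples of p form the kernel of the map S[T] -> (S/p)[T], whose target is a domain. *)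
Lemma prime_elementC p : prime_element p -> prime_element p%:P.
Proof.
move=> hp; have [p0 pu _] := hp.
have [D [q [_ qp]]] := prime_quotient (prime_element_ideal hp).
have E P : divides p%:P P <-> map_poly q P = 0.
  split=> [[Q ->]|h].
    rewrite rmorphM /= map_polyC /= (qp p).2 ?mulr0 //; by exists 1; rewrite mul1r.
  have /choice[r hr] i : divides p P`_i.
    by apply/qp; rewrite -coef_map h coef0.
  exists (\poly_(i < size P) r i); apply/polyP => i.
  rewrite coefMC coef_poly; case: ltnP => [_|le]; first exact: hr.
  by rewrite mul0r nth_default.
split=> [||A B]; first by rewrite polyC_eq0.
  by rewrite poly_unitE size_polyC p0 coefC /= (negPf pu).
move=> /E; rewrite rmorphM => /eqP; rewrite mulf_eq0 => /orP[/eqP|/eqP] /E; by [left|right].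
Qed.

Lemma prime_element_prod p u ps : prime_element p -> u \is a GRing.unit ->
  divides p (u * \prod_(q <- ps) q) -> exists2 q, q \in ps & divides p q.
Proof.
move=> [p0 pu pM] uu; have npu (v : S) : v \is a GRing.unit -> ~ divides p v.
  move=> vu [c e]; case/negP: pu; apply/unitrPr; exists (c * v^-1).
  by rewrite mulrCA mulrA -e divrr.
elim: ps => [|q ps ih]; first by rewrite big_nil mulr1 => /npu.
rewrite big_cons mulrCA => /pM[h|/ih[r rps h]].
  by exists q => //; exact: mem_head.
by exists r => //; rewrite in_cons rps orbT.
Qed.

Lemma primitive_part P : factorial_ring S -> P != 0 ->
  exists c P1, [/\ c != 0, P = c *: P1 & primitive P1].
Proof.
move=> hS; rewrite -lead_coef_eq0 => /hS[u [ps [uu pps e]]].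
elim: {ps}(size ps) {-2}ps (erefl (size ps)) u uu pps P e => [|n ih] ps sz u uu pps P e.
  exists 1, P; split; rewrite ?oner_eq0 ?scale1r // => p hp [Q eQ].
  have [|q] := @prime_element_prod p u ps hp uu; last by rewrite (size0nil sz).
  by rewrite -e eQ lead_coefM lead_coefC; exists (lead_coef Q).
have [pP|] := pselect (primitive P).
  by exists 1, P; split; rewrite ?oner_eq0 ?scale1r.
move=> /existsNP[p /not_implyP[hp /contrapT[Q eQ]]].
have elc : lead_coef P = lead_coef Q * p by rewrite eQ lead_coefM lead_coefC.
have [p0 pu pM] := hp.
have [|q qps [c eq]] := @prime_element_prod p u ps hp uu.
  by rewrite -e elc; exists (lead_coef Q).
have [q0 qu qM] := pps q qps.
have cu : c \is a GRing.unit.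
  have [|[d ed]|[d ed]] := qM c p; first by exists 1; rewrite mul1r.
    case/negP: pu; apply/unitrPr; exists d; apply: (mulfI q0).
    by rewrite mulr1 [in RHS]eq ed; ring.
  by apply/unitrPr; exists d; apply: (mulfI q0); rewrite mulr1 [in RHS]eq ed; ring.
have [||||d [P1 [d0 eP1 pP1]]] := ih (rem q ps) _ (u * c) _ _ Q.
- by rewrite size_rem // sz.
- by rewrite unitrM uu.
- by move=> r /mem_rem; exact: pps.
- apply: (mulIf p0); rewrite -elc e (perm_big _ (perm_to_rem qps)) big_cons /= eq.
  by ring.
exists (p * d), P1; split=> //; first by rewrite mulf_neq0.
by rewrite eQ eP1 mulrC -scalerA mul_polyC.
Qed.

(** Gauss's lemma: each prime factor of c divides P * B but not P, hence divides B and cancels. *)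
Lemma primitive_cancel P A B c : factorial_ring S -> primitive P -> c != 0 ->
  c *: A = P * B -> exists B', A = P * B'.
Proof.
move=> hS pP /hS[u [ps [uu + ->]]].
elim: ps B => [|p ps ih] B pps.
  rewrite big_nil mulr1 => e; exists (u^-1 *: B).
  by rewrite -scalerAr -e scalerA mulVr // scale1r.
rewrite big_cons mulrCA => e.
have hp : prime_element p by apply: pps; exact: mem_head.
have [p0 _ _] := hp.
have [_ _ /(_ P B)] := prime_elementC hp; case.
- by rewrite -e -scalerA -mul_polyC mulrC; eexists.
- by move/(pP p hp).
move=> [B1 eB]; apply: (ih B1).
  by move=> q qps; apply: pps; rewrite in_cons qps orbT.
have p0' : p%:P != 0 by rewrite polyC_eq0.
by apply: (mulfI p0'); rewrite mul_polyC scalerA e eB; ring.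
Qed.

Lemma pseudo_division P Q : Q != 0 -> exists m A R,
  lead_coef Q ^+ m *: P = Q * A + R /\ (size R < size Q)%N.
Proof.
move=> Q0; exists (scalp P Q), (P %/ Q), (P %% Q); split.
- by rewrite mulrC; exact: Pdiv.Idomain.divp_eq.
- by rewrite ltn_modp.
Qed.

Lemma factorial_poly : factorial_ring S -> factorial_ring {poly S}.
Proof.
move=> hS f; elim: {f}(size f) {-2}f (leqnn (size f)) => [|n ih] f sz f0.
  by move: f0; rewrite -size_poly_eq0 -leqn0 sz.
have [sz1|sz1] := leqP (size f) 1.
  have e := size1_polyC sz1; move: f0; rewrite e polyC_eq0 => /hS[u [ps [uu pps ->]]].
  exists u%:P, [seq p%:P | p <- ps]; split.
  - have u0 : u != 0 by apply: contraTneq uu => ->; rewrite unitr0.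
    by rewrite poly_unitE size_polyC coefC /= uu u0.
  - by move=> _ /mapP[p pps' ->]; exact: prime_elementC (pps _ pps').
  - by rewrite rmorphM rmorph_prod big_map.
(* N collects the nonconstant divisors of f over the fraction field. The primitive part of one of
   least size will be a prime factor of f. *)
pose N P := (1 < size P)%N /\ exists c Q, c != 0 /\ c *: f = P * Q.
have [|P [[szP [c [Q [c0 e]]]] mP]] := @ex_min_measure _ (fun P : {poly S} => size P) N.
  by exists f; split=> //; exists 1, 1; rewrite oner_eq0 scale1r mulr1.
have P0 : P != 0 by rewrite -size_poly_gt0 (leq_trans _ szP).
have [d [P1 [d0 eP pP1]]] := primitive_part hS P0.
have szP1 : size P1 = size P by rewrite eP size_scale.
have [|Q1 eQ1] := @primitive_cancel P1 f (d *: Q) c hS pP1 c0.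
  by rewrite e eP -scalerAl -scalerAr.
have P10 : P1 != 0 by rewrite -size_poly_gt0 szP1 (leq_trans _ szP).
have Q10 : Q1 != 0 by apply: contraNneq f0 => e1; rewrite eQ1 e1 mulr0.
have [||u [ps [uu pps eQ]]] := ih Q1 => //.
  have := sz; rewrite eQ1 size_mul // szP1.
  move: szP; case: (size P) => [|[|m]] // _; rewrite !addSn /= ltnS => h.
  by apply: leq_trans h; exact: leq_addl.
exists u, (P1 :: ps); split=> //; last first.
  by rewrite big_cons mulrCA -eQ.
move=> p; rewrite in_cons => /predU1P[->|]; last exact: pps.
split=> // [|A B [C eC]].
  by rewrite poly_unitE szP1; move: szP; case: (size P) => [|[|]].
have [|nA] := pselect (divides P1 A); [by left|right].
(* A nonzero R of least size in the ideal (P1, A) divides both generators up to constants. If R is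
   constant, P1 divides a constant multiple of B. Otherwise R is in N, and the minimality of P makes
   P1 and R agree up to constants, so P1 divides A. *)
pose J R := exists U V, R = U * P1 + V * A.
have [|R [[R0 [U [V eR]]] mR]] := @ex_min_measure _ (fun P : {poly S} => size P)
  (fun R => R != 0 /\ J R).
  by exists P1; split=> //; exists 1, 0; ring.
have dR X : J X -> exists c' Y, c' != 0 /\ c' *: X = R * Y.
  move=> [U' [V' eX]]; have [m [Y [R' [e' szR]]]] := pseudo_division X R0.
  pose c' := lead_coef R ^+ m; exists c', Y; split.
    by rewrite expf_neq0 // lead_coef_eq0.
  rewrite e'; have [->|R'0] := eqVneq R' 0; first by rewrite addr0.
  have := mR R'; rewrite leqNgt szR => h; exfalso; suff: false by [].
  apply: h; split=> //; exists (c'%:P * U' - Y * U), (c'%:P * V' - Y * V).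
  have -> : R' = c' *: X - R * Y by rewrite e'; ring.
  by rewrite -mul_polyC eX eR; ring.
have [|c1 [Y1 [c10 e1]]] := dR P1; first by exists 1, 0; ring.
have [|c2 [Y2 [c20 e2]]] := dR A; first by exists 0, 1; ring.
have [szR|szR] := leqP (size R) 1.
  have eR1 := size1_polyC szR.
  have [||B' eB] := @primitive_cancel P1 B (U * B + V * C) R`_0 hS pP1.
  - by rewrite -polyC_eq0 -eR1.
  - transitivity (U * P1 * B + V * (A * B)); last by rewrite eC; ring.
    by rewrite -mul_polyC -eR1 eR; ring.
  by exists B'; rewrite mulrC.
exfalso; apply: nA.
have NR : N R.
  split=> //; exists c1, (Y1 * Q1); split=> //.
  by rewrite eQ1 mulrA -e1 scalerAl.
have Y10 : Y1 != 0.
  by apply/eqP => e0; move: e1; rewrite e0 mulr0 => /eqP; rewrite -mul_polyC mulf_eq0 polyC_eq0 (negPf c10) (negPf P10).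
have szY : (size Y1 <= 1)%N.
  have := mP R NR; rewrite -szP1 -(size_scale _ c10) e1 size_mul //.
  by move: szR; case: (size R) => // m _; rewrite addSn /= -addn1 leq_add2l.
have [||B' eB] := @primitive_cancel P1 A (c1 *: Y2) (c2 * Y1`_0) hS pP1.
- by rewrite mulf_neq0 // -polyC_eq0 -(size1_polyC szY).
- rewrite mulrC -scalerA e2 -mul_polyC -(size1_polyC szY) -scalerAr scalerAl e1; ring.
by exists B'; rewrite mulrC.
Qed.

End Factorial.

(** * Minimal polynomials of integral elements *)

Section MinimalPolynomial.
Variables (S D : idomainType) (f : {rmorphism S -> D}).
Hypothesis f_inj : injective f.

Lemma rmorph_inj_eq0 a : (f a == 0) = (a == 0).
Proof. by rewrite -(inj_eq f_inj) rmorph0. Qed.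

(** The last clause is division by P0 over the fraction field of S, with denominators cleared by
    powers of the leading coefficient. *)
Lemma minimal_algebraic b : integralOver f b -> exists P0 : {poly S},
  [/\ P0 != 0, (map_poly f P0).[b] = 0,
      forall P, P != 0 -> (map_poly f P).[b] = 0 -> (size P0 <= size P)%N &
      forall G, (map_poly f G).[b] = 0 -> exists m Q, lead_coef P0 ^+ m *: G = P0 * Q].
Proof.
move=> [F mF /rootP rF].
have [|P0 [[P00 eP0] mP0]] := @ex_min_measure _ (fun P : {poly S} => size P)
  (fun P => P != 0 /\ (map_poly f P).[b] = 0).
  by exists F; rewrite monic_neq0.
exists P0; split=> // [P P1 eP|G eG]; first exact: mP0.
have [m [A [R [e szR]]]] := pseudo_division G P00.
exists m, A; rewrite e; have [->|R0] := eqVneq R 0; first by rewrite addr0.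
have := mP0 R; rewrite leqNgt szR => h; exfalso; suff: false by [].
apply: h; split=> //.
have -> : R = lead_coef P0 ^+ m *: G - P0 * A by rewrite e; ring.
by rewrite rmorphB rmorphM /= map_polyZ hornerD hornerN hornerZ hornerM eP0 eG; ring.
Qed.

(** By Gauss's lemma the primitive part of a relation of least size divides every relation of b. It
    divides a monic one in particular, so its leading coefficient is a unit. *)
Lemma factorial_minimal b : factorial_ring S -> integralOver f b ->
  exists F : {poly S}, [/\ F \is monic, (map_poly f F).[b] = 0 &
    forall G, (map_poly f G).[b] = 0 -> exists Q, G = F * Q].
Proof.
move=> hS ib; have [P0 [P00 eP0 _ dP0]] := minimal_algebraic ib.
have [d [P1 [d0 eP pP1]]] := primitive_part hS P00.
have eP1 : (map_poly f P1).[b] = 0.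
  move: eP0; rewrite eP map_polyZ hornerZ => /eqP.
  by rewrite mulf_eq0 rmorph_inj_eq0 (negPf d0) => /eqP.
have dP1 G : (map_poly f G).[b] = 0 -> exists Q, G = P1 * Q.
  move=> /dP0[m [Q e]]; apply: (primitive_cancel (B := d *: Q) (c := lead_coef P0 ^+ m) hS pP1).
    by rewrite expf_neq0 // lead_coef_eq0.
  by rewrite e eP -scalerAl -scalerAr.
have [F mF /rootP/dP1[Q eF]] := ib.
have lu : lead_coef P1 \is a GRing.unit.
  by apply/unitrPr; exists (lead_coef Q); rewrite -lead_coefM -eF (monicP mF).
exists ((lead_coef P1)^-1 *: P1); split.
- by rewrite monicE lead_coefZ mulVr.
- by rewrite map_polyZ hornerZ eP1 mulr0.
- move=> G /dP1[Q' ->]; exists (lead_coef P1 *: Q').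
  by rewrite -scalerAl -scalerAr scalerA mulVr // scale1r.
Qed.

End MinimalPolynomial.

(** * Hilbert's basis theorem *)

Section Hilbert.

(** The ascending chain condition in sequence form, for the ideals generated by the initial segments
    of a. *)
Definition noetherian (A : comPzRingType) := forall a : nat -> A,
  exists m (c : nat -> A), a m = \sum_(i < m) c i * a i.

Lemma noetherian_poly (A : comNzRingType) : noetherian A -> noetherian {poly A}.
Proof.
move=> hA f; apply: contrapT => hf.
pose inI (s : seq {poly A}) g := exists c : nat -> {poly A}, g = \sum_(i < size s) c i * s`_i.
pose F m := [seq f i | i <- iota 0 m].
pose I g := exists m, inI (F m) g.
have inF m g : inI (F m) g <-> exists c : nat -> {poly A}, g = \sum_(i < m) c i * f i.
  have E (c : nat -> {poly A}) : \sum_(i < size (F m)) c i * (F m)`_i = \sum_(i < m) c i * f i.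
    rewrite size_map size_iota; apply: eq_bigr => i _.
    by rewrite (nth_map 0%N) ?size_iota // nth_iota.
  by split=> -[c ->]; exists c.
have IU m m' g : (m <= m')%N -> inI (F m) g -> inI (F m') g.
  move=> le /inF[c ->]; apply/inF; exists (fun i => if (i < m)%N then c i else 0).
  rewrite (big_ord_widen _ (fun i => c i * f i) le) big_mkcond.
  by apply: eq_bigr => i _; case: ifP; rewrite ?mul0r.
have spanD s g h : inI s g -> inI s h -> inI s (g + h).
  move=> [c ->] [d ->]; exists (c \+ d); rewrite -big_split /=.
  by apply: eq_bigr => i _; rewrite mulrDl.
have spanM s g h : inI s h -> inI s (g * h).
  move=> [d ->]; exists (fun i => g * d i); rewrite mulr_sumr.
  by apply: eq_bigr => i _; rewrite mulrA.
have spanm s i : (i < size s)%N -> inI s s`_i.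
  move=> lt; exists (fun j => (j == i)%:R); rewrite (bigD1 (Ordinal lt)) //= eqxx mul1r.
  rewrite big1 ?addr0 // => j ne; rewrite (_ : (j : nat) == i = false) ?mul0r //.
  by apply/negbTE.
have span0 s : inI s 0 by exists (fun=> 0); rewrite big1 // => i _; rewrite mul0r.
have span_sum s n (g : 'I_n -> {poly A}) : (forall i, inI s (g i)) -> inI s (\sum_(i < n) g i).
  by move=> h; elim/big_ind: _ => //; exact: spanD.
have ID g h : I g -> I h -> I (g + h).
  move=> [m hg] [m' hh]; exists (maxn m m'); apply: spanD.
    by apply: IU hg; exact: leq_maxl.
  by apply: IU hh; exact: leq_maxr.
have IM g h : I h -> I (g * h) by move=> [m hh]; exists m; exact: spanM.
have IN g h : I g -> I h -> I (g - h).
  by move=> ig ih; apply: ID => //; rewrite -mulN1r; exact: IM.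
have I0 : I 0 by exists 0%N.
(* No finite part s of I generates I: s lies in the ideal of the first m terms of f for some m, and
   [f m] does not. Among the elements missed by s, one of least size is taken. *)
have nxt s : (forall g, g \in s -> I g) -> exists g, [/\ I g, ~ inI s g &
    forall h, I h -> ~ inI s h -> (size g <= size h)%N].
  move=> hs.
  have [m hm] : exists m, forall g, g \in s -> inI (F m) g.
    elim: s hs => [|g s ih] hs; first by exists 0%N.
    have [|m hm] := ih; first by move=> h h'; apply: hs; rewrite in_cons h' orbT.
    have [m' hm'] := hs g (mem_head _ _); exists (maxn m m') => h.
    rewrite in_cons => /predU1P[->|/hm]; first by apply: IU hm'; exact: leq_maxr.
    by apply: IU; exact: leq_maxl.
  have nf : ~ inI s (f m).
    move=> [c e]; apply: hf; exists m; apply/inF; rewrite e; apply: span_sum => i.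
    by apply: spanM; apply: hm; exact: mem_nth.
  have [|g [[Ig ng] mg]] := @ex_min_measure _ (fun P : {poly A} => size P)
    (fun g => I g /\ ~ inI s g).
    exists (f m); split=> //; exists m.+1; have := @spanm (F m.+1) m.
    rewrite size_map size_iota (nth_map 0%N) ?size_iota // nth_iota // add0n.
    exact.
  by exists g; split=> // h Ih nh; exact: mg.
pose step s := if pselect (forall g, g \in s -> I g) is left h
  then rcons s (projT1 (cid (nxt s h))) else s.
pose G m := iter m step [::].
have GI m : forall g, g \in G m -> I g.
  elim: m => [|m ih] //= g; rewrite /step; case: pselect => // h.
  rewrite mem_rcons in_cons => /predU1P[->|]; last exact: ih.
  by case: cid => g' /= [].
pose g m := projT1 (cid (nxt (G m) (GI m))).
have GS m : G m.+1 = rcons (G m) (g m).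
  rewrite /= /step; case: pselect => [h|/(_ (GI m))//].
  by rewrite /g; congr (rcons _ (projT1 (cid (nxt _ _)))); exact: Prop_irrelevance.
have gP i : [/\ I (g i), ~ inI (G i) (g i) &
    forall h, I h -> ~ inI (G i) h -> (size (g i) <= size h)%N].
  by rewrite /g; case: cid.
have GE m : G m = [seq g i | i <- iota 0 m].
  elim: m => // m ih; rewrite GS ih -addn1 iotaD map_cat /= cats1 add0n //.
have nthG m i : (i < m)%N -> (G m)`_i = g i.
  by move=> lt; rewrite GE (nth_map 0%N) ?size_iota // nth_iota.
have szG m : size (G m) = m by rewrite GE size_map size_iota.
have spang i m : (i < m)%N -> inI (G m) (g i).
  by move=> lt; rewrite -(nthG m) //; apply: spanm; rewrite szG.
have spanU i m h : (i <= m)%N -> inI (G i) h -> inI (G m) h.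
  move=> le [c ->]; apply: span_sum => j; apply: spanM.
  have lt : (j < i)%N by rewrite -[X in (_ < X)%N]szG.
  by rewrite nthG //; apply: spang; exact: leq_trans lt le.
have szg i m : (i <= m)%N -> (size (g i) <= size (g m))%N.
  move=> le; have [_ _ h] := gP i; have [Im nm _] := gP m; apply: h => // h.
  by apply: nm; apply: spanU h.
have [m [c e]] := hA (fun m => lead_coef (g m)).
have [Ig ng mg] := gP m.
have gm0 : g m != 0 by apply/eqP => e0; apply: ng; rewrite e0.
(* The leading coefficient of [g m] is a combination of the earlier ones, and the sizes of the [g i]
   do not decrease; subtracting the shifted combination lowers the size without entering the
   span. *)
pose h := g m - \sum_(i < m) (c i)%:P * 'X^(size (g m) - size (g i)) * g i.
have szh : (size h < size (g m))%N.
  move: (gm0); rewrite -size_poly_gt0; case sm: (size (g m)) => [//|n] _.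
  rewrite ltnS; apply/leq_sizeP => j; rewrite leq_eqVlt => /predU1P[<-|lt].
    rewrite coefB coef_sum.
    have -> : (g m)`_n = lead_coef (g m) by rewrite lead_coefE sm.
    rewrite e -sumrB big1 // => i _.
    rewrite sm -mulrA coefCM coefXnM.
    have li : (size (g i) <= n.+1)%N by rewrite -sm; apply: szg; exact: ltnW.
    have gi0 : (0 < size (g i))%N.
      rewrite size_poly_gt0; apply/eqP => e0; have [_ ni _] := gP i; apply: ni; by rewrite e0.
    rewrite lead_coefE; case sg: (size (g i)) li gi0 => [//|k] + _; rewrite ltnS => kn.
    by rewrite subSS ltnNge leq_subr /= subKn // subrr.
  rewrite coefB coef_sum nth_default ?sm // sub0r big1 ?oppr0 // => i _.
  have li : (size (g i) <= n.+1)%N by rewrite -sm; apply: szg; exact: ltnW.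
  rewrite -mulrA coefCM coefXnM; case: ifP; rewrite ?mulr0 // => _.
  rewrite nth_default ?mulr0 // leq_subRL; first by rewrite subnK.
  by apply: leq_trans lt; exact: leq_subr.
have : (size (g m) <= size h)%N.
  have hs : inI (G m) (\sum_(i < m) (c i)%:P * 'X^(size (g m) - size (g i)) * g i).
    by apply: span_sum => i; apply: spanM; exact: spang.
  apply: mg.
    apply: IN => //; elim/big_ind: _ => // i _; apply: IM; by have [] := gP i.
  move=> hh; apply: ng; rewrite -(subrK (\sum_(i < m) (c i)%:P * 'X^(size (g m) - size (g i)) * g i) (g m)).
  exact: spanD.
by rewrite leqNgt szh.
Qed.

End Hilbert.

(** * Polynomial rings and Noether normalization *)

Section PolyExt.
Variables (S : comNzRingType) (A : comPzRingType) (f : {rmorphism S -> A}) (a : A).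

(** Evaluation at a along f, written as a sum because the target ring may be zero. *)
Definition poly_ext_fun (P : {poly S}) : A := \sum_(i < size P) f P`_i * a ^+ i.

Lemma poly_ext_morphism : zmod_morphism poly_ext_fun /\ monoid_morphism poly_ext_fun.
Proof.
have [e|/eqP ne] := eqVneq (1 : A) 0.
  have z (y y' : A) : y = y' by rewrite -[y]mulr1 -[y']mulr1 e !mulr0.
  by split=> [x y|]; [exact: z|split=> [|x y]; exact: z].
rewrite /poly_ext_fun; move: A ne f a.
apply: (@nz_induction (fun A => forall (f : {rmorphism S -> A}) a,
  zmod_morphism (fun P : {poly S} => \sum_(i < size P) f P`_i * a ^+ i) /\
  monoid_morphism (fun P : {poly S} => \sum_(i < size P) f P`_i * a ^+ i))) => B g b.
have cg : commr_rmorph g b by move=> c; exact: mulrC.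
have -> : (fun P : {poly S} => \sum_(i < size P) g P`_i * b ^+ i) = horner_morph cg.
  apply/funext => P; rewrite /horner_morph (@horner_coef_wide _ (size P)); last exact: size_poly.
  by apply: eq_bigr => i _; rewrite coef_map.
split; [exact: rmorphB|split; [exact: rmorph1|exact: rmorphM]].
Qed.

HB.instance Definition _ := GRing.isZmodMorphism.Build {poly S} A poly_ext_fun
  (poly_ext_morphism.1).
HB.instance Definition _ := GRing.isMonoidMorphism.Build {poly S} A poly_ext_fun
  (poly_ext_morphism.2).

Definition poly_ext : {rmorphism {poly S} -> A} := poly_ext_fun.

Lemma poly_extC c : poly_ext c%:P = f c.
Proof.
rewrite /= /poly_ext_fun size_polyC; case: eqP => [->|_] /=.
  by rewrite big_ord0 rmorph0.
by rewrite big_ord1 expr0 mulr1 coefC.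
Qed.

Lemma poly_extX : poly_ext 'X = a.
Proof.
rewrite /= /poly_ext_fun size_polyX big_ord_recl big_ord1 !coefX /=.
by rewrite rmorph0 mul0r add0r rmorph1 mul1r.
Qed.

Lemma poly_ext_unique (h : {rmorphism {poly S} -> A}) :
  (forall c, h c%:P = f c) -> h 'X = a -> h =1 poly_ext.
Proof.
move=> hC hX; elim/poly_ind => [|P c ih]; first by rewrite !rmorph0.
by rewrite !rmorphD !rmorphM ih hC hX poly_extC poly_extX.
Qed.

End PolyExt.

Lemma poly_ext_horner (S D : comNzRingType) (f : {rmorphism S -> D}) a P :
  poly_ext f a P = (map_poly f P).[a].
Proof.
rewrite (@horner_coef_wide _ (size P)); last exact: size_poly.
by apply: eq_bigr => i _; rewrite coef_map.
Qed.

Section PolynomialTower.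
Variable F : fieldType.

(* The polynomial ring over F in the variables 0, ..., n - 1; the variable n - 1 is outermost. *)
Fixpoint pring n : idomainType :=
  if n is m.+1 then {poly (pring m)} else F.

Fixpoint pconst n : {rmorphism F -> pring n} :=
  if n is m.+1 then (@polyC (pring m) \o pconst m : {rmorphism F -> {poly (pring m)}})
  else (idfun : {rmorphism F -> F}).

Fixpoint pvar n (i : nat) : pring n :=
  if n is m.+1 then (if i == m then 'X else (pvar m i)%:P) : {poly (pring m)} else 0.

(** Values are indexed by [nat], so that the recursion on n keeps the same x; only the first n of
    them matter ([ev_ext]). *)
Fixpoint ev (A : comPzRingType) (k : {rmorphism F -> A}) (x : nat -> A) n :
    {rmorphism pring n -> A} :=
  if n is m.+1 then poly_ext (ev k x m) (x m) else k.

Lemma ev_const (A : comPzRingType) (k : {rmorphism F -> A}) x n c :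
  ev k x n (pconst n c) = k c.
Proof. by elim: n => //= n ih; rewrite [LHS]poly_extC. Qed.

Lemma ev_var (A : comPzRingType) (k : {rmorphism F -> A}) x n i : (i < n)%N ->
  ev k x n (pvar n i) = x i.
Proof.
elim: n => //= n ih; rewrite ltnS leq_eqVlt => /predU1P[->|lt].
  by rewrite eqxx; exact: poly_extX.
by rewrite (ltn_eqF lt) [LHS]poly_extC ih.
Qed.

Lemma ev_top (A : comPzRingType) (k : {rmorphism F -> A}) x n :
  ev k x n.+1 ('X : {poly pring n}) = x n.
Proof. exact: poly_extX. Qed.

Lemma ev_lower (A : comPzRingType) (k : {rmorphism F -> A}) x n (c : pring n) :
  ev k x n.+1 (c%:P : {poly pring n}) = ev k x n c.
Proof. exact: poly_extC. Qed.

Lemma pring_ind n (T : pring n -> Prop) : (forall c, T (pconst n c)) ->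
  (forall i, (i < n)%N -> T (pvar n i)) ->
  (forall a b, T a -> T b -> T (a + b)) -> (forall a b, T a -> T b -> T (a * b)) ->
  forall P, T P.
Proof.
elim: n T => [|n ih] T Tc Tv TD TM P; first exact: Tc.
have TC c : T c%:P.
  apply: (ih (fun c => T c%:P)) => [d|i lt|a b|a b]; first exact: Tc.
  - by have := Tv i (ltnW lt); rewrite /= (ltn_eqF lt).
  - by rewrite rmorphD; exact: TD.
  - by rewrite rmorphM; exact: TM.
have TX : T 'X by have := Tv n (ltnSn n); rewrite /= eqxx.
elim/poly_ind: P => [|P c hP]; first by rewrite -(polyC0 (pring n)).
by apply: TD => //; exact: TM.
Qed.

Lemma ev_ext (A : comPzRingType) (k : {rmorphism F -> A}) x y n P :
  (forall i, (i < n)%N -> x i = y i) -> ev k x n P = ev k y n P.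
Proof.
move=> xy; elim/(@pring_ind n): P => [c|i lt|a b ea eb|a b ea eb].
- by rewrite !ev_const.
- by rewrite !ev_var // xy.
- by rewrite !rmorphD ea eb.
- by rewrite !rmorphM ea eb.
Qed.

Lemma rmorph_ev (A B : comPzRingType) (k : {rmorphism F -> A}) (l : {rmorphism F -> B})
    (g : {rmorphism A -> B}) x n P : (forall c, g (k c) = l c) ->
  g (ev k x n P) = ev l (g \o x) n P.
Proof.
move=> gk; elim/(@pring_ind n): P => [c|i lt|a b ea eb|a b ea eb].
- by rewrite !ev_const.
- by rewrite !ev_var.
- by rewrite !rmorphD ea eb.
- by rewrite !rmorphM ea eb.
Qed.

Lemma ev_id n P : ev (pconst n) (pvar n) n P = P.
Proof.
elim/(@pring_ind n): P => [c|i lt|a b ea eb|a b ea eb].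
- by rewrite ev_const.
- by rewrite ev_var.
- by rewrite rmorphD ea eb.
- by rewrite rmorphM ea eb.
Qed.

Lemma ev_subalgebra (A : comPzRingType) (k : {rmorphism F -> A}) x n :
  is_subalgebra k [set a | exists P, ev k x n P = a].
Proof.
split=> [c|a b [P <-] [Q <-]|a b [P <-] [Q <-]].
- by exists (pconst n c); rewrite ev_const.
- by exists (P + Q); rewrite rmorphD.
- by exists (P * Q); rewrite rmorphM.
Qed.

Lemma pring_factorial n : factorial_ring (pring n).
Proof.
elim: n => [|n ih]; last exact: factorial_poly.
move=> a a0; exists a, [::]; rewrite big_nil mulr1; split=> //.
by rewrite unitfE.
Qed.

Lemma pring_noetherian n : noetherian (pring n).
Proof.
elim: n => [|n ih]; last exact: noetherian_poly.
move=> a; have [e|ne] := eqVneq (a 0%N) 0.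
  by exists 0%N, (fun=> 0); rewrite big_ord0.
by exists 1%N, (fun=> a 1%N / a 0%N); rewrite big_ord1 /= divfK.
Qed.

Lemma noetherian_surj (A B : comPzRingType) (g : {rmorphism A -> B}) :
  (forall b, exists a, g a = b) -> noetherian A -> noetherian B.
Proof.
move=> /choice[r gr] hA b; have [m [c e]] := hA (r \o b).
exists m, (g \o c); rewrite -[LHS]gr; move: e => /= ->; rewrite rmorph_sum.
by apply: eq_bigr => i _; rewrite rmorphM gr.
Qed.

End PolynomialTower.

(** * Noether normalization *)

Section NoetherNormalization.
Variables (F : fieldType) (D : idomainType) (k : {rmorphism F -> D}).
Implicit Types (x y z : nat -> D) (e : nat -> nat).

(* With t = x 0 and x (i + 1) = y i + t ^ e i for rapidly growing e, the leading coefficient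
   of P in t becomes a nonzero constant. *)
Lemma nagata n x (ps : seq (pring F n.+1)) : (forall P, P \in ps -> P != 0) ->
  exists e, forall P, P \in ps -> exists Q : {poly pring F n},
    lead_coef Q \is a GRing.unit /\
    poly_ext (ev k (fun i => x i.+1 - x 0%N ^+ e i) n) (x 0%N) Q = ev k x n.+1 P.
Proof.
set t := x 0%N.
elim: n ps => [|n ih] ps ps0.
  exists (fun=> 0%N) => P /ps0 P0; exists P; split=> //.
  by rewrite unitfE lead_coef_eq0.
(* One choice of exponents must serve all nonzero coefficients of all the given polynomials; this is
   why the statement is about a list. *)
pose cs := flatten [seq [seq c <- (P : {poly pring F n.+1}) | c != 0] | P <- ps].
have [|e he] := ih cs.
  move=> c /flattenP[_ /mapP[P Pps ->]]; by rewrite mem_filter => /andP[].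
have [q hq] : exists q : pring F n.+1 -> {poly pring F n}, forall c, c \in cs ->
    lead_coef (q c) \is a GRing.unit /\
    poly_ext (ev k (fun i => x i.+1 - t ^+ e i) n) t (q c) = ev k x n.+1 c.
  have /choice[q hq] c : exists Q, c \in cs -> lead_coef Q \is a GRing.unit /\
    poly_ext (ev k (fun i => x i.+1 - t ^+ e i) n) t Q = ev k x n.+1 c.
    have [/he[Q hQ]|_] := boolP (c \in cs); first by exists Q.
    by exists 0.
  by exists q.
pose N := \max_(c <- cs) size (q c).
have szq c : c \in cs -> (size (q c) <= N)%N by move=> h; exact: leq_bigmax_seq.
(* The new exponent exceeds the degree in t of every transformed coefficient. *)
pose e' i := if i == n then N.+1 else e i.
exists e' => P Pps.
have memcs i : P`_i != 0 -> P`_i \in cs.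
  move=> ci; apply/flattenP; exists [seq c <- (P : {poly pring F n.+1}) | c != 0].
    by apply/mapP; exists P.
  rewrite mem_filter ci mem_nth // ltnNge; apply: contra ci => le.
  by rewrite nth_default.
(* The outer variable stands for t and the inner one for [x n.+1 - t ^+ N.+1], so that Y evaluates
   to [x n.+1]. *)
pose Y : {poly {poly pring F n}} := 'X^(N.+1) + ('X)%:P.
have mY : Y \is monic.
  by rewrite monicE lead_coefDl ?lead_coefXn // size_polyXn (leq_ltn_trans (size_polyC_leq1 _)).
have szY : size Y = N.+2.
  by rewrite size_polyDl size_polyXn // (leq_ltn_trans (size_polyC_leq1 _)).
have szYi i : size (Y ^+ i) = (N.+1 * i).+1.
  by rewrite -[LHS]prednK ?size_exp ?szY // size_poly_gt0 monic_neq0 // monic_exp.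
pose g i := if P`_i == 0 then 0 else map_poly (@polyC (pring F n)) (q P`_i) * Y ^+ i.
have evg i : poly_ext (ev k (fun i => x i.+1 - t ^+ e' i) n.+1) t (g i) =
    ev k x n.+1 P`_i * x n.+1 ^+ i.
  rewrite /g; have [->|ci] := eqVneq (P`_i) 0; first by rewrite !rmorph0 mul0r.
  have [_ <-] := hq _ (memcs i ci).
  rewrite rmorphM rmorphXn; congr (_ * _ ^+ _); last first.
    rewrite rmorphD rmorphXn poly_extX poly_extC ev_top /e' eqxx addrC.
    exact: subrK.
  pose h : {rmorphism {poly pring F n} -> D} :=
     poly_ext (ev k (fun i => x i.+1 - t ^+ e' i) n.+1) t \o map_poly (@polyC (pring F n)).
  apply: (@poly_ext_unique _ _ _ _ h) => [c|]; last by rewrite /h /= map_polyX; exact: poly_extX.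
  rewrite /h /= map_polyC [LHS]poly_extC ev_lower; apply: ev_ext => j lt.
  by rewrite /e' (ltn_eqF lt).
exists (\sum_(i < size P) g i); split; last first.
  rewrite rmorph_sum; under eq_bigr do rewrite evg.
  by [].
have P0 := ps0 _ Pps; have : size P != 0%N by rewrite size_poly_eq0.
have : P`_(size P).-1 != 0 by rewrite -lead_coefE lead_coef_eq0.
case: (size P) => [//|m] /= cm _.
have [uq _] := hq _ (memcs m cm).
have gm : g m = map_poly (@polyC (pring F n)) (q P`_m) * Y ^+ m by rewrite /g (negPf cm).
have inj : injective (@polyC (pring F n)) by exact: polyC_inj.
have lm : lead_coef (g m) = (lead_coef (q P`_m))%:P.
  by rewrite gm lead_coefM (monicP (monic_exp _ mY)) mulr1 lead_coef_map_inj.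
have q0 : q P`_m != 0 by rewrite -lead_coef_eq0; apply: contraTneq uq => ->; rewrite unitr0.
(* The terms with i < m have size at most [N.+1 * i.+1], hence at most [N.+1 * m]: the top term
   alone determines the leading coefficient. *)
have szm : (N.+1 * m < size (g m))%N.
  have mq0 : map_poly (@polyC (pring F n)) (q P`_m) != 0.
    by rewrite -size_poly_gt0 size_map_inj_poly // size_poly_gt0.
  have Ym0 : Y ^+ m != 0 by rewrite monic_neq0 // monic_exp.
  rewrite gm size_mul //.
  rewrite szYi size_map_inj_poly // addnS /=.
  by rewrite -[X in (X < _)%N]add0n ltn_add2r size_poly_gt0.
rewrite big_ord_recr /= addrC lead_coefDl.
  by rewrite lm poly_unitE size_polyC lead_coef_eq0 q0 coefC /= uq.
apply: leq_ltn_trans szm; apply: (leq_trans (size_sum _ _ _)).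
apply/bigmax_leqP => i _; rewrite /g; case: eqP => [_|/eqP ci]; first by rewrite size_poly0.
apply: (leq_trans (size_polyMleq _ _)); rewrite szYi addnS /=.
have le1 := szq _ (memcs i ci).
apply: leq_trans (_ : N.+1 * i.+1 <= _)%N; last by rewrite leq_mul2l ltn_ord orbT.
rewrite mulnS leq_add2r; apply: leq_trans (size_poly _ _) _.
by apply: (leq_trans le1).
Qed.

Lemma integral_expr (S : comNzRingType) (f : {rmorphism S -> D}) u m :
  integralOver f u -> integralOver f (u ^+ m).
Proof.
move=> h; elim: m => [|m ih]; first by rewrite expr0; exact: integral1.
by rewrite exprS; exact: integral_mul.
Qed.

Lemma ev_integral d n z x P :
  (forall i, (i < n)%N -> integralOver (ev k z d) (x i)) ->
  integralOver (ev k z d) (ev k x n P).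
Proof.
move=> h; elim/(@pring_ind F n): P => [c|i lt|a b ea eb|a b ea eb].
- by rewrite ev_const -(ev_const k z d); exact: integral_id.
- by rewrite ev_var //; exact: h.
- by rewrite rmorphD; exact: integral_add.
- by rewrite rmorphM; exact: integral_mul.
Qed.

(** If the x i are dependent, [nagata] turns a relation into a monic equation of [x 0] over the n
    elements [x i.+1 - x 0 ^+ e i]. The induction applies to these, and they give back each [x i.+1]
    together with [x 0]. *)
Lemma noether_normalization n x : exists d z,
  injective (ev k z d) /\ forall i, (i < n)%N -> integralOver (ev k z d) (x i).
Proof.
elim: n x => [|n ih] x; first by exists 0%N, x; split=> //; exact: fmorph_inj.
have [inj|] := pselect (injective (ev k x n.+1)).
  exists n.+1, x; split=> // i lt; rewrite -(ev_var k x lt); exact: integral_id.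
move=> ninj; have [P [P0 eP]] : exists P, P != 0 /\ ev k x n.+1 P = 0.
  apply: contrapT => h; apply: ninj => P Q e; apply/eqP; rewrite -subr_eq0.
  apply/negPn/negP => ne; apply: h; exists (P - Q); split=> //.
  by rewrite rmorphB e subrr.
have [|e /(_ P)[|Q [uQ eQ]]] := @nagata n x [:: P].
- by move=> R; rewrite inE => /eqP ->.
- exact: mem_head.
have [d [z [inj hz]]] := ih (fun i => x i.+1 - x 0%N ^+ e i).
exists d, z; split=> //.
have it : integralOver (ev k z d) (x 0%N).
  pose y i := x i.+1 - x 0%N ^+ e i.
  apply: (@integral_root_monic _ _ _ _ (map_poly (ev k y n) ((lead_coef Q)^-1 *: Q))).
  - by apply: monic_map; rewrite monicE lead_coefZ mulVr.
  - apply/rootP; rewrite -poly_ext_horner -mul_polyC rmorphM.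
    by rewrite [poly_ext _ _ Q]eQ eP mulr0.
  - by apply/integral_poly => i; rewrite coef_map; exact: ev_integral.
case=> [_|i lt] //.
rewrite -(subrK (x 0%N ^+ e i) (x i.+1)); apply: integral_add; first exact: hz.
exact: integral_expr.
Qed.

End NoetherNormalization.

(** * Points *)

Section Near.
Variable R : realType.
Local Notation C := R[i].
Implicit Types (z w : nat -> C) (eps delta : C).

Definition near_point n z (P : (nat -> C) -> Prop) :=
  exists2 delta, 0 < delta &
    forall w, (forall i, (i < n)%N -> `|w i - z i| < delta) -> P w.

(** Radii are complex numbers, whose order is partial; the product over the sum replaces the
    minimum. *)
Lemma ex_smaller eps delta : 0 < eps -> 0 < delta ->
  exists2 c : C, 0 < c & c <= eps /\ c <= delta.
Proof.
move=> e0 d0; have s0 := addr_gt0 e0 d0; exists (eps * delta / (eps + delta)).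
  by rewrite divr_gt0 // mulr_gt0.
by split; rewrite ler_pdivrMr // mulrDr ?[delta * eps]mulrC ?lerDr ?lerDl mulr_ge0 // ltW.
Qed.

Lemma near_and n z P Q : near_point n z P -> near_point n z Q ->
  near_point n z (fun w => P w /\ Q w).
Proof.
move=> [d d0 hd] [e e0 he]; have [c c0 [cd ce]] := ex_smaller d0 e0.
by exists c => // w h; split; [apply: hd|apply: he] => i lt; apply: lt_le_trans (h i lt) _.
Qed.

Lemma near_imp n z (P Q : (nat -> C) -> Prop) :
  (forall w, P w -> Q w) -> near_point n z P -> near_point n z Q.
Proof. by move=> PQ [d d0 h]; exists d => // w /h/PQ. Qed.

Lemma near_true n z (P : (nat -> C) -> Prop) : (forall w, P w) -> near_point n z P.
Proof. by move=> h; exists 1. Qed.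

Lemma near_all n z m (P : nat -> (nat -> C) -> Prop) :
  (forall i, (i < m)%N -> near_point n z (P i)) ->
  near_point n z (fun w => forall i, (i < m)%N -> P i w).
Proof.
elim: m => [|m ih] h; first by exact: near_true.
have := near_and (ih (fun i lt => h i (ltnW lt))) (h m (ltnSn m)).
by apply: near_imp => w [h1 h2] i; rewrite ltnS leq_eqVlt => /predU1P[->|/h1].
Qed.

Lemma near_coord n z eps i : 0 < eps -> (i < n)%N ->
  near_point n z (fun w => `|w i - z i| < eps).
Proof. by move=> e0 lt; exists eps => // w; apply. Qed.

Local Notation evC := (ev (idfun : {rmorphism C -> C})).

Lemma near_ev n z P eps : 0 < eps ->
  near_point n z (fun w => `|evC w n P - evC z n P| < eps).
Proof.
move: eps; elim/(@pring_ind C n): P => [c|i lt|a b ha hb|a b ha hb] e e0.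
- by apply: near_true => w; rewrite !ev_const subrr normr0.
- by exists e => // w h; rewrite !ev_var //; exact: h.
- have e2 : 0 < e / 2 by rewrite divr_gt0.
  have := near_and (ha _ e2) (hb _ e2); apply: near_imp => w [h1 h2].
  rewrite !rmorphD opprD addrACA; apply: (le_lt_trans (ler_normD _ _)).
  by rewrite [e]splitr ltrD.
- set a0 := evC z n a; set b0 := evC z n b.
  have pb : 0 < `|b0| + 1 by rewrite ltr_wpDl.
  have pa : 0 < `|a0| + 1 by rewrite ltr_wpDl.
  have e2 : 0 < e / 2 by rewrite divr_gt0.
  have h1 := ha _ (divr_gt0 e2 pb); have h2 := hb _ (divr_gt0 e2 pa).
  have h3 := hb _ (@ltr01 C).
  have := near_and h1 (near_and h2 h3); apply: near_imp => w [{}h1 [{}h2 {}h3]].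
  rewrite !rmorphM.
  have -> : evC w n a * evC w n b - a0 * b0 =
    (evC w n a - a0) * evC w n b + a0 * (evC w n b - b0) by ring.
  apply: (le_lt_trans (ler_normD _ _)); rewrite !normrM [e]splitr.
  have hb1 : `|evC w n b| < `|b0| + 1.
    rewrite -[evC w n b](subrK b0); apply: (le_lt_trans (ler_normD _ _)).
    by rewrite addrC ltrD2l.
  apply: ltr_leD.
    have [->|ne] := eqVneq (evC w n a - a0) 0; first by rewrite normr0 mul0r.
    apply: (lt_trans (y := `|evC w n a - a0| * (`|b0| + 1))).
      by rewrite ltr_pM2l // normr_gt0.
    by rewrite -ltr_pdivlMr.
  apply: (le_trans (y := (`|a0| + 1) * `|evC w n b - b0|)).
    by apply: ler_wpM2r => //; rewrite lerDl.
  by rewrite mulrC -ler_pdivlMr // ltW.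
Qed.

Lemma near_ev_bounded n z P :
  near_point n z (fun w => `|evC w n P| <= `|evC z n P| + 1).
Proof.
have := @near_ev n z P 1 ltr01; apply: near_imp => w h.
rewrite -[evC w n P](subrK (evC z n P)); apply: (le_trans (ler_normD _ _)).
by rewrite addrC lerD2l ltW.
Qed.

Lemma poly_nonroot_near (p : {poly C}) (c : C) delta : p != 0 -> 0 < delta ->
  exists2 w, `|w - c| < delta & p.[w] != 0.
Proof.
(* Infinitely many distinct points; denominators starting at 2 keep them strictly within delta of
   c. *)
move=> p0 d0; pose u (j : nat) := c + delta / j.+2%:R.
have [[j hj]|h] := pselect (exists j, p.[u j] != 0).
  exists (u j) => //; rewrite /u addrC addKr ger0_norm; last by rewrite divr_ge0 // ltW.
  by rewrite ltr_pdivrMr // ltr_pMr // ltr1n.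
have uinj : injective u.
  move=> i j /addrI/(mulfI (lt0r_neq0 d0))/invr_inj/eqP.
  by rewrite eqr_nat => /eqP[].
pose rs := [seq u j | j <- iota 0 (size p)].
have rr : all (root p) rs.
  apply/allP => _ /mapP[j _ ->]; apply/rootP; apply/eqP/negPn/negP => hj.
  by apply: h; exists j.
have ur : uniq rs by rewrite map_inj_uniq // iota_uniq.
by have := max_poly_roots p0 rr ur; rewrite size_map size_iota ltnn.
Qed.

(** First the zeros of the leading coefficient are avoided, then the finitely many roots in the
    outermost variable. *)
Lemma nonvanishing_near n z (H : pring C n) delta : H != 0 -> 0 < delta ->
  exists2 w, (forall i, (i < n)%N -> `|w i - z i| < delta) & evC w n H != 0.
Proof.
move=> H0 d0; elim: n H H0 => [|n ih] H H0; first by exists z.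
have [|w hw ne] := ih (lead_coef (H : {poly pring C n})).
  by rewrite lead_coef_eq0.
pose p := map_poly (evC w n) H.
have p0 : p != 0.
  apply: contra ne => /eqP e; have := coef_map (evC w n) H (size H).-1.
  by rewrite -/p e coef0 -lead_coefE => <-.
have [t ht pt] := poly_nonroot_near (z n) p0 d0.
exists (fun i => if i == n then t else w i) => [i|].
  by rewrite ltnS leq_eqVlt => /predU1P[->|lt]; rewrite ?eqxx // (ltn_eqF lt) hw.
rewrite /= eqxx [X in X != 0]poly_ext_horner.
rewrite (_ : map_poly _ _ = p) //; apply: eq_map_poly => c.
by apply: ev_ext => i lt; rewrite (ltn_eqF lt).
Qed.

Lemma root_bound m (c : 'I_m -> C) (b : C) : b ^+ m + \sum_(i < m) c i * b ^+ i = 0 ->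
  `|b| <= 1 + \sum_(i < m) `|c i|.
Proof.
move=> e; have s0 : 0 <= \sum_(i < m) `|c i| by apply: sumr_ge0.
have [le|gt] := real_leP (normr_real b) (@real1 C).
  by apply: (le_trans le); rewrite lerDl.
case: m c e s0 => [|m] c e s0.
  by move/eqP: e; rewrite big_ord0 addr0 expr0 oner_eq0.
have b0 : 0 < `|b| := lt_trans ltr01 gt.
apply: (le_trans (y := \sum_(i < m.+1) `|c i|)); last by rewrite lerDr.
have pb : 0 < `|b| ^+ m by rewrite exprn_gt0.
rewrite -(ler_pM2r pb) -exprS -normrX.
have -> : b ^+ m.+1 = - \sum_(i < m.+1) c i * b ^+ i.
  by apply/eqP; rewrite -addr_eq0; apply/eqP.
rewrite normrN mulr_suml; apply: (le_trans (ler_norm_sum _ _ _)).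
apply: ler_sum => i _; rewrite normrM normrX; apply: ler_wpM2l => //.
by apply: ler_weXn2l; [exact: ltW|rewrite -ltnS].
Qed.

(** The product of the roots has modulus |F(0)|, so they cannot all have modulus at least delta.
    This is the only form of continuity of roots that is used. *)
Lemma small_root (F : {poly C}) delta : F \is monic -> 0 < delta ->
  `|F.[0]| < delta ^+ (size F).-1 -> exists2 t, root F t & `|t| < delta.
Proof.
move=> mF d0; have [rs e] := closed_field_poly_normal F.
move: e; rewrite (monicP mF) scale1r => ->; rewrite size_prod_XsubC /=.
elim: rs => [|r rs ih]; first by rewrite big_nil hornerC normr1 ltxx.
rewrite big_cons hornerM normrM hornerXsubC sub0r normrN exprS => lt.
have [rd|dr] := real_ltP (normr_real r) (gtr0_real d0).
  by exists r => //; rewrite rootM root_XsubC eqxx.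
have [|t rt td] := ih.
  rewrite -(ltr_pM2l d0); apply: le_lt_trans lt.
  exact: ler_wpM2r.
by exists t => //; rewrite rootM rt orbT.
Qed.

End Near.

(** * Points of algebras integral over a finitely generated one *)

Section Points.
Variables (R : realType) (B : comPzRingType) (k : {rmorphism R[i] -> B}).
Local Notation C := R[i].
Local Notation evC := (ev (idfun : {rmorphism C -> C})).

Definition is_point (eta : {rmorphism B -> C}) := forall c, eta (k c) = c.

Lemma point_ev (eta : {rmorphism B -> C}) x n P : is_point eta ->
  eta (ev k x n P) = evC (eta \o x) n P.
Proof. by move=> h; apply: rmorph_ev => c; exact: h. Qed.

Lemma point_kernel_maximal eta : is_point eta -> is_maximal [set b | eta b = 0].
Proof.
move=> h; split=> [||J [J0 JD JM] J1 le] /=.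
- exact: kernel_ideal.
- by rewrite rmorph1 => /eqP; rewrite oner_eq0.
- apply/seteqP; split=> // b Jb; apply: contrapT => /eqP ne; apply: J1.
  rewrite -(rmorph1 k) -(mulVf ne) rmorphM; apply: (JM).
  rewrite -[k _](subKr b); apply: (JD) => //.
  by rewrite -mulN1r; apply: (JM); apply: le => /=; rewrite rmorphB h subrr.
Qed.

Lemma residue_maximal (Q : set B) : is_ideal Q -> ~ Q 1 ->
  (forall b, exists c, Q (b - k c)) -> is_maximal Q.
Proof.
move=> hQ Q1 h; split=> // J hJ J1 QJ; apply/seteqP; split=> // b Jb.
have [c Qc] := h b; have [_ _ JM] := hJ.
have [e|ne] := eqVneq c 0; first by move: Qc; rewrite e rmorph0 subr0.
exfalso; apply: J1; rewrite -(rmorph1 k) -(mulVf ne) rmorphM; apply: (JM).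
exact: (ideal_subl hJ (QJ _ Qc)).
Qed.

Lemma residue_point (Q : set B) : is_ideal Q -> ~ Q 1 ->
  (forall b, exists c, Q (b - k c)) ->
  exists eta : {rmorphism B -> C}, is_point eta /\ forall b, Q b <-> eta b = 0.
Proof.
move=> hQ Q1 /choice[e he]; have [Q0 QD QM] := hQ.
have uniq c d : Q (k c - k d) -> c = d.
  move=> Qcd; apply/eqP; rewrite -subr_eq0; apply/negPn/negP => ne; apply: Q1.
  by rewrite -(rmorph1 k) -(mulVf ne) rmorphM; apply: QM; rewrite rmorphB.
have eP b c : Q (b - k c) -> e b = c.
  move=> Qc; apply: uniq; have -> : k (e b) - k c = (b - k c) - (b - k (e b)) by ring.
  exact: idealB.
have ea : zmod_morphism e.
  move=> a b; apply: eP; rewrite rmorphB.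
  have -> : a - b - (k (e a) - k (e b)) = (a - k (e a)) - (b - k (e b)) by ring.
  exact: idealB.
have em : monoid_morphism e.
  split=> [|a b]; apply: eP; first by rewrite rmorph1 subrr.
  rewrite rmorphM.
  have -> : a * b - k (e a) * k (e b) = b * (a - k (e a)) + k (e a) * (b - k (e b)) by ring.
  by apply: QD; exact: QM.
pose e' : {rmorphism B -> C} := HB.pack e
   (GRing.isZmodMorphism.Build B C e ea) (GRing.isMonoidMorphism.Build B C e em).
exists e'; split=> [c|b]; first by apply: eP; rewrite subrr.
split=> [Qb|e0]; first by apply: eP; rewrite rmorph0 subr0.
by have := he b; rewrite -[e b]/(e' b) e0 rmorph0 subr0.
Qed.

Section Lift.
Variables (S : comPzRingType) (f : {rmorphism S -> B}) (e : {rmorphism S -> C}).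

(** Modulo Q the integral equation of b has coefficients in C and splits into linear factors;
    primality of Q selects one of them. *)
Lemma residue_integral (Q : set B) : is_prime Q ->
  (forall s, Q (f s - k (e s))) -> forall b, integral_elt f b -> exists c, Q (b - k c).
Proof.
move=> pQ Qf b [m [c eb]]; have [hQ Q1 Qp] := pQ; have [Q0 QD QM] := hQ.
pose p : {poly C} := 'X^m + \sum_(i < m) (e (c i))%:P * 'X^i.
have Qpb : Q (poly_ext k b p).
  rewrite rmorphD rmorphXn poly_extX rmorph_sum.
  under eq_bigr do rewrite rmorphM rmorphXn poly_extX poly_extC.
  have -> : b ^+ m + \sum_(i < m) k (e (c i)) * b ^+ i =
    - \sum_(i < m) b ^+ i * (f (c i) - k (e (c i))).
    rewrite -[LHS]subr0 -[X in _ - X = _]eb; under [in RHS]eq_bigr do rewrite mulrBr.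
    rewrite sumrB opprB.
    under [X in _ = X - _]eq_bigr do rewrite mulrC.
    by under [X in _ = _ - X]eq_bigr do rewrite mulrC; ring.
  rewrite -mulN1r; apply: (QM); apply: ideal_sum => // i; exact: QM.
have [rs ep] := closed_field_poly_normal p.
have lp : lead_coef p = 1.
  rewrite lead_coefDl ?lead_coefXn // size_polyXn.
  apply: (leq_ltn_trans (size_sum _ _ _)); rewrite ltnS; apply/bigmax_leqP => i _.
  by rewrite mul_polyC (leq_trans (size_scale_leq _ _)) ?size_polyXn.
move: Qpb; rewrite ep lp scale1r.
elim: rs {ep} => [|r rs ih]; first by rewrite big_nil rmorph1.
rewrite big_cons rmorphM => /Qp[|/ih//].
by rewrite rmorphB poly_extX poly_extC => h; exists r.
Qed.

Hypothesis integral_f : integral_ext f.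

Lemma point_of_prime_over (Q : set B) : is_prime Q -> (forall s, Q (f s - k (e s))) ->
  exists eta : {rmorphism B -> C}, [/\ is_point eta, forall b, Q b <-> eta b = 0 &
     forall s, eta (f s) = e s].
Proof.
move=> pQ Qf; have [hQ Q1 _] := pQ.
have [eta [pe eQ]] := residue_point hQ Q1
  (fun b => residue_integral pQ Qf (integral_f b)).
exists eta; split=> // s; apply/eqP; rewrite -subr_eq0 -[X in _ - X]pe -rmorphB.
by apply/eqP/eQ; exact: Qf.
Qed.

(** Lying over in geometric form: e lifts to a point of the closed subset V(J) as soon as e kills
    the contraction of J. *)
Lemma point_lift (kS : {rmorphism C -> S}) (J : set B) : (forall c, f (kS c) = k c) ->
  (forall c, e (kS c) = c) -> is_ideal J -> (forall s, J (f s) -> e s = 0) ->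
  exists eta : {rmorphism B -> C}, [/\ is_point eta, forall b, J b -> eta b = 0 &
     forall s, eta (f s) = e s].
Proof.
move=> fk ek hJ JP.
have pP := kernel_prime e.
have [Q [pQ JQ hQ]] := lying_over pP integral_f hJ JP.
have [|eta [pe eQ ef]] := @point_of_prime_over Q pQ.
  by move=> s; rewrite -fk -rmorphB; apply/hQ; rewrite /= rmorphB ek subrr.
by exists eta; split=> // b /JQ/eQ.
Qed.

End Lift.

Variables (n : nat) (x : nat -> B).
Hypothesis integral_B : integral_ext (ev k x n).

Lemma point_of_prime (Q : set B) z : is_prime Q ->
  (forall i, (i < n)%N -> Q (x i - k (z i))) ->
  exists eta : {rmorphism B -> C}, [/\ is_point eta, forall b, Q b <-> eta b = 0 &
     forall i, (i < n)%N -> eta (x i) = z i].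
Proof.
move=> pQ Qx; have [hQ Q1 _] := pQ; have [Q0 QD QM] := hQ.
have Qev P : Q (ev k x n P - k (evC z n P)).
  elim/(@pring_ind C n): P => [d|i lt|P P' h h'|P P' h h'].
  - by rewrite !ev_const subrr.
  - by rewrite !ev_var //; exact: Qx.
  - rewrite !rmorphD opprD addrACA; exact: QD.
  - rewrite !rmorphM.
    set a := ev k x n P; set a' := ev k x n P'.
    set d := k (evC z n P); set d' := k (evC z n P').
    have -> : a * a' - d * d' = a' * (a - d) + d * (a' - d') by ring.
    by apply: QD; exact: QM.
have [eta [pe eQ ee]] := point_of_prime_over integral_B pQ Qev.
by exists eta; split=> // i lt; rewrite -(ev_var k x lt) ee ev_var.
Qed.

Lemma point_over z : (forall P, ev k x n P = 0 -> evC z n P = 0) ->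
  exists eta : {rmorphism B -> C}, is_point eta /\ forall i, (i < n)%N -> eta (x i) = z i.
Proof.
move=> kz.
have [|eta [pe _ ee]] := @point_lift _ (ev k x n) (evC z n) integral_B (pconst C n) [set 0]
  (ev_const k x n) (ev_const _ z n) (zero_ideal B); first exact: kz.
by exists eta; split=> // i lt; rewrite -(ev_var k x lt) ee ev_var.
Qed.

(** The coefficients of an integral equation of b are polynomials in the x i, hence bounded near z,
    and [root_bound] then bounds the values of b. *)
Lemma near_bounded z b : exists2 M : C, 0 <= M & near_point n z (fun w =>
  forall eta : {rmorphism B -> C}, is_point eta ->
    (forall i, (i < n)%N -> eta (x i) = w i) -> `|eta b| <= M).
Proof.
have [m [c e]] := integral_B b.
exists (1 + \sum_(i < m) (`|evC z n (c i)| + 1)).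
  by apply: addr_ge0 => //; apply: sumr_ge0 => i _; exact: addr_ge0.
pose c' j := if insub j is Some i then c i else 0.
have := @near_all _ n z m (fun j w => `|evC w n (c' j)| <= `|evC z n (c' j)| + 1)
  (fun j lt => @near_ev_bounded R n z (c' j)).
apply: near_imp => w h eta pe ex.
have h' (i : 'I_m) : `|evC w n (c i)| <= `|evC z n (c i)| + 1.
  by have := h i (ltn_ord i); rewrite /c' valK.
apply: (le_trans (y := 1 + \sum_(i < m) `|evC w n (c i)|)); last first.
  by rewrite lerD2l; apply: ler_sum => i _.
apply: root_bound; rewrite -[RHS](rmorph0 eta) -e rmorphD rmorphXn rmorph_sum.
congr (_ + _); apply: eq_bigr => i _; rewrite rmorphM rmorphXn point_ev //.
by congr (_ * _); apply: ev_ext => j lt; rewrite /= ex.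
Qed.

(* If g takes the single value t on the fibre over z, then g - t is nilpotent modulo the
   ideal of the fibre, so its powers are combinations of the x i - z i with bounded
   coefficients. *)
Lemma near_fiber z g t : (forall eta : {rmorphism B -> C}, is_point eta ->
    (forall i, (i < n)%N -> eta (x i) = z i) -> eta g = t) ->
  forall eps, 0 < eps -> near_point n z (fun w =>
    forall eta : {rmorphism B -> C}, is_point eta ->
      (forall i, (i < n)%N -> eta (x i) = w i) -> `|eta g - t| < eps).
Proof.
move=> hg eps e0.
pose J : set B := [set b | exists c : nat -> B, b = \sum_(i < n) c i * (x i - k (z i))].
have hJ : is_ideal J.
  split; first by exists (fun=> 0); rewrite big1 // => i _; rewrite mul0r.
    move=> _ _ [c ->] [d ->]; exists (c \+ d); rewrite -big_split /=.
    by apply: eq_bigr => i _; rewrite mulrDl.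
  move=> a _ [c ->]; exists (fun i => a * c i); rewrite mulr_sumr.
  by apply: eq_bigr => i _; rewrite mulrA.
(* Otherwise a prime over J avoiding the powers of [g - k t] would be a point over z at which g
   differs from t. *)
have [N [c e]] : exists N, J ((g - k t) ^+ N.+1).
  apply: contrapT => nJ.
  have [|Q [pQ JQ dQ _]] := @prime_ideal_avoiding B J (powers (g - k t)) hJ.
    move=> _ [i <-] Ji; apply: nJ; exists i; rewrite exprS.
    by have [_ _] := hJ; apply.
  have [|eta [pe eQ ex]] := @point_of_prime Q z pQ.
    move=> i lt; apply: JQ; exists (fun j => (j == i)%:R).
    rewrite (bigD1 (Ordinal lt)) //= eqxx mul1r big1 ?addr0 // => j ne.
    by rewrite (_ : (j : nat) == i = false) ?mul0r //; apply/negbTE.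
  apply: (dQ (g - k t)); first by exists 1%N; rewrite expr1.
  by apply/eQ; rewrite rmorphB hg // pe subrr.
have /choice[M' hM'] (i : nat) : exists M, 0 <= M /\ near_point n z (fun w =>
    forall eta : {rmorphism B -> C}, is_point eta ->
      (forall i, (i < n)%N -> eta (x i) = w i) -> `|eta (c i)| <= M).
  by have [M1 M10 h] := near_bounded z (c i); exists M1.
pose T := \sum_(i < n) M' i + 1.
have T0 : 0 < T.
  by rewrite ltr_wpDl //; apply: sumr_ge0 => i _; case: (hM' i).
(* The sum of the [M' i] is less than T, so the combination of the [w i - z i] stays strictly below
   [eps ^+ N.+1]. *)
pose d := eps ^+ N.+1 / T.
have d0 : 0 < d by rewrite divr_gt0 // exprn_gt0.
have H1 := @near_all _ n z n _ (fun i lt => (hM' i).2).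
have H2 := @near_all _ n z n _ (fun i lt => @near_coord R n z d i d0 lt).
apply: near_imp (near_and H1 H2) => w [h1 h2] eta pe ex.
rewrite real_ltNge ?normr_real ?gtr0_real //; apply/negP => le.
have : eps ^+ N.+1 <= `|eta g - t| ^+ N.+1.
  by apply: lerXn2r => //; rewrite nnegrE ltW.
apply/negP; rewrite -real_ltNge; last 2 first.
- by rewrite realX // normr_real.
- by rewrite realX // gtr0_real.
rewrite -normrX.
have -> : (eta g - t) ^+ N.+1 = \sum_(i < n) eta (c i) * (w i - z i).
  rewrite -{1}[t]pe -rmorphB -rmorphXn e rmorph_sum; apply: eq_bigr => i _.
  by rewrite rmorphM rmorphB pe ex.
apply: (le_lt_trans (ler_norm_sum _ _ _)).
apply: (le_lt_trans (y := \sum_(i < n) M' i * d)).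
  apply: ler_sum => i _; rewrite normrM; apply: ler_pM => //; first exact: h1.
  by apply: ltW; exact: h2.
rewrite -mulr_suml mulrC -ltr_pdivlMl // /d invf_div mulrAC -mulrA divff ?mulr1; last first.
  by rewrite expf_neq0 // gt_eqF.
by rewrite ltrDl.
Qed.

End Points.

(** * Euclidean density of Zariski open sets *)

Section PointsOfDomains.
Variables (R : realType) (D : idomainType) (k : {rmorphism R[i] -> D}).
Local Notation C := R[i].
Local Notation evC := (ev (idfun : {rmorphism C -> C})).
Variables (n : nat) (x : nat -> D).
Hypothesis surj_x : forall a, exists P, ev k x n P = a.

Lemma noether_normalization_surj : exists d z,
  injective (ev k z d) /\ integral_ext (ev k z d).
Proof.
have [d [z [inj h]]] := noether_normalization k n x.
exists d, z; split=> // a; have [P <-] := surj_x a.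
by apply/integral_eltE; exact: ev_integral.
Qed.

(** H is the constant coefficient of a relation of least size of h. It is nonzero, since otherwise
    dividing the relation by the variable would give a smaller one. *)
Lemma divides_base (S : idomainType) (f : {rmorphism S -> D}) h :
  integral_elt f h -> h != 0 -> exists H h', H != 0 /\ f H = h * h'.
Proof.
move=> /integral_eltE ih h0; have [P [P0 eP mP _]] := minimal_algebraic ih.
have [Q eQ] : exists Q, P = Q * 'X + (P`_0)%:P.
  exists (drop_poly 1 P); rewrite -[LHS](poly_take_drop 1 P) expr1 addrC; congr (_ + _).
  by apply/polyP => i; rewrite coef_take_poly coefC; case: i.
exists P`_0, (- (map_poly f Q).[h]); split; last first.
  move: eP; rewrite {1}eQ rmorphD rmorphM /= map_polyX map_polyC hornerD hornerM hornerX hornerC.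
  by move=> /eqP; rewrite addrC addr_eq0 => /eqP ->; rewrite mulrN mulrC.
apply/eqP => e0; move: eQ; rewrite e0 addr0 => eQ.
have Q0 : Q != 0 by apply: contraNneq P0 => e; rewrite eQ e mul0r.
have := mP Q Q0; rewrite leqNgt {1}eQ size_mulX // ltnSn => hQ.
suff: false by []; apply: hQ.
move: eP; rewrite eQ rmorphM /= map_polyX hornerM hornerX => /eqP.
by rewrite mulf_eq0 (negPf h0) orbF => /eqP.
Qed.

Lemma domain_nullstellensatz h : h != 0 ->
  exists eta : {rmorphism D -> C}, is_point k eta /\ eta h != 0.
Proof.
move=> h0; have [d [z [inj iz]]] := noether_normalization_surj.
have [H [h' [H0 eH]]] := divides_base (iz h) h0.
have [w _ wH] := nonvanishing_near (fun=> 0) H0 (@ltr01 C).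
have [|eta [pe ez]] := @point_over R D k d z iz w.
  by move=> P eP; rewrite (inj P 0) ?rmorph0 // eP rmorph0.
exists eta; split=> //; apply: contraNneq wH => e0.
rewrite -(@ev_ext _ _ _ (eta \o z)) => [|i lt]; last by rewrite /= ez.
by rewrite -(point_ev _ _ pe) eH rmorphM e0 mul0r.
Qed.

(* Over the points of a polynomial ring S the points of D are separated from eta by some b;
   near eta(b) = 0 the monic generator F of the relations of b over S has a root, and
   lying over S[b] = S[T]/(F) turns it into a point of D, which is close to eta because
   eta is alone in its fibre over S[b]. *)
Lemma domain_density (eta : {rmorphism D -> C}) h delta : is_point k eta -> h != 0 -> 0 < delta ->
  exists eta' : {rmorphism D -> C}, [/\ is_point k eta', eta' h != 0 &
    forall i, (i < n)%N -> `|eta' (x i) - eta (x i)| < delta].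
Proof.
move=> pe h0 d0; have [d [z [inj iz]]] := noether_normalization_surj.
have [H [h' [H0 eH]]] := divides_base (iz h) h0.
(* [r j] lists the possible values of [x j] on the fibre of eta: the roots of its integral equation
   specialised at eta. *)
have /choice[r hr] j : exists rs : seq C, forall eta' : {rmorphism D -> C}, is_point k eta' ->
    (forall i, (i < d)%N -> eta' (z i) = eta (z i)) -> eta' (x j) \in rs.
  have [G mG /rootP rG] := (integral_eltE _ _).1 (iz (x j)).
  pose p := map_poly (evC (eta \o z) d) G.
  have [rs ep] := closed_field_poly_normal p.
  exists rs => eta' pe' ez; rewrite -root_prod_XsubC.
  have -> : \prod_(z0 <- rs) ('X - z0%:P) = p.
    by rewrite ep (monicP (monic_map _ mG)) scale1r.
  apply/rootP; rewrite -[RHS](rmorph0 eta') -rG -horner_map; congr (_.[_]).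
  rewrite -map_poly_comp; apply: eq_map_poly => c /=.
  by rewrite (point_ev _ _ pe'); apply: ev_ext => i lt; rewrite /= ez.
(* e vanishes at every point of the fibre other than eta, but not at eta; after the shift, b
   vanishes on the fibre at eta only. *)
pose e := \prod_(j < n) \prod_(c <- r j | c != eta (x j)) (x j - k c).
pose b := e - k (eta e).
have eb : eta b = 0 by rewrite rmorphB pe subrr.
have e0 : eta e != 0.
  rewrite rmorph_prod; apply/prodf_neq0 => j _; rewrite rmorph_prod prodf_seq_neq0.
  by apply/allP => c _; apply/implyP => ne; rewrite rmorphB pe subr_eq0 eq_sym.
have sep (eta' : {rmorphism D -> C}) : is_point k eta' ->
    (forall i, (i < d)%N -> eta' (z i) = eta (z i)) -> eta' b = 0 ->
    forall j, (j < n)%N -> eta' (x j) = eta (x j).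
  move=> pe' ez eb' j lt; apply/eqP/negPn/negP => ne.
  move/eqP: eb'; rewrite rmorphB pe' subr_eq0 => /eqP e'.
  case/negP: e0; rewrite -e' rmorph_prod (bigD1 (Ordinal lt)) //= mulf_eq0; apply/orP; left.
  rewrite rmorph_prod prodf_seq_eq0; apply/hasP; exists (eta' (x j)); first exact: hr.
  by rewrite ne rmorphB pe' subrr eqxx.
have [F [mF eF dF]] := factorial_minimal inj (@pring_factorial C d) ((integral_eltE _ _).1 (iz b)).
pose z' i := if i == d then b else z i.
have zz' P : ev k z' d P = ev k z d P.
  by apply: ev_ext => i lt; rewrite /z' (ltn_eqF lt).
have evz' P : ev k z' d.+1 P = (map_poly (ev k z d) (P : {poly pring C d})).[b].
  transitivity (poly_ext (ev k z d) b P); last exact: poly_ext_horner.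
  symmetry; have top : ev k z' d.+1 ('X : {poly pring C d}) = b by rewrite ev_top /z' eqxx.
  rewrite -(@poly_ext_unique _ _ (ev k z d) b (ev k z' d.+1 : {rmorphism {poly pring C d} -> D})) //.
  by move=> c; rewrite ev_lower.
have iz' : integral_ext (ev k z' d.+1).
  move=> a; have [m [c ea]] := iz a; exists m, (fun i => (c i)%:P : {poly pring C d}).
  rewrite -[RHS]ea; congr (_ + _); apply: eq_bigr => i _.
  by rewrite ev_lower zz'.
pose z0 i := eta (z' i).
have near_x j : (j < n)%N -> near_point d.+1 z0 (fun w =>
    forall eta' : {rmorphism D -> C}, is_point k eta' ->
      (forall i, (i < d.+1)%N -> eta' (z' i) = w i) -> `|eta' (x j) - eta (x j)| < delta).
  move=> lt; apply: near_fiber => // eta' pe' ez; apply: sep => //.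
    move=> i lti; have := ez i (ltnW lti).
    by rewrite /z0 /z' (ltn_eqF lti).
  by have := ez d (ltnSn d); rewrite /z0 /z' eqxx eb.
have [d1 d10 hd1] := near_all near_x.
(* Since F(b) = 0 and eta(b) = 0, the constant coefficient of F vanishes at eta; near it, that
   coefficient is small and yields a small root. *)
have F0z : evC z0 d (F : {poly pring C d})`_0 = 0.
  have : eta (ev k z' d.+1 F) = 0 by rewrite evz' eF rmorph0.
  rewrite (point_ev _ _ pe) -/z0.
  have [Q ->] : exists Q, F = Q * 'X + (F`_0)%:P.
    exists (drop_poly 1 F); rewrite -[LHS](poly_take_drop 1 F) expr1 addrC; congr (_ + _).
    by apply/polyP => i; rewrite coef_take_poly coefC; case: i.
  rewrite rmorphD rmorphM ev_top ev_lower coefD coefMX coefC /= add0r.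
  have -> : eta (z' d) = 0 by rewrite /z' eqxx eb.
  by rewrite mulr0 add0r.
have [d2 d20 hd2] := near_ev z0 (F : {poly pring C d})`_0 (exprn_gt0 (size F).-1 d10).
have [d3 d30 [le1 le2]] := ex_smaller d10 d20.
have [w ww wH] := nonvanishing_near z0 H0 d30.
pose Fw := map_poly (evC w d) F.
have mFw : Fw \is monic by exact: monic_map.
have szFw : size Fw = size F by rewrite size_map_poly_id0 // (monicP mF) rmorph1 oner_neq0.
have [|t rt td] := @small_root R Fw d1 mFw d10.
  rewrite szFw horner_coef0 coef_map.
  have := hd2 w (fun i lt => lt_le_trans (ww i lt) le2); by rewrite F0z subr0.
pose w' i := if i == d then t else w i.
have ww' P : evC w' d P = evC w d P.
  by apply: ev_ext => i lt; rewrite /w' (ltn_eqF lt).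
have evw' P : evC w' d.+1 P = (map_poly (evC w d) (P : {poly pring C d})).[t].
  transitivity (poly_ext (evC w d) t P); last exact: poly_ext_horner.
  symmetry; have top : evC w' d.+1 ('X : {poly pring C d}) = t by rewrite ev_top /w' eqxx.
  rewrite -(@poly_ext_unique _ _ (evC w d) t (evC w' d.+1 : {rmorphism {poly pring C d} -> C})) //.
  by move=> c; rewrite ev_lower.
(* Every relation among [z'] is a multiple of F, which vanishes at (w, t). *)
have [|eta' [pe' ez']] := @point_over R D k d.+1 z' iz' w'.
  move=> P; rewrite evz' => /dF[Q ->]; rewrite evw' rmorphM hornerM.
  by rewrite (rootP rt) mul0r.
exists eta'; split=> //.
- apply: contraNneq wH => e0'; rewrite -ww'.
  rewrite (@ev_ext _ _ _ w' (eta' \o z')) => [|i lt]; last by rewrite /= ez' // ltnW.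
  by rewrite -(point_ev _ _ pe') zz' eH rmorphM e0' mul0r.
- move=> i lt; apply: (hd1 w') => // j; rewrite ltnS leq_eqVlt => /predU1P[->|ltj].
    by rewrite /w' eqxx /z0 /z' eqxx eb subr0.
  by rewrite /w' (ltn_eqF ltj); apply: lt_le_trans (ww j ltj) le1.
Qed.

End PointsOfDomains.

(** * Zeros of polynomial ideals *)

Section Zeros.
Variable R : realType.
Local Notation C := R[i].
Local Notation evC := (ev (idfun : {rmorphism C -> C})).

Lemma prime_nullstellensatz (A : comPzRingType) (k : {rmorphism C -> A}) n x (P : set A) h :
  (forall a, exists p, ev k x n p = a) -> is_prime P -> ~ P h ->
  exists eta : {rmorphism A -> C},
    [/\ is_point k eta, forall a, P a -> eta a = 0 & eta h != 0].
Proof.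
move=> sx pP nh; have [D [q [sq qP]]] := prime_quotient pP.
pose kD : {rmorphism C -> D} := q \o k.
have [||eta [pe eh]] := @domain_nullstellensatz R D kD n (q \o x) _ (q h).
- move=> d; have [a <-] := sq d; have [p <-] := sx a; exists p.
  by symmetry; exact: rmorph_ev.
- by apply/eqP => /qP.
exists (eta \o q); split=> //= a /qP ->; exact: rmorph0.
Qed.

Lemma ideal_nullstellensatz N (J : set (pring C N)) : is_ideal J -> ~ J 1 ->
  exists z, forall P, J P -> evC z N P = 0.
Proof.
move=> hJ J1; have [Q pQ JQ] := prime_ideal_above hJ J1; have [_ Q1 _] := pQ.
have [|eta [pe eQ _]] := @prime_nullstellensatz _ (pconst C N) N (pvar C N) Q 1 _ pQ Q1.
  by move=> a; exists a; exact: ev_id.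
exists (eta \o pvar C N) => P /JQ/eQ <-.
by rewrite -(point_ev _ _ pe) ev_id.
Qed.

(** A prime Q over J avoiding all [u * h ^+ m] with u(z) nonzero defines an irreducible set through
    z on which h is not identically zero. It exists because [u * h ^+ m] in J implies u in J, so
    u(z) = 0. *)
Lemma zero_density N (J : set (pring C N)) h z delta : is_ideal J ->
  (forall u, J (h * u) -> J u) -> (forall P, J P -> evC z N P = 0) -> 0 < delta ->
  exists w, [/\ forall P, J P -> evC w N P = 0, evC w N h != 0 &
    forall i, (i < N)%N -> `|w i - z i| < delta].
Proof.
move=> hJ regh zJ d0.
pose MS (a : pring C N) := exists u m, evC z N u != 0 /\ a = u * h ^+ m.
have m1 : MS 1 by exists 1, 0%N; rewrite rmorph1 oner_neq0 expr0 mulr1.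
have mM a b : MS a -> MS b -> MS (a * b).
  move=> [u [i [u0 ->]]] [v [j [v0 ->]]]; exists (u * v), (i + j)%N.
  by rewrite rmorphM mulf_neq0 // exprD; split=> //; ring.
have [|Q [pQ JQ dQ _]] := @prime_ideal_avoiding _ J (Multset m1 mM) hJ.
  move=> _ [u [m [u0 ->]]] Ju; case/negP: u0; apply/eqP; apply: zJ.
  elim: m Ju => [|m ih]; first by rewrite expr0 mulr1.
  by rewrite exprS mulrCA => /regh.
have [D [q [sq qQ]]] := prime_quotient pQ.
have qh : q h != 0.
  apply/eqP => /qQ; apply: dQ; exists 1, 1%N.
  by rewrite rmorph1 oner_neq0 mul1r expr1.
pose kD : {rmorphism C -> D} := q \o pconst C N.
have [|eta0 e0] := @factor_through _ _ _ q (evC z N) sq.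
  move=> a /qQ Qa; apply/eqP/negPn/negP => ne; apply: (dQ a) => //.
  by exists a, 0%N; rewrite expr0 mulr1.
have evq P : ev kD (q \o pvar C N) N P = q P.
  by rewrite -(rmorph_ev (k := pconst C N) (pvar C N) P (g := q)) // ev_id.
have pe0 : is_point kD eta0 by move=> c; rewrite /= e0 ev_const.
have [|eta [pe eh ed]] := @domain_density R D kD N (q \o pvar C N) _ eta0 (q h) delta pe0 qh d0.
  by move=> a; have [P <-] := sq a; exists P.
have evw P : evC (eta \o (q \o pvar C N)) N P = eta (q P).
  by rewrite -evq (point_ev _ _ pe).
exists (eta \o (q \o pvar C N)); split.
- by move=> P /JQ/qQ; rewrite evw => ->; exact: rmorph0.
- by rewrite evw.
- by move=> i lt; have := ed i lt; rewrite /= e0 ev_var.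
Qed.

End Zeros.

(** * Euclidean continuity in coordinates *)

Section Variety.
Variables (R : realType) (X : affine_variety R).
Local Notation C := R[i].
Local Notation evC := (ev (idfun : {rmorphism C -> C})).
Local Notation pt := (closed_point X).
Local Notation k := (Defs.scalar X).
Local Notation val_at := (value (Defs.scalar X)).
Local Notation n := (embdim X).

Definition coords (i : nat) : X := if insub i is Some j then Defs.coord j else 0.

Lemma coordsE (j : 'I_n) : coords j = Defs.coord j.
Proof. by rewrite /coords valK. Qed.

Lemma coords_surj (a : X) : exists P, ev k coords n P = a.
Proof.
apply: (coord_generates (ev_subalgebra k coords n)) => i.
by exists (pvar C n i); rewrite ev_var ?coordsE.
Qed.

Lemma euclidean_continuousP (f : pt -> C) : euclidean_continuous f <->
  forall (m : pt) (eps : C), 0 < eps -> exists2 delta, 0 < delta & forall m' : pt,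
    (forall i, (i < n)%N -> `|val_at (coords i) m' - val_at (coords i) m| < delta) ->
    `|f m' - f m| < eps.
Proof.
split=> [cf m eps e0|h m];
    have FF : Filter (nbhs (m : initial_topology (@embedding R X))) by exact: nbhs_filter.
  have nf : nbhs (m : initial_topology (@embedding R X)) [set t | `|f m - f t| < eps].
    exact: ((@cvgrPdist_lt C C^o _ _ FF f (f m)).1 (cf m) eps e0).
  move: nf; rewrite nbhsE => -[U [[A oA <-] Am] sU].
  have nA : nbhs (embedding m) A by apply: open_nbhs_nbhs; split.
  have [d d0 hd] := (nbhs_ballP _ _).1 nA.
  exists d => // m' hm'; rewrite distrC; apply: sU; apply: hd; split=> // i j.
  by rewrite !mxE -ball_normE /= -coordsE distrC; exact: hm'.
apply/(@cvgrPdist_lt C C^o _ _ FF f (f m)) => eps e0; have [d d0 hd] := h m eps e0.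
have sub : @embedding R X @^-1` ball (embedding m) d `<=` [set t | `|f m - f t| < eps].
  move=> m' mb; have [_ hb] : ball (embedding m) d (embedding m') := mb.
  change (`|f m - f m'| < eps).
  rewrite distrC; apply: hd => i lt.
  have := hb ord0 (Ordinal lt); rewrite !mxE -ball_normE /= -coordsE distrC; exact.
change (nbhs (m : initial_topology (@embedding R X)) [set t | `|f m - f t| < eps]).
rewrite nbhsE; exists (@embedding R X @^-1` (interior (ball (embedding m) d))).
  split; last exact: nbhsx_ballx.
  by exists (interior (ball (embedding m) d)) => //; exact: open_interior.
by move=> m' /interior_subset; exact: sub.
Qed.

End Variety.

(** * Fractions on an affine variety *)

Section ClosedPoints.

Lemma closed_point_eq (A : comPzRingType) (m m' : closed_point A) :
  (forall a, m a <-> m' a) -> m = m'.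
Proof.
case: m m' => [I hI] [J hJ] /= e.
have E : I = J by apply/funext => a; exact/propext.
by subst J; congr ClosedPoint; exact: Prop_irrelevance.
Qed.

Variables (R : realType) (B : comPzRingType) (k : {rmorphism R[i] -> B}).

Lemma value_of_point (m : closed_point B) (eta : {rmorphism B -> R[i]}) : is_point k eta ->
  (forall b, m b <-> eta b = 0) -> forall b, value k b m = eta b.
Proof.
move=> pe me b; rewrite /value; case: xgetP => [c _ /me|/(_ (eta b))/me].
  by rewrite rmorphB pe => /eqP; rewrite subr_eq0 => /eqP.
by rewrite rmorphB pe subrr.
Qed.

Lemma closed_point_residue (m : closed_point B) : (forall b, exists c, m (b - k c)) ->
  exists eta : {rmorphism B -> R[i]},
    [/\ is_point k eta, forall b, m b <-> eta b = 0 & forall b, value k b m = eta b].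
Proof.
move=> h; have [hm m1 _] := point_idealP m.
have [eta [pe me]] := residue_point hm m1 h.
by exists eta; split=> //; exact: value_of_point.
Qed.

Lemma closed_point_of (eta : {rmorphism B -> R[i]}) : is_point k eta ->
  exists m : closed_point B, (forall b, m b <-> eta b = 0) /\ forall b, value k b m = eta b.
Proof.
move=> pe; exists (ClosedPoint (point_kernel_maximal pe)); split=> //.
exact: value_of_point.
Qed.

End ClosedPoints.

Section LocalizationUnits.
Variables (A : comPzRingType) (S : multset A).

Lemma loc_in_unit s : S s -> loc_frac S 1 s * loc_in S s = 1.
Proof.
move=> Ss; have S1 := multset1 S; rewrite /loc_in loc_fracM // mul1r mulr1.
rewrite -(rmorph1 (loc_in S)); apply: (loc_frac_eq _ _ Ss S1).2.
by exists 1 => //; ring.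
Qed.

Lemma loc_in_cancel s (y : localization S) : S s -> loc_in S s * y = 0 -> y = 0.
Proof. by move=> /loc_in_unit e h; rewrite -[y]mul1r -e -mulrA h mulr0. Qed.

Lemma loc_in_eq0 a : loc_in S a = 0 -> exists2 u, S u & u * a = 0.
Proof.
move=> h; have S1 := multset1 S.
have /(loc_frac_eq _ _ S1 S1)[u Su e] : loc_in S a = loc_in S 0 by rewrite h rmorph0.
by exists u => //; move: e; rewrite !mulr1 mulr0.
Qed.

Lemma loc_in_frac a s : S s -> loc_in S s * loc_frac S a s = loc_in S a.
Proof.
move=> Ss; have S1 := multset1 S; rewrite /loc_in loc_fracM // mul1r.
by apply: (loc_frac_eq _ _ Ss S1).2; exists 1 => //; ring.
Qed.

Lemma loc_surj (y : localization S) : exists a s, S s /\ y = loc_frac S a s.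
Proof.
elim/quotW: y => -[a s]; exists a, (sval s); split; first exact: denomP.
rewrite (loc_fracE _ (denomP s)); congr (\pi_(localization S) (_, _)).
by apply: val_inj.
Qed.

End LocalizationUnits.

Section Fractions.
Variables (R : realType) (X : affine_variety R).
Local Notation C := R[i].
Local Notation evC := (ev (idfun : {rmorphism C -> C})).
Local Notation pt := (closed_point X).
Local Notation k := (Defs.scalar X).
Local Notation val_at := (value (Defs.scalar X)).
Local Notation n := (embdim X).
Local Notation x := (coords X).

Lemma variety_point (m : pt) : exists eta : {rmorphism X -> C},
  [/\ is_point k eta, forall a, m a <-> eta a = 0 & forall a, val_at a m = eta a].
Proof.
apply: closed_point_residue => b.
exact: (residue_field (@coord_generates R X) b (point_idealP m)).
Qed.

Lemma reduced_nullstellensatz (u : X) : u <> 0 ->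
  exists eta : {rmorphism X -> C}, is_point k eta /\ eta u != 0.
Proof.
move=> u0.
have [|P [pP _ dP _]] := @prime_ideal_avoiding X [set 0] (powers u) (@zero_ideal X).
  by move=> _ [i <-] /coord_ring_reduced.
have [|eta [pe _ eu]] := @prime_nullstellensatz _ _ k n x P u (@coords_surj R X) pP.
  by apply: dP; exists 1%N; rewrite expr1.
by exists eta.
Qed.

(* Otherwise J would contain an infinite sequence of nonzero, pairwise orthogonal elements. *)
Lemma reduced_ideal_regular (J : set X) : is_ideal J ->
  (forall u, u <> 0 -> exists2 t, J t & t * u <> 0) -> exists2 s, J s & regular s.
Proof.
move=> [J0 JD JM] hJ; apply: contrapT => nreg.
have nxt s : exists y, J s -> [/\ J y, y <> 0 & s * y = 0].
  have [Js|nJ] := pselect (J s); last by exists 0.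
  have /existsNP[u /not_implyP[su u0]] : ~ regular s by move=> rs; apply: nreg; exists s.
  have [t Jt tu] := hJ u u0; exists (t * u) => _; split=> //.
    by rewrite mulrC; exact: JM.
  by rewrite mulrCA su mulr0.
have [g hg] := choice nxt.
pose s := fix s i := if i is j.+1 then s j + g (s j) else 0 : X.
have Js i : J (s i).
  elim: i => [//|i ih] /=; apply: JD => //; by have [] := hg _ ih.
pose y i := g (s i).
have [y0 sy] : (forall i, y i <> 0) /\ forall i, s i * y i = 0.
  by split=> i; have [] := hg _ (Js i).
have sE i : s i = \sum_(j < i) y j.
  by elim: i => [|i ih]; rewrite ?big_ord0 // big_ord_recr /= -ih.
have orth i : forall j, (j < i)%N -> y j * y i = 0.
  elim/ltn_ind: i => i ih j ji.
  (* By orthogonality so far, only the square of [y j] survives in [y j * s i]; as [s i] kills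
     [y i], the square of [y j * y i] is zero. *)
  have e : y j * s i = y j * y j.
    rewrite sE mulr_sumr (bigD1 (Ordinal ji)) //= big1 ?addr0 // => l ne.
    have [lj|jl|elj] := ltngtP l j.
    - by rewrite mulrC; exact: ih.
    - exact: (ih l (ltn_ord l)).
    - by move: ne; rewrite -(inj_eq val_inj) /= elj eqxx.
  apply: (@coord_ring_reduced _ X _ 2).
  have -> : (y j * y i) ^+ 2 = y i * (y j * y j * y i) by ring.
  by rewrite -e -mulrA sy !mulr0.
(* Some [y m] is a combination of earlier terms, all orthogonal to it, so its square is zero. *)
have [m [c e]] := noetherian_surj (@coords_surj R X) (@pring_noetherian C n) y.
apply: (y0 m); apply: (@coord_ring_reduced _ X _ 2).
rewrite expr2 {1}e mulr_suml big1 // => i _.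
by rewrite -mulrA orth // mulr0.
Qed.

(** J is the ideal of global denominators of f. No nonzero u kills it: by density f is a local
    fraction near some point where u does not vanish, and [reduced_ideal_regular] applies. *)
Lemma rational_fraction (f : pt -> C) : Defs.rational f ->
  exists s a, regular s /\ forall m, val_at s m * f m = val_at a m.
Proof.
move=> [U [oU dU rU]].
pose J : set X := [set s | exists a, forall m, val_at s m * f m = val_at a m].
have vD a b m : val_at (a + b) m = val_at a m + val_at b m.
  by have [eta [_ _ e]] := variety_point m; rewrite !e rmorphD.
have v0 m : val_at 0 m = 0 by have [eta [_ _ e]] := variety_point m; rewrite e rmorph0.
have hJ : is_ideal J.
  split=> [|s t [a ha] [b hb]|u s [a ha]].
  - by exists 0 => m; rewrite v0 mul0r.
  - by exists (a + b) => m; rewrite !vD mulrDl ha hb.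
  - by exists (u * a) => m; rewrite !valueM -mulrA ha.
have [|s [a ha] rs] := reduced_ideal_regular hJ; last by exists s, a.
move=> u u0; have [eta [pe eu]] := reduced_nullstellensatz u0.
have [m0 [hm0 _]] := closed_point_of pe.
have [||q [nuq Uq]] := dU [set m : pt | ~ [set u] `<=` m].
- by exists [set u].
- by exists m0 => /= h; move: (h u erefl) => /hm0/eqP; rewrite (negPf eu).
have nu : ~ q u by move=> h; apply: nuq => _ ->.
have [W [a [s [[I WI] Wq WU hW]]]] := rU q Uq.
have [h [Ih nh]] : exists h, I h /\ ~ q h.
  move: Wq; rewrite WI /= => /existsNP[h /not_implyP[Ih nh]]; by exists h.
(* h vanishes off W, so the local identity multiplied by h holds everywhere. *)
exists (h * s).
  exists (h * a) => m; rewrite !valueM; have [Wm|nW] := pselect (W m).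
    by have [s0 ->] := hW m Wm; rewrite mulrACA -mulrA [_ * val_at a m]mulrC !mulrA mulfK ?mulrA // mulrC.
  have mh : m h by apply: contrapT => nmh; apply: nW; rewrite WI /= => /(_ h Ih).
  have [eta' [_ me ve]] := variety_point m.
  by rewrite ve (me h).1 // !mul0r.
have [eta' [_ me ve]] := variety_point q.
have [s0 _] := hW q Wq.
move=> e; have := congr1 eta' e; rewrite !rmorphM rmorph0 => /eqP.
rewrite !mulf_eq0 => /orP[/orP[/eqP/me|]|/eqP/me] //.
by rewrite -ve (negPf s0).
Qed.

Lemma vector_point z : (forall P, ev k x n P = 0 -> evC z n P = 0) ->
  exists m : pt, forall P, val_at (ev k x n P) m = evC z n P.
Proof.
move=> h; have [eta he] := factor_through (@coords_surj R X) h.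
have pe : is_point k eta by move=> c; rewrite -(ev_const k x n) he ev_const.
have [m [_ hm]] := closed_point_of pe.
by exists m => P; rewrite hm.
Qed.

Section ContinuousFraction.
Variables (f : pt -> C) (s a : X).
Hypothesis cf : euclidean_continuous f.
Hypothesis sf : forall m, val_at s m * f m = val_at a m.

(* The points of Spec C[X][b] with s <> 0 lie on the graph of f and are dense. *)
Lemma fraction_value (B : comPzRingType) (j : {rmorphism X -> B}) b
    (eta : {rmorphism B -> C}) (m : pt) :
  j s * b = j a -> (forall y, j s * y = 0 -> y = 0) -> is_point (j \o k) eta ->
  (forall c, eta (j c) = val_at c m) -> eta b = f m.
Proof.
move=> jb rs pe em; apply/eqP/negPn/negP => ne.
pose eps := `|eta b - f m| / 2.
have e0 : 0 < eps by rewrite divr_gt0 // normr_gt0 subr_eq0.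
have [d d0 hd] := (euclidean_continuousP f).1 cf m eps e0.
have [d' d'0 [dd de]] := ex_smaller d0 e0.
pose jk : {rmorphism C -> B} := j \o k.
pose z' i := if i == n then b else j (x i).
have low P : ev jk z' n.+1 (P%:P : {poly pring C n}) = j (ev k x n P).
  rewrite ev_lower (rmorph_ev (l := jk) x P (g := j)) //.
  by apply: ev_ext => i lt; rewrite /z' (ltn_eqF lt).
have top : ev jk z' n.+1 ('X : {poly pring C n}) = b by rewrite ev_top /z' eqxx.
have hJ := kernel_ideal (ev jk z' n.+1).
have [Ps ePs] := coords_surj s; have [Pa ePa] := coords_surj a.
(* The relations among the x i and b cut out the closure of the graph; w is a nearby zero with s
   nonzero, so its last coordinate is a / s, the value of f there. *)
have [||w [wJ ws wd]] := @zero_density R n.+1 [set P | ev jk z' n.+1 P = 0]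
    (Ps%:P : {poly pring C n}) (eta \o z') d' hJ _ _ d'0.
- by move=> u; rewrite /mkset rmorphM low ePs => /rs.
- move=> P eP; rewrite -(point_ev _ _ pe).
  by rewrite (eP : ev jk z' n.+1 P = 0) rmorph0.
have lowC P : evC w n.+1 (P%:P : {poly pring C n}) = evC w n P by rewrite ev_lower.
have [m' hm'] : exists m' : pt, forall P, val_at (ev k x n P) m' = evC w n P.
  apply: vector_point => P eP; rewrite -lowC; apply: wJ; rewrite /mkset.
  by rewrite low eP rmorph0.
have efm' : f m' = w n.
  have : evC w n.+1 (Ps%:P * 'X - Pa%:P : {poly pring C n}) = 0.
    by apply: wJ; rewrite /mkset rmorphB rmorphM !low top ePs ePa jb subrr.
  rewrite rmorphB rmorphM !lowC ev_top => /eqP; rewrite subr_eq0 => /eqP.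
  rewrite -!hm' ePs ePa -sf => /mulfI ->//.
  by move: ws; rewrite lowC -hm' ePs.
have : `|f m' - f m| < eps.
  apply: hd => i lt.
  have := wd i (ltnW lt); rewrite /= /z' (ltn_eqF lt) em => h.
  have -> : x i = ev k x n (pvar C n i) by rewrite ev_var.
  by rewrite hm' ev_var // ev_var //; apply: lt_le_trans h dd.
have : `|w n - eta b| < eps.
  have := wd n (ltnSn n); rewrite /= /z' eqxx => h; exact: lt_le_trans h de.
rewrite efm' distrC => h1 h2; have := ltrD h1 h2; apply/negP.
rewrite /eps -splitr -real_leNgt ?realD ?normr_real //.
apply: le_trans (ler_normD _ _); rewrite le_eqVlt; apply/orP; left.
by apply/eqP; congr (`|_|); ring.
Qed.

End ContinuousFraction.

End Fractions.

(** * Integrality and constancy on the fibres *)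

(** The lower exponents may come in any order and with repetitions. *)
Lemma integral_eltI (A B : comPzRingType) (f : {rmorphism A -> B}) b m q
    (c : 'I_q -> A) (e : 'I_q -> nat) :
  (forall i, (e i < m)%N) -> b ^+ m = \sum_(i < q) f (c i) * b ^+ e i -> integral_elt f b.
Proof.
move=> em eb.
have [d ed] : exists d : 'I_m -> A, b ^+ m = \sum_(i < m) f (d i) * b ^+ i.
  rewrite {1}eb; elim/big_ind: _ => [|y z [d ->] [d' ->]|i _].
  - by exists (fun=> 0); rewrite big1 // => i _; rewrite rmorph0 mul0r.
  - exists (fun i => d i + d' i); rewrite -big_split /=.
    by apply: eq_bigr => i _; rewrite rmorphD mulrDl.
  - exists (fun j => if j == Ordinal (em i) then c i else 0).
    rewrite (bigD1 (Ordinal (em i))) //= eqxx big1 ?addr0 // => j ne.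
    by rewrite (negPf ne) rmorph0 mul0r.
exists m, (fun i => - d i); rewrite {1}ed -big_split big1 //= => i _.
by rewrite rmorphN mulNr subrr.
Qed.

Section IntegralFraction.
Variables (R : realType) (X : affine_variety R).
Local Notation C := R[i].
Local Notation evC := (ev (idfun : {rmorphism C -> C})).
Local Notation pt := (closed_point X).
Local Notation k := (Defs.scalar X).
Local Notation val_at := (value (Defs.scalar X)).
Local Notation n := (embdim X).
Local Notation x := (coords X).
Variables (f : pt -> C) (s a : X).
Hypothesis cf : euclidean_continuous f.
Hypothesis sf : forall m, val_at s m * f m = val_at a m.

(* If g is not integral, then 1/g lies in a maximal ideal of C[X][1/g], i.e. the closure of
   the graph of 1/g contains a point (m, 0); by density there are points m' near m at which
   f = 1/w with w small but nonzero, against the continuity of f at m. *)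
Lemma integral_fraction (g : total_fractions X) : regular s ->
  to_fractions X s * g = to_fractions X a -> integral_elt (to_fractions X) g.
Proof.
move=> rs eg; pose Kg := localization (powers g).
pose io : {rmorphism total_fractions X -> Kg} := loc_in (powers g).
pose w : Kg := loc_frac (powers g) 1 g.
have gP : powers g g by exists 1%N; rewrite expr1.
have wg : w * io g = 1 by exact: loc_in_unit.
have gu y : io g * y = 0 -> y = 0 by exact: loc_in_cancel.
have wu y : w * y = 0 -> y = 0 by move=> e; rewrite -[y]mul1r -wg [w * _]mulrC -mulrA e mulr0.
pose it : {rmorphism X -> Kg} := io \o to_fractions X.
have su y : it s * y = 0 -> y = 0.
  move=> e; rewrite -[y]mul1r -(rmorph1 io) -(@loc_in_unit _ (regular_elts X) s rs) rmorphM.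
  by rewrite -mulrA [X in _ * X]e mulr0.
have ags : it a * w = it s.
  by rewrite /it /= -eg rmorphM -mulrA [io g * w]mulrC wg mulr1.
pose jk : {rmorphism C -> Kg} := it \o k.
pose z' i := if i == n then w else it (x i).
have evl P : ev jk z' n P = it (ev k x n P).
  rewrite (rmorph_ev (l := jk) x P (g := it)) //.
  by apply: ev_ext => i lt; rewrite /z' (ltn_eqF lt).
have low P : ev jk z' n.+1 (P%:P : {poly pring C n}) = it (ev k x n P).
  by rewrite ev_lower evl.
have top : ev jk z' n.+1 ('X : {poly pring C n}) = w by rewrite ev_top /z' eqxx.
pose J : set (pring C n.+1) := [set P | ev jk z' n.+1 P = 0].
have hJ : is_ideal J by exact: kernel_ideal.
pose J' : set (pring C n.+1) := [set P | exists Q, ev jk z' n.+1 P = w * ev jk z' n.+1 Q].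
have hJ' : is_ideal J'.
  split=> [|P P' [Q eQ] [Q' eQ']|P P' [Q eQ]].
  - by exists 0; rewrite !rmorph0 mulr0.
  - by exists (Q + Q'); rewrite !rmorphD eQ eQ' mulrDr.
  - by exists (P * Q); rewrite !rmorphM eQ mulrCA.
(* J' 1 says that 1 is a combination of positive powers of w = 1/g over C[X]. Multiplication by
   [g ^+ q] gives an integral equation in the localization, and a further power of g makes it hold
   before localizing. *)
have [[Q eQ]|nJ'] := pselect (J' 1).
  pose q := size (Q : {poly pring C n}).
  pose c i := ev k x n (Q : {poly pring C n})`_i.
  have eQ' : 1 = \sum_(i < q) it (c i) * w ^+ i.+1.
    rewrite -[LHS](rmorph1 (ev jk z' n.+1)) eQ.
    have -> : ev jk z' n.+1 Q = \sum_(i < q) it (c i) * w ^+ i.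
      transitivity (poly_ext_fun (ev jk z' n) (z' n) Q); first by [].
      by apply: eq_bigr => i _; rewrite evl /z' eqxx.
    by rewrite mulr_sumr; apply: eq_bigr => i _; rewrite mulrCA -exprS.
  have : io (g ^+ q - \sum_(i < q) to_fractions X (c i) * g ^+ (q - i.+1)) = 0.
    rewrite rmorphB rmorph_sum rmorphXn.
    rewrite -[X in X - _]mul1r [X in X * _]eQ' mulr_suml -sumrB big1 // => i _.
    rewrite rmorphM rmorphXn.
    have -> : io g ^+ q = io g ^+ i.+1 * io g ^+ (q - i.+1) by rewrite -exprD subnKC.
    have -> : it (c i) * w ^+ i.+1 * (io g ^+ i.+1 * io g ^+ (q - i.+1)) =
      it (c i) * (w * io g) ^+ i.+1 * io g ^+ (q - i.+1) by rewrite exprMn !mulrA.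
    by rewrite wg expr1n mulr1 subrr.
  move=> /loc_in_eq0[_ [l <-]]; rewrite mulrBr mulr_sumr => /eqP.
  rewrite subr_eq0 -exprD => /eqP e.
  apply: (@integral_eltI _ _ (to_fractions X) g (l + q)%N q (fun i => c i)
    (fun i => l + (q - i.+1))%N).
    by move=> i; rewrite ltn_add2l ltn_subrL /= (leq_ltn_trans (leq0n i) (ltn_ord i)).
  by rewrite e; apply: eq_bigr => i _; rewrite mulrCA -exprD.
exfalso; have [z hz] := ideal_nullstellensatz hJ' nJ'.
have JJ' P : J P -> J' P by move=> eP; exists 0; rewrite rmorph0 mulr0.
have zn : z n = 0.
  rewrite -(ev_top (idfun : {rmorphism C -> C})); apply: hz; exists 1.
  by rewrite rmorph1 mulr1.
have restr v : (forall P, J P -> evC v n.+1 P = 0) ->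
    exists m : pt, forall P, val_at (ev k x n P) m = evC v n P.
  move=> hv; apply: vector_point => P eP.
  rewrite -(ev_lower (idfun : {rmorphism C -> C})); apply: hv.
  by rewrite /J /mkset low eP rmorph0.
have [m hm] := restr z (fun P JP => hz P (JJ' P JP)).
have [d d0 hd] := (euclidean_continuousP f).1 cf m 1 ltr01.
have p0 : 0 < `|f m| + 1 by rewrite ltr_wpDl.
have [d' d'0 [dd de]] := ex_smaller d0 (divr_gt0 ltr01 p0).
have [Ps ePs] := coords_surj s; have [Pa ePa] := coords_surj a.
(* The nonvanishing of s and of the last coordinate puts v over a point m' with f(m') equal to the
   inverse of that coordinate. *)
have [||v [vJ vs vd]] := @zero_density R n.+1 J (Ps%:P * 'X : {poly pring C n}) z d' hJ _ _ d'0.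
- by move=> u; rewrite /J /mkset !rmorphM low top ePs -mulrA => /su/wu.
- by move=> P /JJ'/hz.
have [m' hm'] := restr v vJ.
have eas : val_at a m' * v n = val_at s m'.
  have : evC v n.+1 (Pa%:P * 'X - Ps%:P : {poly pring C n}) = 0.
    by apply: vJ; rewrite /J /mkset rmorphB rmorphM !low top ePs ePa ags subrr.
  rewrite rmorphB rmorphM !ev_lower ev_top -!hm' ePs ePa => /eqP.
  by rewrite subr_eq0 => /eqP.
have s0 : val_at s m' != 0.
  by apply: contraNneq vs => e; rewrite rmorphM ev_lower -hm' ePs e mul0r.
have fv : f m' * v n = 1.
  by apply: (mulfI s0); rewrite mulrA sf eas mulr1.
have fm : `|f m'| < `|f m| + 1.
  have : `|f m' - f m| < 1.
    apply: hd => i lt; have := vd i (ltnW lt) => h.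
    have -> : x i = ev k x n (pvar C n i) by rewrite ev_var.
    by rewrite hm hm' !ev_var //; apply: lt_le_trans h dd.
  move=> h; rewrite -[f m'](subrK (f m)); apply: (le_lt_trans (ler_normD _ _)).
  by rewrite addrC ltrD2l.
have vn : `|v n| < 1 / (`|f m| + 1).
  by have := vd n (ltnSn n); rewrite zn subr0 => h; exact: lt_le_trans h de.
have : `|f m' * v n| < 1.
  rewrite normrM; apply: (le_lt_trans (y := (`|f m| + 1) * `|v n|)).
    by apply: ler_wpM2r => //; exact: ltW.
  by rewrite mulrC -ltr_pdivlMr.
by rewrite fv normr1 ltxx.
Qed.

End IntegralFraction.

(** * Seminormality and constancy on the fibres *)

Section Seminormal.
Variables (R : realType) (A B : comPzRingType) (f : {rmorphism A -> B}).
Local Notation C := R[i].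
Variables (kA : {rmorphism C -> A}) (n : nat) (x : nat -> A).
Hypothesis surj_x : forall a, exists P, ev kA x n P = a.
Hypothesis integral_f : integral_ext f.
Let kB : {rmorphism C -> B} := f \o kA.

(* The minimal polynomial P0 of g over A/P has degree one: at a general point of A/P all its
   roots are simple, and by lying over they are values of g at points of B over that point. *)
Lemma constant_degree_one (g : B) (P : set A) (Q : set B) :
  (forall e1 e2 : {rmorphism B -> C}, is_point kB e1 -> is_point kB e2 ->
     (forall a, e1 (f a) = e2 (f a)) -> e1 g = e2 g) ->
  is_prime P -> is_prime Q -> (forall a, Q (f a) <-> P a) ->
  exists s a, ~ P s /\ Q (f s * g - f a).
Proof.
move=> hg pP pQ QP.
have [D [qA [sA kerA]]] := prime_quotient pP.
have [L [qB [sB kerB]]] := prime_quotient pQ.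
have [|phi hphi] := @factor_through _ _ _ qA (qB \o f) sA.
  by move=> a /kerA/QP/kerB.
have phi_inj : injective phi.
  move=> d d' e; have [b eb] := sA (d - d').
  apply/eqP; rewrite -subr_eq0 -eb; apply/eqP/kerA/QP/kerB.
  by rewrite -[LHS]/((qB \o f) b) -hphi eb rmorphB e subrr.
have iphi : integral_ext phi.
  move=> l; have [b <-] := sB l; have [m [c e]] := integral_f b.
  exists m, (qA \o c); rewrite -[RHS](rmorph0 qB) -e rmorphD rmorphXn rmorph_sum.
  by congr (_ + _); apply: eq_bigr => i _; rewrite rmorphM rmorphXn /= hphi.
pose l := qB g.
have il : integralOver phi l by apply/integral_eltE.
have [P0 [P00 eP0 mP0 dP0]] := minimal_algebraic il.
have [sz2|sz2] := leqP (size P0) 2.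
  have [s es] := sA P0`_1; have [a ea] := sA (- P0`_0).
  have e : phi P0`_1 * l = phi (- P0`_0).
    move: eP0; rewrite (@horner_coef_wide _ 2); last first.
      by apply: leq_trans sz2; exact: size_poly.
    rewrite !big_ord_recl big_ord0 !coef_map /= expr0 expr1 mulr1 addr0 => /eqP.
    by rewrite addrC addr_eq0 rmorphN => /eqP.
  exists s, a; split; last first.
    apply/kerB; rewrite rmorphB rmorphM.
    by rewrite -[qB (f s)]hphi -[qB (f a)]hphi es ea e subrr.
  move=> /kerA; rewrite es => e1.
  have e0 : P0`_0 = 0.
    by apply: phi_inj; apply/eqP; rewrite rmorph0 -oppr_eq0 -rmorphN -e e1 rmorph0 mul0r.
  case/eqP: P00; apply/polyP => i; rewrite coef0; case: i => [|[|i]] //.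
  by rewrite nth_default // (leq_trans sz2).
exfalso.
pose k0 : {rmorphism C -> D} := qA \o kA.
have chD m : (m.+1%:R : D) != 0.
  rewrite -(rmorph_nat k0) fmorph_eq0 pnatr_eq0 //.
(* The characteristic is zero, as D contains C. *)
have dP0n : deriv P0 != 0.
  rewrite -size_poly_gt0; apply: (@leq_trans (size P0).-1); first by case: (size P0) sz2 => [|[|]].
  rewrite leqNgt; apply/negP => lt.
  have : (deriv P0)`_(size P0).-2 = 0.
    by apply: nth_default; move: lt; case: (size P0) sz2 => [|[|m]].
  rewrite coef_deriv; have -> : (size P0).-2.+1 = (size P0).-1 by case: (size P0) sz2 => [|[|m]].
  move=> /eqP; rewrite -mulr_natr mulf_eq0 -lead_coefE lead_coef_eq0 (negPf P00) /=.
  by case: (size P0) sz2 => [|[|m]] // _; rewrite (negPf (chD _)).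
have dl : (map_poly phi (deriv P0)).[l] != 0.
  apply/eqP => e; have := mP0 _ dP0n e; rewrite leqNgt => /negP; apply.
  exact: lt_size_deriv.
have [H [h' [H0 eH]]] := divides_base (iphi (map_poly phi (deriv P0)).[l]) dl.
(* The general point: neither the leading coefficient of P0 nor H, whose image is a multiple of the
   derivative of P0 at l, vanishes there. *)
have [||eta [pe eh]] := @domain_nullstellensatz R D k0 n (qA \o x) _ (H * lead_coef P0).
- move=> d; have [b <-] := sA d; have [p <-] := surj_x b; exists p.
  by symmetry; exact: rmorph_ev.
- by rewrite mulf_neq0 // lead_coef_eq0.
pose p := map_poly eta P0.
move: eh; rewrite rmorphM mulf_eq0 negb_or => /andP[eH0 elc].
pose kL : {rmorphism C -> L} := qB \o kB.
(* A relation of l becomes a multiple of P0 after multiplication by a power of the leading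
   coefficient, which eta does not kill; so it vanishes at t. *)
have lift t : root p t -> exists e : {rmorphism L -> C},
    [/\ is_point kL e, forall d, e (phi d) = eta d & e l = t].
  move=> rt; have iS : integral_ext (poly_ext phi l).
    move=> y; have [m [c e]] := iphi y; exists m, (fun i => (c i)%:P); rewrite -[RHS]e.
    by congr (_ + _); apply: eq_bigr => i _; rewrite poly_extC.
  pose kS : {rmorphism C -> {poly D}} := @polyC D \o k0.
  have [||||e [pe' _ ee]] := @point_lift R L kL {poly D} (poly_ext phi l) (poly_ext eta t) iS kS [set 0].
  - by move=> c; rewrite /= [LHS]poly_extC -[RHS]/((qB \o f) (kA c)) -hphi.
  - by move=> c; rewrite /= [LHS]poly_extC pe.
  - exact: zero_ideal.
  - move=> G /= eG; have {}eG : (map_poly phi G).[l] = 0 by rewrite -poly_ext_horner.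
    have [m [Q' e]] := dP0 G eG.
    have : poly_ext eta t (lead_coef P0 ^+ m *: G) = 0.
      by rewrite e rmorphM [X in X * _]poly_ext_horner (rootP rt) mul0r.
    rewrite -mul_polyC rmorphM poly_extC rmorphXn => /eqP.
    by rewrite mulf_eq0 expf_eq0 (negPf elc) andbF /= => /eqP.
  exists e; split=> // [d|]; first by rewrite -(poly_extC phi l d) ee poly_extC.
  by rewrite -(poly_extX phi l) ee poly_extX.
have eqroots t t' : root p t -> root p t' -> t = t'.
  move=> /lift[e [pe1 e1 <-]] /lift[e' [pe2 e2 <-]].
  apply: (hg (e \o qB) (e' \o qB)) => // b /=.
  by rewrite -[qB (f b)]hphi e1 e2.
have simple t : root p t -> (deriv p).[t] != 0.
  move=> /lift[e [pe1 e1 <-]]; rewrite /p deriv_map.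
  have -> : (map_poly eta (deriv P0)).[e l] = e (map_poly phi (deriv P0)).[l].
    rewrite -horner_map -map_poly_comp; congr (_.[_]); apply: eq_map_poly => d /=.
    by rewrite e1.
  apply: contraNneq eH0 => e0; rewrite -e1 eH rmorphM e0 mul0r //.
have [rs ep] := closed_field_poly_normal p.
have szp : size p = size P0 by rewrite size_map_poly_id0.
have lp0 : lead_coef p != 0 by rewrite lead_coef_eq0 -size_poly_gt0 szp size_poly_gt0.
have : size p = (size rs).+1 by rewrite ep size_scale // size_prod_XsubC.
rewrite szp => szrs; move: sz2; rewrite szrs !ltnS.
case: rs ep {szrs} => [|t1 [|t2 rs]] // ep _.
have rt1 : root p t1 by rewrite ep rootZ // root_prod_XsubC mem_head.
have rt2 : root p t2 by rewrite ep rootZ // root_prod_XsubC !inE eqxx orbT.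
have e12 := eqroots _ _ rt1 rt2.
have := simple _ rt1; rewrite ep !big_cons -e12 derivZ !derivM derivXsubC.
by rewrite !hornerE subrr !(mul0r, mulr0, addr0) eqxx.
Qed.

(** The fraction a / s found for one prime over P serves all of them: two such fractions agree at
    general points of V(P), by lifting to both primes. Every maximal ideal of B_p contracts to a
    prime over P, so g - a / s lies in the Jacobson radical. *)
Lemma seminormal_of_constant (g : B) :
  (forall e1 e2 : {rmorphism B -> C}, is_point kB e1 -> is_point kB e2 ->
     (forall a, e1 (f a) = e2 (f a)) -> e1 g = e2 g) ->
  seminorm_pred f g.
Proof.
move=> hg; apply/asboolP => p; set P : set A := p.
have pP : is_prime P := prime_idealP p; have [[P0 PD PM] P1 Pp] := pP.
have [s [a [ns hsa]]] : exists s a, ~ P s /\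
    forall Q : set B, is_prime Q -> (forall b, Q (f b) <-> P b) -> Q (f s * g - f a).
  have [[Q1 [pQ1 QP1]]|nQ] := pselect (exists Q : set B, is_prime Q /\ (forall b, Q (f b) <-> P b));
    last first.
    (* Without a prime over P the ring B_p is zero and any fraction will do. *)
    by exists 1, 0; split=> // Q pQ QP; exfalso; apply: nQ; exists Q.
  have [s1 [a1 [ns1 h1]]] := constant_degree_one hg pP pQ1 QP1.
  exists s1, a1; split=> // Q2 pQ2 QP2.
  have [s2 [a2 [ns2 h2]]] := constant_degree_one hg pP pQ2 QP2.
  have Pe : P (s1 * a2 - s2 * a1).
    apply: contrapT => ne.
    have [|eta [pe eP eh]] := @prime_nullstellensatz R A kA n x P (s1 * s2 * (s1 * a2 - s2 * a1)) surj_x pP.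
      by move=> /Pp[/Pp[]|].
    have lift (Q : set B) : is_prime Q -> (forall b, Q (f b) <-> P b) ->
        exists e : {rmorphism B -> C}, [/\ is_point kB e, forall b, Q b -> e b = 0 &
          forall b, e (f b) = eta b].
      move=> [hQ _ _] QP; apply: (@point_lift R B kB A f eta integral_f kA Q) => // b /QP; exact: eP.
    have [e1 [pe1 eQ1 ef1]] := lift Q1 pQ1 QP1.
    have [e2 [pe2 eQ2 ef2]] := lift Q2 pQ2 QP2.
    have eg : e1 g = e2 g by apply: hg => // b; rewrite ef1 ef2.
    have := eQ1 _ h1; have := eQ2 _ h2; rewrite !rmorphB !rmorphM !ef1 !ef2 eg.
    move=> /eqP; rewrite subr_eq0 => /eqP e2a /eqP; rewrite subr_eq0 => /eqP e1a.
    move: eh; rewrite !rmorphM rmorphB !rmorphM -e1a -e2a.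
    by rewrite [eta s1 * (eta s2 * _)]mulrCA subrr mulr0 eqxx.
  have [hQ _ Qp] := pQ2; have [Q20 Q2D Q2M] := hQ.
  have : Q2 (f s2 * (f s1 * g - f a1)).
    have -> : f s2 * (f s1 * g - f a1) = f s1 * (f s2 * g - f a2) + f (s1 * a2 - s2 * a1).
      by rewrite rmorphB !rmorphM; ring.
    by apply: Q2D; [exact: Q2M|exact/QP2].
  by move=> /Qp[/QP2|].
exists (loc_frac (prime_compl f p) (f a) (f s)), (loc_in (prime_compl f p) g -
  loc_frac (prime_compl f p) (f a) (f s)).
have Ss : prime_compl f p (f s) by exists s.
split; [by exists a, s| |by rewrite addrC subrK].
move=> I mI; have [hI I1 _] := mI; have [I0 ID IM] := hI.
have [_ _ Ip] := maximal_prime mI.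
pose S := prime_compl f p.
pose Q : set B := loc_in S @^-1` I.
have hQ : is_ideal Q.
  split=> [|b c Ib Ic|b c Ic]; rewrite /Q /preimage /mkset.
  - by rewrite rmorph0.
  - by rewrite rmorphD; exact: ID.
  - by rewrite rmorphM; exact: IM.
have pQ : is_prime Q.
  split=> //; rewrite /Q /preimage /mkset; first by rewrite rmorph1.
  by move=> b c; rewrite rmorphM => /Ip.
have Iu b : S b -> ~ I (loc_in S b).
  move=> Sb Ib; apply: I1; rewrite -(loc_in_unit Sb); exact: IM.
have QsP b : Q (f b) -> P b.
  by move=> Qb; apply: contrapT => nb; apply: (Iu (f b)) => //; exists b.
have QP b : Q (f b) <-> P b.
  (* An inverse c / f t of b modulo I would give [f t = c * f b] modulo Q, as in [lying_over]. *)
  split=> [/QsP//|Pb]; apply: contrapT => nI.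
  have [y Iy] := maximal_inv mI nI; have [c [d [[t nt <-] ey]]] := loc_surj y.
  apply: (nt); apply: (integral_contract (b := c) pP hQ QsP (integral_f c) Pb).
  rewrite /Q /preimage /mkset rmorphB rmorphM.
  have St : prime_compl f p (f t) by exists t.
  have -> : loc_in S (f t) - loc_in S c * loc_in S (f b) =
     (- loc_in S (f t)) * (y * loc_in S (f b) - 1).
    by rewrite mulNr mulrBr mulr1 opprB mulrA ey (loc_in_frac c St).
  exact: IM.
have : I (loc_in S (f s * g - f a)) by exact: (hsa Q pQ QP).
have -> : loc_in S (f s * g - f a) = loc_in S (f s) * (loc_in S g - loc_frac S (f a) (f s)).
  by rewrite mulrBr (loc_in_frac _ Ss) rmorphB rmorphM.
by move=> /Ip[/(Iu _ Ss)|].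
Qed.

(** At p = ker eta, g is a fraction a / s plus an element of the radical. Each point e over eta
    extends to a maximal ideal of B_p, which contains that element; hence e(g) = eta(a) / eta(s). *)
Lemma seminormal_constant (g : B) (eta : {rmorphism A -> C}) : is_point kA eta ->
  seminorm_pred f g -> exists t, forall e : {rmorphism B -> C}, is_point kB e ->
    (forall a, e (f a) = eta a) -> e g = t.
Proof.
move=> pe /asboolP sg.
pose p := Spectrum (kernel_prime eta); have [_ [r [[a [s [ns ->]]] Jr eg]]] := sg p.
exists (eta a / eta s) => e pe' ef.
have s0 : eta s != 0 by apply/eqP.
pose S := prime_compl f p.
pose I : set (localization S) := [set z | exists b t, [/\ e b = 0, eta t <> 0 &
   z = loc_frac S b (f t)]].
have Sf t : eta t <> 0 -> prime_compl f p (f t) by move=> nt; exists t.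
have hI : is_ideal I.
  split.
  - exists 0, 1; rewrite rmorph0 rmorph1; split=> //; first exact/eqP/oner_neq0.
    by rewrite rmorph1 -[LHS](rmorph0 (loc_in S)).
  - move=> _ _ [b [t [eb nt ->]]] [c [u [ec nu ->]]].
    exists (b * f u + c * f t), (t * u); split.
    + by rewrite rmorphD !rmorphM eb ec !mul0r addr0.
    + by rewrite rmorphM => /eqP; rewrite mulf_eq0 => /orP[]/eqP.
    + by rewrite loc_fracD ?rmorphM //; exact: Sf.
  - move=> y _ [b [t [eb nt ->]]]; have [c [_ [[u nu <-] ->]]] := loc_surj y.
    exists (c * b), (u * t); split.
    + by rewrite rmorphM eb mulr0.
    + by rewrite rmorphM => /eqP; rewrite mulf_eq0 => /orP[]/eqP.
    + by rewrite loc_fracM ?rmorphM //; [exists u|exact: Sf].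
pose kS : {rmorphism C -> localization S} := loc_in S \o kB.
have key b t : eta t <> 0 -> forall v c, S v -> loc_frac S b v = loc_frac S c (f t) ->
    e b * eta t = e c * e v.
  move=> nt v c Sv /(loc_frac_eq _ _ Sv (Sf _ nt))[_ [u nu <-]] h.
  have := congr1 e h; rewrite !rmorphM !ef => /mulfI; apply; exact/eqP.
have I1 : ~ I 1.
  move=> [b [t [eb nt e1]]]; have := key 1 t nt 1 b (multset1 S).
  rewrite -[X in X = _](rmorph1 (loc_in S)) in e1.
  by move=> /(_ e1); rewrite eb mul0r rmorph1 mul1r.
have mI : is_maximal I.
  apply: (@residue_maximal R _ kS I hI I1) => y.
  have [c [_ [[u nu <-] ->]]] := loc_surj y.
  have u0 : eta u != 0 by apply/eqP.
  exists (e c / eta u), (c - f u * kB (e c / eta u)), u; split=> //.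
    by rewrite rmorphB rmorphM ef pe' mulrCA divff // mulr1 subrr.
  have Su : S (f u) by exact: Sf.
  have S1 := multset1 S.
  rewrite [kS _]/= /loc_in loc_fracN // loc_fracD //.
  by apply: (loc_frac_eq _ _ _ _).2; [rewrite mulr1|exact: Su|exists 1 => //; ring].
have [b [t [eb nt er]]] := Jr I mI.
have Ss : S (f s) by apply: Sf; exact/eqP.
move: eg; rewrite er loc_fracD //; last exact: Sf.
have t0 : eta t != 0 by apply/eqP.
have st0 : eta (s * t) <> 0 by apply/eqP; rewrite rmorphM mulf_neq0.
rewrite -(rmorphM f s t) => egst.
have h := key g (s * t) st0 1 _ (multset1 S) egst.
rewrite rmorph1 mulr1 in h.
move: h; rewrite rmorphD !rmorphM !ef eb mul0r addr0 mulrA => /(mulIf t0) <-.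
by rewrite mulfK.
Qed.

End Seminormal.

(** * The seminormalization *)

Section Main.
Variables (R : realType) (X : affine_variety R).
Local Notation C := R[i].
Local Notation pt := (closed_point X).
Local Notation k := (Defs.scalar X).
Local Notation val_at := (value (Defs.scalar X)).
Local Notation n := (embdim X).
Local Notation x := (coords X).
Local Notation N := (normalization X).
Local Notation SX := (seminorm_ring X).
Local Notation tf := (to_fractions X).
Local Notation ts := (to_seminorm_ring X).
Local Notation ks := (seminorm_scalar X).

Let tn : {rmorphism X -> N} := @to_normalization X.
Let kN : {rmorphism C -> N} := tn \o k.
Let inc : {rmorphism SX -> N} := (\val : seminormalization (@to_normalization X) -> N).

Lemma to_fractions_inj a : tf a = 0 -> a = 0.
Proof. by move=> /loc_in_eq0[u ru]; exact: ru. Qed.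

Lemma to_seminorm_ring_inj a : ts a = 0 -> a = 0.
Proof.
move=> e; apply: to_fractions_inj.
by rewrite -[tf a]/(\val (\val (ts a))) e !rmorph0.
Qed.

Lemma normalization_cancel s y : regular s -> tn s * y = 0 -> y = 0.
Proof.
move=> rs e; apply: val_inj; rewrite rmorph0.
apply: (@loc_in_cancel _ (regular_elts X) s) => //.
by have := congr1 \val e; rewrite rmorphM rmorph0.
Qed.

Lemma inclusion_integral : integral_ext inc.
Proof.
move=> b; have [m [c e]] := @to_normalization_integral X b.
by exists m, (fun i => ts (c i)).
Qed.

Lemma seminorm_point (M : closed_point SX) : exists eta : {rmorphism SX -> C},
  [/\ is_point ks eta, forall b, M b <-> eta b = 0 & forall b, value ks b M = eta b].
Proof.
apply: (@closed_point_residue R SX ks) => b.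
have [e [pe me _]] := variety_point (seminorm_map M).
apply: (@residue_integral R SX ks X ts e M (maximal_prime (point_idealP M))) => [s|].
  rewrite -[ks (e s)]/(ts (k (e s))) -rmorphB.
  by apply/(me (s - k (e s))); rewrite rmorphB pe subrr.
exact: to_seminorm_ring_integral.
Qed.

Lemma value_seminorm_map (M : closed_point SX) (eta : {rmorphism SX -> C}) : is_point ks eta ->
  (forall b, M b <-> eta b = 0) -> forall a, val_at a (seminorm_map M) = eta (ts a).
Proof.
move=> pe me a; apply/valueP; rewrite -[seminorm_map M _]/(M (ts _)) me.
by rewrite !rmorphB -[ts (k _)]/(ks _) pe subrr.
Qed.

Lemma normalization_point (eta : {rmorphism SX -> C}) : is_point ks eta ->
  exists e : {rmorphism N -> C}, is_point kN e /\ forall b, e (inc b) = eta b.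
Proof.
move=> pe.
have [||||e [pe' _ ee]] := @point_lift R N kN SX inc eta inclusion_integral ks [set 0].
- by [].
- exact: pe.
- exact: zero_ideal.
- by move=> b /= e0; rewrite (_ : b = 0) ?rmorph0 //; apply: val_inj; rewrite [LHS]e0 rmorph0.
by exists e.
Qed.

Lemma point_seminorm_map (m : pt) (eta : {rmorphism SX -> C}) : is_point ks eta ->
  (forall a, val_at a m = eta (ts a)) ->
  exists M : closed_point SX, seminorm_map M = m /\ (forall b, value ks b M = eta b).
Proof.
move=> pe hm; have [M [hM vM]] := closed_point_of pe.
exists M; split=> //; apply: closed_point_eq => a.
have [e [_ me ve]] := variety_point m.
by rewrite -[seminorm_map M a]/(M (ts a)) hM -hm me ve.
Qed.

Lemma seminorm_map_surj (m : pt) : exists M : closed_point SX, seminorm_map M = m.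
Proof.
have [e [pe me ve]] := variety_point m.
have [||||eta [peta _ ee]] := @point_lift R SX ks X ts e (@to_seminorm_ring_integral R X) k [set 0].
- by [].
- exact: pe.
- exact: zero_ideal.
- by move=> a /= /to_seminorm_ring_inj ->; rewrite rmorph0.
have [|M [<- _]] := @point_seminorm_map m eta peta; last by exists M.
by move=> a; rewrite ve ee.
Qed.

Lemma seminorm_ring_fraction (g : SX) : exists s a, regular s /\ ts s * g = ts a.
Proof.
have [a [s [rs e]]] := loc_surj (\val (\val g)).
exists s, a; split=> //; apply: val_inj; apply: val_inj; rewrite !rmorphM.
transitivity (tf s * \val (\val g)); first by [].
by rewrite e; exact: loc_in_frac.
Qed.

(** A difference with zero values is a fraction a / s; a vanishes on X because the map of points is
    surjective, so a = 0 as X is reduced. *)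
Lemma value_seminorm_inj (g g' : SX) : value ks g = value ks g' -> g = g'.
Proof.
move=> e; apply/eqP; rewrite -subr_eq0; apply/eqP; set d := g - g'.
have [s [a [rs esd]]] := seminorm_ring_fraction d.
have a0 : a = 0.
  apply: contrapT => /reduced_nullstellensatz[eta [pe ea]].
  have [m [_ vm]] := closed_point_of pe; have [M eM] := seminorm_map_surj m.
  have [etaM [pM mM vM]] := seminorm_point M.
  have d0 : etaM d = 0 by rewrite rmorphB -!vM e subrr.
  case/negP: ea; rewrite -vm -eM (value_seminorm_map pM mM) -esd rmorphM d0 mulr0.
  exact/eqP.
apply: val_inj; rewrite rmorph0; apply: (@normalization_cancel s) => //.
by have := congr1 inc esd; rewrite a0 rmorphM !rmorph0.
Qed.

Lemma K0_seminorm (f : K0 X) : exists g : SX, value ks g = val f \o @seminorm_map R X.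
Proof.
have /asboolP[rf cf] := valP f.
have [s [a [rs sf]]] := rational_fraction rf.
pose g0 := loc_frac (regular_elts X) a s.
have eg0 : tf s * g0 = tf a by exact: (@loc_in_frac X (regular_elts X) a s rs).
have ig := integral_fraction cf sf rs eg0.
pose g1 : N := exist _ g0 (asboolT ig).
have eg1 : tn s * g1 = tn a by apply: val_inj; rewrite rmorphM.
have cancel y := @normalization_cancel s y rs.
(* All points of the normalization over m give g1 the value f(m): this is the constancy on fibres
   required below. *)
have vg (e : {rmorphism N -> C}) m : is_point kN e -> (forall c, e (tn c) = val_at c m) ->
    e g1 = val f m.
  by move=> pe ee; apply: (fraction_value cf sf eg1 cancel pe ee).
have sg : seminorm_pred (@to_normalization X) g1.
  apply: (@seminormal_of_constant R X N tn k n x (@coords_surj R X) (@to_normalization_integral X)).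
  move=> e1 e2 pe1 pe2 e12.
  pose e1' : {rmorphism X -> C} := e1 \o tn.
  have [m [_ vm]] := closed_point_of (pe1 : is_point k e1').
  by rewrite (vg e1 m) // (vg e2 m) // => c; rewrite vm -e12.
exists (exist _ g1 sg : SX); apply/funext => M /=.
have [eta [pe me ve]] := seminorm_point M.
have [e [pe' ee]] := normalization_point pe.
rewrite ve -ee; apply: vg => // c.
by rewrite (value_seminorm_map pe me) -ee.
Qed.

Lemma seminorm_ring_integral_ev : integral_ext (ev ks (ts \o x) n).
Proof.
move=> b; have [m [c e]] := @to_seminorm_ring_integral R X b.
have /choice[p hp] (i : 'I_m) := coords_surj (c i).
exists m, p; rewrite -[RHS]e; congr (_ + _); apply: eq_bigr => i _.
by rewrite -(rmorph_ev (k := k) x (p i) (g := ts)) // hp.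
Qed.

Lemma seminorm_K0 (g : SX) : exists f : K0 X, value ks g = val f \o @seminorm_map R X.
Proof.
have /choice[f hf] (m : pt) : exists t, forall M, seminorm_map M = m -> value ks g M = t.
  have [e [pe me ve]] := variety_point m.
  have [t ht] := @seminormal_constant R X N tn k (inc g) e pe (valP g).
  exists t => M eM; have [eta [peta meta veta]] := seminorm_point M.
  have [e' [pe' ee']] := normalization_point peta.
  rewrite veta -ee'; apply: ht => // a.
  by rewrite -ve -eM (value_seminorm_map peta meta) -ee'.
have [s [a [rs esg]]] := seminorm_ring_fraction g.
have sf m : val_at s m * f m = val_at a m.
  have [M eM] := seminorm_map_surj m; have [eta [pe me ve]] := seminorm_point M.
  by rewrite -(hf m M eM) -eM !(value_seminorm_map pe me) ve -rmorphM esg.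
have rf : Defs.rational f.
  exists [set m : pt | ~ [set s] `<=` m]; split.
  - by exists [set s].
  (* Density of the locus where s is nonzero: s is regular, so [s * h] is nonzero and does not
     vanish somewhere. *)
  - move=> _ [I ->] [m /= /existsNP[h /not_implyP[Ih nh]]].
    have h0 : h <> 0 by move=> e; apply: nh; rewrite e; have [[]] := point_idealP m.
    have [|eta [pe e0]] := @reduced_nullstellensatz R X (s * h); first by move=> /rs.
    have [q [hq _]] := closed_point_of pe; exists q.
    move: e0; rewrite rmorphM mulf_eq0 negb_or => /andP[es eh].
    split=> /= hs; [move: eh|move: es]; have := hs _; first by move=> /(_ h Ih)/hq ->; rewrite eqxx.
    by move=> /(_ s erefl)/hq ->; rewrite eqxx.
  - move=> m Um; exists [set m : pt | ~ [set s] `<=` m], a, s; split=> //; first by exists [set s].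
    move=> q /= Uq; have s0 : val_at s q != 0.
      apply/eqP => e; apply: Uq => _ ->; have [eta [_ mq vq]] := variety_point q.
      by apply/mq; rewrite -vq.
    by split=> //; rewrite -sf mulrC mulKf.
have cf : euclidean_continuous f.
  apply/euclidean_continuousP => m eps e0.
  (* Agreement on the coordinates means lying over m, so this is the constancy of g on the fibre in
     the form needed by [near_fiber]. *)
  have fib (eta : {rmorphism SX -> C}) : is_point ks eta ->
      (forall i, (i < n)%N -> eta ((ts \o x) i) = val_at (x i) m) -> eta g = f m.
    move=> pe ex; have [e [pe' me ve]] := variety_point m.
    have [|M [eM vM]] := @point_seminorm_map m eta pe; last by rewrite -vM; exact: hf.
    move=> b; have [P <-] := coords_surj b; rewrite ve.
    rewrite (rmorph_ev (l := ks) x P (g := ts)) // (point_ev _ _ pe) (point_ev _ _ pe').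
    by apply: ev_ext => i lt; rewrite /= -ve -ex.
  have [d d0 hd] := near_fiber seminorm_ring_integral_ev fib e0.
  exists d => // m' hm'; have [M eM] := seminorm_map_surj m'.
  have [eta [pe me ve]] := seminorm_point M.
  rewrite -(hf m' M eM) ve; apply: (hd (fun i => val_at (x i) m')) => // i lt.
  by rewrite -eM (value_seminorm_map pe me).
have Kf : K0_pred f by apply/asboolP.
exists (exist _ f Kf); apply/funext => M /=; exact: hf.
Qed.

End Main.

(* [value _ g] is the function on X^+(C) defined by g in C[X^+]. *)
Theorem mainTheorem2 (R : realType) (X : affine_variety R) :
  (forall f : K0 X, exists! g : seminorm_ring X,
      value (seminorm_scalar X) g = val f \o @seminorm_map R X) /\
  (exists phi : {rmorphism K0 X -> seminorm_ring X},
      (forall f : K0 X,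
          value (seminorm_scalar X) (phi f) = val f \o @seminorm_map R X) /\
      bijective phi).
Proof.
have ex := @K0_seminorm R X; split.
  move=> f; have [g eg] := ex f; exists g; split=> // g' eg'.
  by apply: value_seminorm_inj; rewrite eg eg'.
have [phi hphi] := choice ex.
(* As values determine an element of C[X^+], the morphism laws can be checked pointwise. *)
have phiP f g : value (seminorm_scalar X) g = val f \o @seminorm_map R X -> phi f = g.
  by move=> eg; apply: value_seminorm_inj; rewrite hphi eg.
have pa : zmod_morphism phi.
  move=> f g; apply: phiP; apply/funext => M; have [eta [_ _ ve]] := seminorm_point M.
  rewrite ve rmorphB -!ve !hphi /=.
  by rewrite -[RHS]/((val (f - g)) (seminorm_map M)) rmorphB.
have pm : monoid_morphism phi.
  split=> [|f g]; apply: phiP; apply/funext => M; have [eta [_ _ ve]] := seminorm_point M.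
    by rewrite ve rmorph1 -[RHS]/((val (1 : K0 X)) (seminorm_map M)) rmorph1.
  rewrite ve rmorphM -!ve !hphi /=.
  by rewrite -[RHS]/((val (f * g)) (seminorm_map M)) rmorphM.
pose phi' : {rmorphism K0 X -> seminorm_ring X} := HB.pack phi
  (GRing.isZmodMorphism.Build (K0 X) (seminorm_ring X) phi pa)
  (GRing.isMonoidMorphism.Build (K0 X) (seminorm_ring X) phi pm).
exists phi'; split=> //.
have [psi hpsi] := choice (@seminorm_K0 R X).
exists psi => [f|g]; last exact: phiP.
apply: val_inj; apply/funext => m; have [M <-] := seminorm_map_surj m.
by have := congr1 (fun h => h M) (hpsi (phi f)); rewrite hphi /= => ->.
Qed.
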